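(* Suppose that $T$ is a computable real with $0<T<1$. Let $V$ and $W$ be optimal prefix-free machines, and let $f\colon\mathbb{N}\to\mathbb{N}$ be an order function. Then the following two conditions are equivalent: (i) There exists $c\in\mathbb{N}$ such that $\mathrm{Pf}(Z_V(T))$ is reducible to $\operatorname{dom}W$ in query size $f(n)+c$ (that is, in query size given by the function $n\mapsto f(n)+c$). (ii) There exists $c\in\mathbb{N}$ such that $Tn\le f(n)+c$ for all $n\in\mathbb{N}$.
   Context: $\{0,1\}^*$ is the set of finite binary strings and $|x|$ is the length of $x$. A prefix-free machine is a partial recursive function $F\colon\{0,1\}^*\to\{0,1\}^*$ whose domain $\operatorname{dom}F$ is prefix-free. A prefix-free machine $V$ is optimal if for each prefix-free machine $F$ there exists $d\in\mathbb{N}$ such that for every $p\in\operatorname{dom}F$ there is $q\in\operatorname{dom}V$ with $V(q)=F(p)$ and $|q|\le|p|+d$. For a real $T$ with $0<T\le1$, $Z_V(T)=\sum_{p\in\operatorname{dom}V}2^{-|p|/T}$, which converges with $0<Z_V(T)<1$. A real $\alpha$ is computable if there is a computable sequence $\{a_n\}_{n\in\mathbb{N}}$ of rationals with $|\alpha-a_n|<2^{-n}$ for all $n\in\mathbb{N}$. For a real $\alpha$ and $n\in\mathbb{N}$, $\alpha\!\upharpoonright_n\in\{0,1\}^*$ denotes the first $n$ bits of the base-two expansion of $\alpha-\lfloor\alpha\rfloor$ with infinitely many zeros, and $\mathrm{Pf}(\alpha)=\{\alpha\!\upharpoonright_n\mid n\in\mathbb{N}\}\subset\{0,1\}^*$.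 For $f\colon\mathbb{N}\to\mathbb{N}$ and $A,B\subset\{0,1\}^*$, $A$ is reducible to $B$ in query size $f$ if there exists an oracle deterministic Turing machine $M$ such that $A$ is Turing reducible to $B$ via $M$ and, on every input $x\in\{0,1\}^*$, $M$ only queries strings of length at most $f(|x|)$. An order function is a non-decreasing total recursive function $f\colon\mathbb{N}\to\mathbb{N}$ with $\lim_{n\to\infty}f(n)=\infty$. *)

(* Defs.v *)
From HB Require Import structures.
From mathcomp Require Import all_boot all_order all_algebra.
From mathcomp Require Import all_classical all_reals all_analysis.
Set Implicit Arguments.
Unset Strict Implicit.
Unset Printing Implicit Defensive.
Import Order.TTheory GRing.Theory Num.Theory.
Import numFieldNormedType.Exports.

Local Open Scope classical_set_scope.
Local Open Scope ring_scope.

Notation bstr := (seq bool).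

(** * Oracle Turing machines *)

(* Tape cells hold 0, 1 or blank (None). *)
Notation cell := (option bool).

Inductive move := MoveLeft | Stay | MoveRight.

(* A deterministic machine with k+2 two-way infinite tapes.  Tape [ord0] is
   used for the input and the output, and tape [ord_max] is the query tape.
   In a state q with [otm_query q = Some (yes, no)] the machine asks the oracle
   about the string on the query tape and enters [yes] or [no]; in any other
   non-halting state it applies [otm_trans]. *)
Record otm := OTM {
  otm_state : finType;
  otm_work : nat;
  otm_start : otm_state;
  otm_halt : pred otm_state;
  otm_query : otm_state -> option (otm_state * otm_state);
  otm_trans : otm_state -> {ffun 'I_otm_work.+2 -> cell} ->
              otm_state * {ffun 'I_otm_work.+2 -> cell * move}
}.

(* The pair (l, r) is the tape whose cells to the left of the head, read
   leftwards, are l, and whose cells from the scanned one on, read rightwards,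
   are r; all other cells are blank. *)
Definition tape : Type := seq cell * seq cell.

Definition tape_read (t : tape) : cell := head None t.2.

Definition tape_act (a : cell * move) (t : tape) : tape :=
  let: (l, r) := (t.1, a.1 :: behead t.2) in
  match a.2 with
  | MoveLeft => (behead l, head None l :: r)
  | Stay => (l, r)
  | MoveRight => (head None r :: l, behead r)
  end.

Definition tape_of_string (x : bstr) : tape := ([::], map Some x).

Fixpoint bits_until_blank (s : seq cell) : bstr :=
  if s is Some b :: s' then b :: bits_until_blank s' else [::].

(* The string on a tape starts at the head and ends before the first blank. *)
Definition string_of_tape (t : tape) : bstr := bits_until_blank t.2.

Definition config (M : otm) : Type :=
  otm_state M * {ffun 'I_(otm_work M).+2 -> tape}.

Definition init (M : otm) (x : bstr) : config M :=
  (otm_start M,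
   [ffun i => if i == ord0 then tape_of_string x else tape_of_string [::]]).

Definition halted (M : otm) (c : config M) : bool := otm_halt c.1.

Definition output (M : otm) (c : config M) : bstr := string_of_tape (c.2 ord0).

Definition query_string (M : otm) (c : config M) : bstr :=
  string_of_tape (c.2 ord_max).

Definition step (M : otm) (B : set bstr) (c : config M) : config M :=
  if halted c then c else
  if otm_query c.1 is Some (yes, no) then
    (if query_string c \in B then yes else no, c.2)
  else
    let qa := otm_trans c.1 [ffun i => tape_read (c.2 i)] in
    (qa.1, [ffun i => tape_act (qa.2 i) (c.2 i)]).

Definition run (M : otm) (B : set bstr) (x : bstr) (t : nat) : config M :=
  iter t (step B) (init M x).

Definition outputs (M : otm) (B : set bstr) (x y : bstr) : Prop :=
  exists t, halted (run M B x t) /\ output (run M B x t) = y.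

Definition queries (M : otm) (B : set bstr) (x w : bstr) : Prop :=
  exists t, [/\ ~~ halted (run M B x t),
                otm_query (run M B x t).1 != None &
                query_string (run M B x t) = w].

(* The answers "yes" and "no" are the strings 1 and 0. *)
Definition turing_reducible_via (M : otm) (A B : set bstr) : Prop :=
  forall x, outputs M B x [:: x \in A].

Definition reducible_in_query_size (f : nat -> nat) (A B : set bstr) : Prop :=
  exists M : otm, turing_reducible_via M A B /\
    forall x w, queries M B x w -> (size w <= f (size x))%N.

(** * Partial recursive functions *)

Definition oracle_free (M : otm) : Prop := forall q : otm_state M, otm_query q = None.

(* The oracle set0 is irrelevant, as it is never consulted. *)
Definition partial_recursive (F : bstr -> option bstr) : Prop :=
  exists M : otm, oracle_free M /\
    forall x y, F x = Some y <-> outputs M set0 x y.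

Definition string_of_nat (n : nat) : bstr := nseq n true.

Definition total_recursive (g : nat -> nat) : Prop :=
  exists F, partial_recursive F /\
    forall n, F (string_of_nat n) = Some (string_of_nat (g n)).

Definition order_function (f : nat -> nat) : Prop :=
  [/\ total_recursive f,
      {homo f : m n / (m <= n)%N} &
      f n @[n --> \oo] --> \oo].

(** * Prefix-free machines *)

Definition dom (F : bstr -> option bstr) : set bstr := [set p | F p != None].

Definition prefix_free (A : set bstr) : Prop :=
  forall p q, A p -> A q -> prefix p q -> p = q.

Definition prefix_free_machine (F : bstr -> option bstr) : Prop :=
  partial_recursive F /\ prefix_free (dom F).

Definition optimal_machine (V : bstr -> option bstr) : Prop :=
  prefix_free_machine V /\
  forall F, prefix_free_machine F ->
    exists d : nat, forall p, dom F p ->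
      exists q, [/\ dom V q, V q = F p & (size q <= size p + d)%N].

(** * Reals *)

Definition computable_rat_seq (a : nat -> rat) : Prop :=
  exists s u v : nat -> nat,
    [/\ total_recursive s, total_recursive u, total_recursive v &
        forall n, v n <> 0%N /\ a n = (-1) ^+ s n * (u n)%:R / (v n)%:R].

Definition computable_real (R : realType) (alpha : R) : Prop :=
  exists a : nat -> rat, computable_rat_seq a /\
    forall n : nat, `|alpha - ratr (a n)| < 2 ^- n.

Definition Z (R : realType) (V : bstr -> option bstr) (T : R) : R :=
  fine (\esum_(p in dom V) (2 `^ (- ((size p)%:R / T)))%:E)%E.

(* b is the base-two expansion of the fractional part of alpha with infinitely
   many zeros. *)
Definition base_two_expansion (R : realType) (alpha : R) (b : nat -> bool) : Prop :=
  (forall N, exists2 k, (N <= k)%N & b k = false) /\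
  series (fun k => (b k)%:R / 2 ^+ k.+1 : R) @ \oo
    --> alpha - (Num.floor alpha)%:~R.

Definition Pf (R : realType) (alpha : R) : set bstr :=
  [set x | exists b n, base_two_expansion alpha b /\ x = mkseq b n].

(* Main.v *)
Require Import Defs.
From mathcomp Require Import all_boot all_order all_algebra.
From mathcomp Require Import all_classical all_reals all_analysis.
From mathcomp Require Import zify ring lra.
Set Implicit Arguments.
Unset Strict Implicit.
Unset Printing Implicit Defensive.
Local Open Scope nat_scope.

(** Write [Z] for [Z V T], [w k] for the weight [2 ^ (- k / T)] of a program of length
    [k], and let a machine be run in stages.  The argument has two halves, both built on
    one observation: knowing which strings of length at most [m] are in [dom W] costs as
    much as a program of length [m + O(1)], the length [m] included, and not more.
    Indeed, if an enumeration of events is such that the sum of [2 ^ - (length)] over all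
    events of all levels is finite, then the Kraft-Chaitin theorem ([kraft_machine],
    [event_machine]) provides a prefix-free machine that describes every event by a
    string of the length allotted to its level, up to a constant, and an optimal machine
    does as well.  The last event of a level ([last_event]) carries all that has to be
    known about the level.

    From the bound on [f] to the reduction ([Pf_reducible]): the events at level [n] are
    the changes of the first [n] bits of the approximations of [Z] from below, and they
    are allotted [f n + O(1) >= T * n] bits.  A program of length [k] that is discovered
    moves [Z] by [w k], so it is responsible for about [min 1 (2 ^ n * w k)] changes at
    level [n].  Weighted by [2 ^ (- T * n)] and summed over [n], this gives one series
    growing at rate [2 ^ (1 - T)] up to [n = k / T] and one decaying at rate [2 ^ - T]
    from there; as [0 < T < 1], both are geometric and bounded by a multiple of their
    terms at [n = k / T], that is of [2 ^ - k] ([geometric_min], [zevent_weights]).  By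
    the Kraft inequality the total is finite.  So [W] describes the stage of the last
    change at level [n] by a program of length [f n + O(1)].  A machine that learns from
    its oracle how many strings up to this length are in [dom W] can wait for all of them
    and read the stage off their outputs.

    From the reduction to the bound on [f] ([jump_bound], [bound_of_jumps]): the events at
    level [n] are the discoveries of strings of length at most [f n + c] in [dom W].  If
    only one level is kept for each value of [f], a string [p] is counted at most once for
    each [m >= size p], with weight [2 ^ - m], so the total is again bounded by the Kraft
    inequality ([event_weights]).  The last event of level [n] gives the part of the
    oracle that the reduction needs for the first [n] bits of [Z], hence a stage at which
    all programs of [V] shorter than about [T * n] have halted, since a program of length
    [k] that is still missing keeps the approximation [w k] away from [Z]
    ([Zpart_missing]).  A string that is no output of [V] by this stage is thus described
    by [f n + O(1)] bits, but by no program of [V] shorter than [T * n - O(1)].  Optimality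
    of [V] leaves only [T * n <= f n + O(1)].

    All machines are obtained from functions on the naturals.  The class [computable] is
    closed under the usual recursions and minimization; it contains the step functions of
    all Turing machines, for finite oracles given as numbers ([comp3_simh],
    [comp3_simo]); its members are implemented by programs working on stacks
    ([comp_implemented]), and these are compiled to Turing machines ([exec_reach]).  As
    every machine needed here consists of an unbounded search, preceded at most by a set
    of questions determined by the input, two constructions are enough: [partial_recursive_search] and
    [oracle_search_machine]. *)

(** * Stack programs and their compilation to Turing machines *)

Definition store := nat -> bstr.

Definition upd (st : store) (r : nat) (v : bstr) : store :=
  fun i => if i == r then v else st i.

(** A structured language in which every operation is a bounded number of moves of a
    Turing machine that holds each stack on a tape of its own, with the top under the
    head.  Emptying a stack bit by bit is the only loop. *)
Inductive cmd :=
| Skip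
| Push of nat & bool
| Seq of cmd & cmd
| While of nat & cmd & cmd
| Ask of nat.

Section Exec.
Variables (B : set bstr) (Q : bstr -> Prop) (q : nat).

(** [q] is the query stack.  The predicate [Q] on the strings asked about is how the query
    size is followed through an execution. *)
Inductive exec : cmd -> store -> store -> Prop :=
| ESkip st : exec Skip st st
| EPush r b st : exec (Push r b) st (upd st r (b :: st r))
| ESeq c1 c2 st st1 st2 :
    exec c1 st st1 -> exec c2 st1 st2 -> exec (Seq c1 c2) st st2
| EWhileNil r c0 c1 st : st r = [::] -> exec (While r c0 c1) st st
| EWhileCons r c0 c1 b s st st1 st2 :
    st r = b :: s -> exec (if b then c1 else c0) (upd st r s) st1 ->
    exec (While r c0 c1) st1 st2 -> exec (While r c0 c1) st st2
| EAsk r st : Q (st q) ->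
    exec (Ask r) st (if st q \in B then upd st r (true :: st r) else st).

End Exec.

Fixpoint regs_below (n : nat) (c : cmd) : bool :=
  match c with
  | Skip => true
  | Push r _ => r < n
  | Seq c1 c2 => regs_below n c1 && regs_below n c2
  | While r c0 c1 => [&& r < n, regs_below n c0 & regs_below n c1]
  | Ask r => r < n
  end.

Fixpoint ask_free (c : cmd) : bool :=
  match c with
  | Seq c1 c2 => ask_free c1 && ask_free c2
  | While _ c0 c1 => ask_free c0 && ask_free c1
  | Ask _ => false
  | _ => true
  end.

Inductive instr :=
| IPush of nat & bool
| IPop of nat & nat & nat & nat
| IAsk of nat & nat
| IJump of nat
| IHalt.

Fixpoint clen (c : cmd) : nat :=
  match c with
  | Skip => 0
  | Push _ _ => 1
  | Seq c1 c2 => clen c1 + clen c2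
  | While _ c0 c1 => (clen c0 + clen c1).+3
  | Ask _ => 2
  end.

Fixpoint assemble (c : cmd) (p : nat) : seq instr :=
  match c with
  | Skip => [::]
  | Push r b => [:: IPush r b]
  | Seq c1 c2 => assemble c1 p ++ assemble c2 (p + clen c1)
  | While r c0 c1 =>
      [:: IPop r (p + clen (While r c0 c1)) p.+1 (p + clen c0).+2] ++
      (assemble c0 p.+1 ++ [:: IJump p]) ++
      (assemble c1 (p + clen c0).+2 ++ [:: IJump p])
  | Ask r => [:: IAsk p.+1 p.+2; IPush r true]
  end.

Lemma size_assemble c p : size (assemble c p) = clen c.
Proof.
elim: c p => //= [c1 h1 c2 h2|r c1 h1 c2 h2] p; rewrite !size_cat /=.
  by rewrite h1 h2.
by rewrite h1 h2 /=; lia.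
Qed.

(** A block is compiled for a fixed address, and its correctness has to be stated inside an
    arbitrary program that contains it there. *)
Definition code_at (prog : seq instr) (p : nat) (l : seq instr) : Prop :=
  p + size l <= size prog /\
  forall i, i < size l -> nth IHalt prog (p + i) = nth IHalt l i.

Lemma code_at_cat prog p l1 l2 : code_at prog p (l1 ++ l2) <->
  code_at prog p l1 /\ code_at prog (p + size l1) l2.
Proof.
rewrite /code_at size_cat; split.
  move=> [le h]; split; split; try lia.
    by move=> i il; rewrite h ?nth_cat ?il //; lia.
  move=> i il; rewrite -addnA h; last lia.
  by rewrite nth_cat ifN ?addKn // -leqNgt leq_addr.
move=> [[le1 h1] [le2 h2]]; split; first lia.
move=> i il; rewrite nth_cat; case: ltnP => hi; first exact: h1.
by rewrite -h2 ?[in RHS]addnA; [congr nth|]; lia.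
Qed.

Lemma code_at1 prog p i : code_at prog p [:: i] ->
  p < size prog /\ nth IHalt prog p = i.
Proof. by move=> [le h]; split; [move: le => /=; lia|rewrite -[p]addn0 h]. Qed.

Definition is_halt (i : instr) : bool := if i is IHalt then true else false.

Section Machine.
Variables (k : nat) (prog : seq instr).

Definition mstate : Type := ('I_(size prog).+1 * bool)%type.

Definition goto (p : nat) : mstate := (inord p, false).

Definition fetch (s : mstate) : instr := nth IHalt prog s.1.

Definition mquery (s : mstate) : option (mstate * mstate) :=
  if s.2 then None else
  if fetch s is IAsk jy jn then Some (goto jy, goto jn) else None.

(** Pushing takes two steps: the head moves left, and then the new bit is
    written; the boolean in the state tells the two phases apart. *)
Definition mtrans (s : mstate) (rd : {ffun 'I_k.+2 -> cell}) :
    mstate * {ffun 'I_k.+2 -> cell * move} :=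
  match fetch s with
  | IPush r b =>
      if s.2 then (goto s.1.+1,
        [ffun i : 'I_k.+2 => if (i : nat) == r then (Some b, Stay) else (rd i, Stay)])
      else ((s.1, true),
        [ffun i : 'I_k.+2 => if (i : nat) == r then (rd i, MoveLeft) else (rd i, Stay)])
  | IPop r je j0 j1 =>
      if rd (inord r) is Some b then (goto (if b then j1 else j0),
        [ffun i : 'I_k.+2 => if (i : nat) == r then (None, MoveRight) else (rd i, Stay)])
      else (goto je, [ffun i : 'I_k.+2 => (rd i, Stay)])
  | IJump j => (goto j, [ffun i : 'I_k.+2 => (rd i, Stay)])
  | _ => (s, [ffun i : 'I_k.+2 => (rd i, Stay)])
  end.

Definition machine : otm :=
  @OTM mstate k (goto 0) (fun s => is_halt (fetch s)) mquery mtrans.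

Definition tape_holds (t : tape) (s : bstr) : Prop :=
  all (fun c => c == None) t.1 /\ exists j, t.2 = map Some s ++ nseq j None.

Lemma tape_holds_string t s : tape_holds t s -> string_of_tape t = s.
Proof.
case: t => l r [_ [j /= ->]]; rewrite /string_of_tape /=.
by elim: s => [|b s /= ->] //; case: j.
Qed.

Lemma tape_holds_init s : tape_holds (tape_of_string s) s.
Proof. by split=> //; exists 0; rewrite /= cats0. Qed.

Lemma tape_holds_stay t s : tape_holds t s ->
  tape_holds (tape_act (tape_read t, Stay) t) s.
Proof.
case: t => l r [al [j /= ->]]; split=> //=; rewrite /tape_read /=.
case: s => [|b s] /=; last by exists j.
by case: j => [|j]; [exists 1|exists j.+1].
Qed.

Lemma tape_holds_push t s b : tape_holds t s ->
  let t' := tape_act (tape_read t, MoveLeft) t in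
  tape_holds (tape_act (Some b, Stay) t') (b :: s).
Proof.
move=> h; have [_ [j]] := tape_holds_stay h; case: t h => l r [al _] /=.
rewrite /tape_act /tape_read /= => e; split => /=; first by case: l al => //= ? ? /andP[].
by exists j; rewrite e.
Qed.

Lemma tape_read_holds t s : tape_holds t s -> tape_read t = ohead s.
Proof. by case: t => l r [al [j /= ->]]; case: s => [|b s] //; case: j. Qed.

Lemma tape_holds_pop t s b : tape_holds t (b :: s) ->
  tape_holds (tape_act (None, MoveRight) t) s.
Proof. by case: t => l r [al [j /= ->]]; split=> //=; exists j. Qed.

Variables (B : set bstr) (Q : bstr -> Prop).
Let q := k.+1.

Definition represents (p : nat) (st : store) (c : config machine) : Prop :=
  c.1 = goto p /\ forall i : 'I_k.+2, tape_holds (c.2 i) (st i).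

Lemma represents_init x :
  represents 0 (upd (fun=> [::]) 0 x) (init machine x).
Proof.
split=> // i; rewrite /= ffunE /upd -val_eqE /=.
by case: eqP => _; apply: tape_holds_init.
Qed.

(** Halting configurations are absorbing, so a run that is quiet up to a halting
    configuration asks only what its quiet part asks. *)
Definition quiet (M : otm) (c : config M) : Prop :=
  ~~ halted c /\ (otm_query c.1 != None -> Q (query_string c)).

Definition reach (n : nat) (c c' : config machine) : Prop :=
  iter n (step B) c = c' /\ forall j, j < n -> quiet (iter j (step B) c).

Lemma reach1 c : quiet c -> reach 1 c (step B c).
Proof. by move=> h; split=> // -[]. Qed.

Lemma reach_trans n1 n2 c1 c2 c3 :
  reach n1 c1 c2 -> reach n2 c2 c3 -> reach (n2 + n1) c1 c3.
Proof.
move=> [e1 h1] [e2 h2]; split; first by rewrite iterD e1.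
move=> j jn; case: (ltnP j n1) => hj; first exact: h1.
by rewrite -(subnK hj) iterD e1; apply: h2; lia.
Qed.

Lemma fetch_goto p : p <= size prog -> fetch (goto p) = nth IHalt prog p.
Proof. by move=> ple; rewrite /fetch /= inordK. Qed.

Lemma represents_fetch p st c : p <= size prog -> represents p st c ->
  fetch c.1 = nth IHalt prog p.
Proof. by move=> ple [-> _]; rewrite fetch_goto. Qed.

Lemma represents_halted p st c : p <= size prog -> represents p st c ->
  halted c = is_halt (nth IHalt prog p).
Proof. by move=> ple h; rewrite /halted /= (represents_fetch ple h). Qed.

Lemma represents_quiet p st c : p <= size prog -> represents p st c ->
  ~~ is_halt (nth IHalt prog p) ->
  (forall jy jn, nth IHalt prog p <> IAsk jy jn) -> quiet c.
Proof.
move=> ple h nh na; split; first by rewrite (represents_halted ple h).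
rewrite /= /mquery (represents_fetch ple h).
by case: h => -> _ /=; case: nth na => // jy jn /(_ jy jn).
Qed.

Lemma step_trans (c : config machine) : ~~ halted c -> mquery c.1 = None ->
  step B c = let qa := mtrans c.1 [ffun i => tape_read (c.2 i)] in
             (qa.1, [ffun i => tape_act (qa.2 i) (c.2 i)]).
Proof. by move=> nh nq; rewrite /step (negbTE nh) /= nq. Qed.

Lemma step_push p r b st c : p < size prog -> nth IHalt prog p = IPush r b ->
  represents p st c ->
  exists c', reach 2 c c' /\ represents p.+1 (upd st r (b :: st r)) c'.
Proof.
move=> plt ep h; have ple := ltnW plt.
have qc : quiet c by apply: (represents_quiet ple h); rewrite ep.
have fc := represents_fetch ple h; rewrite ep in fc.
case: h => ec hc.
have ec1 : c.1.1 = p :> nat by rewrite ec /= inordK.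
have e1 : step B c = ((c.1.1, true), [ffun i : 'I_k.+2 => tape_act
    ((if (i : nat) == r then (tape_read (c.2 i), MoveLeft)
      else (tape_read (c.2 i), Stay))) (c.2 i)]).
  rewrite step_trans; [|by case: qc|by rewrite /mquery fc if_same].
  have -> : mtrans c.1 [ffun i => tape_read (c.2 i)] = ((c.1.1, true),
      [ffun i : 'I_k.+2 => if (i : nat) == r then (tape_read (c.2 i), MoveLeft)
                           else (tape_read (c.2 i), Stay)]).
    rewrite /mtrans fc [c.1.2](_ : _ = false); last by rewrite ec.
    by congr pair; apply/ffunP => i; rewrite !ffunE.
  by congr pair; apply/ffunP => i; rewrite !ffunE.
have f1 : fetch (step B c).1 = IPush r b by rewrite e1.
have q1 : quiet (step B c).
  split; first by rewrite /halted /= f1.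
  by rewrite /= /mquery f1 if_same.
have r2 := reach_trans (reach1 qc) (reach1 q1).
eexists; split; first exact: r2.
rewrite step_trans; [|by case: q1|by rewrite /mquery f1 if_same].
rewrite /mtrans f1 e1 /= ec1; split=> //= i.
rewrite !ffunE /upd; case: eqP => [e|_]; last first.
  by do 2! apply: tape_holds_stay.
by rewrite -e; apply: tape_holds_push.
Qed.

Lemma step_pop p r je j0 j1 st c : p < size prog -> r < k.+2 ->
  nth IHalt prog p = IPop r je j0 j1 -> represents p st c ->
  exists c', reach 1 c c' /\
    match st r with
    | [::] => represents je st c'
    | b :: s => represents (if b then j1 else j0) (upd st r s) c'
    end.
Proof.
move=> plt rk ep h; have ple := ltnW plt.
have qc : quiet c by apply: (represents_quiet ple h); rewrite ep.
have fc := represents_fetch ple h; rewrite ep in fc.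
case: h => ec hc.
exists (step B c); split; first exact: reach1.
rewrite step_trans; [|by case: qc|by rewrite /mquery fc if_same].
rewrite /mtrans fc ffunE (tape_read_holds (hc _)) inordK //.
case es: (st r) => [|b s] /=; split=> //= i; rewrite !ffunE.
  exact: tape_holds_stay.
rewrite /upd; case: eqP => [ei|_]; last exact: tape_holds_stay.
by apply: (@tape_holds_pop _ _ b); rewrite -es -ei.
Qed.

Lemma step_jump p j st c : p < size prog ->
  nth IHalt prog p = IJump j -> represents p st c ->
  exists c', reach 1 c c' /\ represents j st c'.
Proof.
move=> plt ep h; have ple := ltnW plt.
have qc : quiet c by apply: (represents_quiet ple h); rewrite ep.
have fc := represents_fetch ple h; rewrite ep in fc.
case: h => ec hc.
exists (step B c); split; first exact: reach1.
rewrite step_trans; [|by case: qc|by rewrite /mquery fc if_same].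
rewrite /mtrans fc /=; split=> //= i; rewrite !ffunE.
exact: tape_holds_stay.
Qed.

Lemma step_ask p jy jn st c : p < size prog -> Q (st q) ->
  nth IHalt prog p = IAsk jy jn -> represents p st c ->
  exists c', reach 1 c c' /\
    represents (if st q \in B then jy else jn) st c'.
Proof.
move=> plt hQ ep h; have ple := ltnW plt.
have fc := represents_fetch ple h; rewrite ep in fc.
case: h => ec hc.
have eq : query_string c = st q by apply: tape_holds_string (hc ord_max).
have qc : quiet c by split; rewrite ?eq // /halted /= fc.
exists (step B c); split; first exact: reach1.
rewrite /step (negbTE (proj1 qc)).
rewrite /= /mquery fc ec /= eq; split=> //=.
by case: ifP.
Qed.

Lemma while_iteration r c0 c1 b s st st1 : st r = b :: s -> r < k.+2 ->
  (forall p cf, let c := if b then c1 else c0 in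
     code_at prog p (assemble c p) -> represents p (upd st r s) cf ->
     exists n cf', reach n cf cf' /\ represents (p + clen c) st1 cf') ->
  forall p cf, code_at prog p (assemble (While r c0 c1) p) ->
  represents p st cf ->
  exists n cf', [/\ 0 < n, reach n cf cf' & represents p st1 cf'].
Proof.
move=> es rk h1 p cf; rewrite /= -cat1s => /code_at_cat[/code_at1[plt e] kk] h.
have [c' [r1 ]] := step_pop plt rk e h; rewrite es => h'.
move: kk; rewrite addn1 => /code_at_cat[] /code_at_cat[k0].
rewrite !size_assemble size_cat size_assemble /= => /code_at1[lt0 e0].
rewrite -[X in code_at _ X]/(p + (clen c0 + 1)).+1 addn1 addnS.
move=> /code_at_cat[k1]; rewrite !size_assemble => /code_at1[lt1 e1].
case: b {es} h1 h' => h1 h'.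
  have [n1 [cf1 [r1' h1']]] := h1 _ _ k1 h'.
  have [c2 [r2 h2']] := step_jump lt1 e1 h1'.
  exists (1 + (n1 + 1)), c2; split=> //.
  by apply: reach_trans r2; apply: reach_trans r1'.
have [n1 [cf1 [r1' h1']]] := h1 _ _ k0 h'.
have [c2 [r2 h2']] := step_jump lt0 e0 h1'.
exists (1 + (n1 + 1)), c2; split=> //.
by apply: reach_trans r2; apply: reach_trans r1'.
Qed.

(** The compiler is correct: by induction on the execution, since the code of a loop comes
    back to its first instruction after each round. *)
Lemma exec_reach c st st' : exec B Q q c st st' -> regs_below k.+2 c ->
  forall p cf, code_at prog p (assemble c p) -> represents p st cf ->
  exists n cf', reach n cf cf' /\ represents (p + clen c) st' cf'.
Proof.
elim=> {c st st'} /=.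
- by move=> st _ p cf _ h; exists 0, cf; rewrite addn0.
- move=> r b st _ p cf /code_at1[plt e] h.
  by have [c' [r2 h2]] := step_push plt e h; exists 2, c'; rewrite addn1.
- move=> c1 c2 st st1 st2 _ h1 _ h2 /andP[b1 b2] p cf.
  move=> /code_at_cat[k1]; rewrite size_assemble => k2 h.
  have [n1 [cf1 [r1 {}h1]]] := h1 b1 _ _ k1 h.
  have [n2 [cf2 [r2 {}h2]]] := h2 b2 _ _ k2 h1.
  by exists (n2 + n1), cf2; rewrite addnA; split=> //; apply: reach_trans r2.
- move=> r c0 c1 st es /and3P[rk _ _] p cf.
  move=> /(@code_at_cat _ _ [:: _])[/code_at1[plt e] _] h.
  have [c' [r1 ]] := step_pop plt rk e h; rewrite es => h1.
  by exists 1, c'.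
- move=> r c0 c1 b s st st1 st2 es _ h1 _ h2 bb p cf kk h.
  have /and3P[rk b0 b1] := bb.
  have [|n1 [cf1 [_ r1 {}h1]]] := while_iteration (st1 := st1) es rk _ kk h.
    by move=> p' cf'; apply: h1; case: (b).
  have [n2 [cf2 [r2 {}h2]]] := h2 bb _ _ kk h1.
  by exists (n2 + n1), cf2; split=> //; apply: reach_trans r2.
- move=> r st hQ rk p cf; rewrite -cat1s => /code_at_cat[/code_at1[plt e]].
  rewrite /= addn1 => /code_at1[plt1 e1] h.
  have [c1 [r1 h1]] := step_ask plt hQ e h.
  case: ifP h1 => _ h1; last by exists 1, c1; rewrite addn2.
  have [c2 [r2 h2]] := step_push plt1 e1 h1.
  by exists 3, c2; rewrite addn2; split=> //; apply: reach_trans r2.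
Qed.

(** A big-step semantics is silent about divergence; this is what shows that an
    unsuccessful search never halts. *)
Lemma while_diverges r c0 c1 (S : nat -> store) :
  regs_below k.+2 (While r c0 c1) -> (forall j, S j r = [:: true]) ->
  (forall j, exec B Q q c1 (upd (S j) r [::]) (S j.+1)) ->
  forall p cf, code_at prog p (assemble (While r c0 c1) p) ->
  represents p (S 0) cf ->
  forall N, exists n cf', [/\ N <= n, reach n cf cf' & represents p (S N) cf'].
Proof.
move=> bb Sr Sx p cf kk h; have /and3P[rk b0 b1] := bb.
elim=> [|N [n [cf1 [Nn r1 h1]]]]; first by exists 0, cf.
have [p' cf' /= kc hc|n2 [cf2 [n2p r2 h2]]] :=
  while_iteration (st1 := S N.+1) (Sr N) rk _ kk h1.
  by have := exec_reach (Sx N) b1 kc hc.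
exists (n2 + n), cf2; split=> //; last exact: reach_trans r2.
by rewrite -add1n leq_add.
Qed.

End Machine.

(** * Programs as oracle machines *)

Definition compile (k : nat) (c : cmd) : otm := machine k (assemble c 0).

Lemma code_at_self c : code_at (assemble c 0) 0 (assemble c 0).
Proof. by split=> // i; rewrite add0n. Qed.

Lemma exec_run k B Q c x st : regs_below k.+2 c ->
  exec B Q k.+1 c (upd (fun=> [::]) 0 x) st ->
  outputs (compile k c) B x (st 0) /\
  forall w, queries (compile k c) B x w -> Q w.
Proof.
move=> bc ec.
have [n [cf [[en hn] hcf]]] :=
  exec_reach ec bc (code_at_self c) (represents_init _ _ x).
have hh : halted cf.
  rewrite (represents_halted _ hcf) add0n ?size_assemble //.
  by rewrite nth_default // size_assemble.
split.
  by exists n; rewrite /run en; split=> //; apply: tape_holds_string (hcf.2 ord0).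
move=> w [t [nh hq <-]]; case: (ltnP t n) => tn; first by have [_] := hn _ tn; apply.
move: nh; rewrite /run -(subnK tn) iterD en.
suff -> : iter (t - n) (step B) cf = cf by rewrite hh.
by elim: (t - n) => //= m ->; rewrite /step hh.
Qed.

Lemma ask_free_nth c p i jy jn : ask_free c ->
  nth IHalt (assemble c p) i <> IAsk jy jn.
Proof.
elim: c p i => //=.
- by move=> p [|i]; rewrite ?nth_nil.
- by move=> r b p [|[|i]] //=; rewrite nth_nil.
- move=> c1 h1 c2 h2 p i /andP[a1 a2]; rewrite nth_cat.
  by case: ifP => _; [apply: h1|apply: h2].
- move=> r c0 h0 c1 h1 p [|i] //= /andP[a0 a1].
  rewrite !nth_cat; do ?[case: ifP => _]; try by [apply: h0|apply: h1].
    by case: (_ - _) => [|[|m]].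
  by case: (_ - _) => [|[|m]].
Qed.

Lemma oracle_free_compile k c : ask_free c -> oracle_free (compile k c).
Proof.
move=> ac q; rewrite /= /mquery; case: q.2 => //.
rewrite /fetch; case E: nth => [||jy jn||] //.
by have := @ask_free_nth c 0 q.1 jy jn ac.
Qed.

(** * Computable functions of natural numbers *)

Definition env := nat -> nat.

Definition scons (n : nat) (e : env) : env := fun i => if i is j.+1 then e j else n.

(** The total recursive functions, as a predicate on functions of infinitely
    many arguments: a body under a binder sees the bound values as its first
    arguments, so that beta-reduction does the renumbering of variables. *)
Inductive computable : (env -> nat) -> Prop :=
| comp_var i : computable (fun e => e i)
| comp_zero : computable (fun=> 0)
| comp_succ f : computable f -> computable (fun e => (f e).+1)
| comp_let g f : computable g -> computable f -> computable (fun e => f (scons (g e) e))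
| comp_ren r f : computable f -> computable (fun e => f (fun i => e (r i)))
| comp_iteri n a h : computable n -> computable a -> computable h ->
    computable (fun e => iteri (n e) (fun i acc => h (scons i (scons acc e))) (a e))
| comp_mu p g : computable p ->
    (forall e, p (scons (g e) e) = 0) ->
    (forall e i, i < g e -> p (scons i e) != 0) -> computable g.

Definition unary (n : nat) : bstr := nseq n true.

Fixpoint reg_bound (c : cmd) : nat :=
  match c with
  | Skip => 0
  | Push r _ => r.+1
  | Seq c1 c2 => maxn (reg_bound c1) (reg_bound c2)
  | While r c0 c1 => maxn r.+1 (maxn (reg_bound c0) (reg_bound c1))
  | Ask r => r.+1
  end.

Lemma regs_below_bound c n : reg_bound c <= n -> regs_below n c.
Proof.
elim: c => //= [c1 h1 c2 h2|r c1 h1 c2 h2]; rewrite !geq_max.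
  by move=> /andP[/h1 -> /h2 ->].
by move=> /and3P[-> /h1 -> /h2 ->].
Qed.

Ltac upd_cases := repeat match goal with
  | |- context [@eq_op _ ?a ?b] => case: (@eqP _ a b) => ?; try (exfalso; lia)
  end; subst; rewrite //=.

Section Macros.
Variables (B : set bstr) (Q : bstr -> Prop) (q : nat).
Notation exec := (exec B Q q).

Lemma upd_id st r : upd st r (st r) = st.
Proof. by apply/funext => i; rewrite /upd; case: eqP => [->|]. Qed.

Lemma upd_upd st r u v : upd (upd st r u) r v = upd st r v.
Proof. by apply/funext => i; rewrite /upd; case: eqP. Qed.

Lemma upd_same st r v : upd st r v r = v.
Proof. by rewrite /upd eqxx. Qed.

Lemma upd_other st r r' v : r' != r -> upd st r v r' = st r'.
Proof. by rewrite /upd => /negbTE->. Qed.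

(** The rule for loops controlled by a unary counter, indexed by what is left on it. *)
Lemma exec_count r c0 c1 (S : nat -> store) n :
  (forall j, j <= n -> S j r = unary j) ->
  (forall j, j < n -> exec c1 (upd (S j.+1) r (unary j)) (S j)) ->
  exec (While r c0 c1) (S n) (S 0).
Proof.
elim: n => [|n IH] e h; first by apply: EWhileNil; rewrite e.
apply: (@EWhileCons _ _ _ r c0 c1 true (unary n)); first by rewrite e.
  by apply: h.
by apply: IH => j jn; [apply: e|apply: h]; lia.
Qed.

Definition clear (r : nat) : cmd := While r Skip Skip.

Lemma exec_clear st r : exec (clear r) st (upd st r [::]).
Proof.
move e: (st r) => s; elim: s st e => [|b s IH] st e.
  by rewrite -[in X in upd _ _ X]e upd_id; apply: EWhileNil.
apply: (EWhileCons e (st1 := upd st r s)); first by case: b {e}; apply: ESkip.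
by rewrite -[upd st r [::]](@upd_upd st r s); apply: IH; rewrite upd_same.
Qed.

Definition move_reg (r d : nat) : cmd := While r Skip (Push d true).

Lemma exec_move st r d n : r != d -> st r = unary n -> st d = [::] ->
  exec (move_reg r d) st (upd (upd st r [::]) d (unary n)).
Proof.
move=> ne er ed.
pose S j := upd (upd st r (unary j)) d (unary (n - j)).
have -> : st = S n.
  by apply/funext => i; rewrite /S /upd subnn; case: eqP => [->//|_]; case: eqP => [->|].
have -> : upd (upd (S n) r [::]) d (unary n) = S 0.
  apply/funext => i; rewrite /S /upd subn0; case: eqP => //; case: eqP => //.
apply: exec_count => [j _|j jn].
  by rewrite /S /upd (negbTE ne) eqxx.
suff -> : S j = upd (upd (S j.+1) r (unary j)) d
    (true :: upd (S j.+1) r (unary j) d) by apply: EPush.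
apply/funext => i; rewrite /S /upd [d == r]eq_sym (negbTE ne) eqxx.
case: eqP => [_|//]; last by case: eqP.
by rewrite /unary -[true :: _]/(nseq _.+1 true); congr nseq; lia.
Qed.

Definition copy_reg (r d t : nat) : cmd :=
  Seq (move_reg r t) (While t Skip (Seq (Push r true) (Push d true))).

Lemma exec_copy st r d t n : r != d -> r != t -> d != t ->
  st r = unary n -> st d = [::] -> st t = [::] ->
  exec (copy_reg r d t) st (upd st d (unary n)).
Proof.
move=> rd rt dt er ed et; apply: ESeq; first exact: exec_move er et.
pose S j := upd (upd (upd st r (unary (n - j))) d (unary (n - j))) t (unary j).
have -> : upd (upd st r [::]) t (unary n) = S n.
  by apply/funext => i; rewrite /S /upd subnn; upd_cases.
have -> : upd st d (unary n) = S 0.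
  by apply/funext => i; rewrite /S /upd subn0; upd_cases.
apply: exec_count => [j _|j jn]; first by rewrite /S /upd eqxx.
apply: ESeq; first exact: EPush.
set st1 := upd _ r _.
suff -> : S j = upd st1 d (true :: st1 d) by apply: EPush.
have nj : (n - j) = (n - j.+1).+1 by lia.
by apply/funext => i; rewrite /st1 /S /upd nj; upd_cases.
Qed.

End Macros.

(** The registers from [b] on are lent to the program as scratch space and have to be
    returned empty, so that programs can be run in sequence and inside loops. *)
Definition implemented (f : env -> nat) : Prop :=
  forall (rs : nat -> nat) (d b : nat), d < b -> (forall i, rs i < b) ->
  (forall i, rs i != d) ->
  exists2 c, ask_free c & forall B Q q st e,
    (forall i, st (rs i) = unary (e i)) -> st d = [::] ->
    (forall i, b <= i -> st i = [::]) -> exec B Q q c st (upd st d (unary (f e))).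

Lemma implemented_var i : implemented (fun e => e i).
Proof.
move=> rs d b db rsb rsd; exists (copy_reg (rs i) d b) => // B Q q st e ers ed eb.
apply: exec_copy; rewrite ?ers ?ed ?eb //.
  by rewrite neq_ltn rsb.
by rewrite neq_ltn db.
Qed.

Lemma implemented_zero : implemented (fun=> 0).
Proof.
move=> rs d b db rsb rsd; exists Skip => // B Q q st e ers ed eb.
by rewrite /unary /= -[in X in upd _ _ X]ed upd_id; apply: ESkip.
Qed.

Lemma implemented_succ f : implemented f -> implemented (fun e => (f e).+1).
Proof.
move=> hf rs d b db rsb rsd; have [c ac hc] := hf rs d b db rsb rsd.
exists (Seq c (Push d true)); first by rewrite /= ac.
move=> B Q q st e ers ed eb; apply: ESeq; first exact: hc.
set s1 := upd st d (unary (f e)).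
suff -> : upd st d (unary (f e).+1) = upd s1 d (true :: s1 d) by apply: EPush.
by rewrite /s1 upd_upd upd_same.
Qed.

Lemma implemented_ren r f :
  implemented f -> implemented (fun e => f (fun i => e (r i))).
Proof.
move=> hf rs d b db rsb rsd.
have [c ac hc] := hf (fun i => rs (r i)) d b db (fun i => rsb _) (fun i => rsd _).
by exists c => // B Q q st e ers ed eb; apply: hc.
Qed.

Lemma implemented_let g f : implemented g -> implemented f ->
  implemented (fun e => f (scons (g e) e)).
Proof.
move=> hg hf rs d b db rsb rsd.
have [cg ag {}hg] : exists2 c, ask_free c & forall B Q q st e,
    (forall i, st (rs i) = unary (e i)) ->
    (forall i, b <= i -> st i = [::]) ->
    exec B Q q c st (upd st b (unary (g e))).
  have [|i|i|c ac hc] := hg rs b b.+1 => //.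
  - by rewrite ltnS ltnW.
  - by rewrite neq_ltn rsb.
  by exists c => // B Q q st e h1 h2; apply: hc => // [|i ib]; apply: h2; lia.
have [|[|i]|[|i]|cf af {}hf] := hf (scons b rs) d b.+1; rewrite //=; try lia.
  by have := rsb i; lia.
exists (Seq cg (Seq cf (clear b))); first by rewrite /= ag af.
move=> B Q q st e ers ed eb.
have db' : d != b by rewrite neq_ltn db.
apply: ESeq; first exact: hg.
apply: ESeq.
  apply: (hf _ _ _ _ (scons (g e) e)) => [[|i]||i ib].
  - by rewrite upd_same.
  - by rewrite upd_other ?ers // neq_ltn rsb.
  - by rewrite upd_other.
  by rewrite upd_other ?eb //; lia.
set v := unary (f _).
suff -> : upd st d v = upd (upd (upd st b (unary (g e))) d v) b [::].
  exact: exec_clear.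
apply/funext => i; rewrite /upd; upd_cases.
by rewrite eb.
Qed.

Lemma implemented_iteri n a h :
  implemented n -> implemented a -> implemented h ->
  implemented (fun e =>
    iteri (n e) (fun i acc => h (scons i (scons acc e))) (a e)).
Proof.
move=> hn ha hh rs d b db rsb rsd.
have rsb' i j : b <= j -> rs i != j by move=> bj; have := rsb i; lia.
have [|i|i|cn an {}hn] := hn rs b b.+1; rewrite ?rsb' //; first by have := rsb i; lia.
have [|i|i|ca aa {}ha] := ha rs b.+2 b.+3; rewrite ?rsb' //; first by have := rsb i; lia.
  lia.
have [|[|[|i]]|[|[|i]]|ch ah {}hh] := hh (scons b.+1 (scons b.+2 rs)) b.+3 b.+4.
all: rewrite /= ?rsb' //; try lia.
  by have := rsb i; lia.
exists (Seq cn (Seq ca (Seq (While b Skip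
  (Seq ch (Seq (clear b.+2) (Seq (move_reg b.+3 b.+2) (Push b.+1 true)))))
  (Seq (clear b.+1) (move_reg b.+2 d))))); first by rewrite /= an aa ah.
move=> B Q q st e ers ed eb.
pose v j := iteri j (fun i acc => h (scons i (scons acc e))) (a e).
pose S j := upd (upd (upd st b (unary j)) b.+1 (unary (n e - j)))
  b.+2 (unary (v (n e - j))).
apply: ESeq.
  by apply: hn => //; [apply: eb|move=> i ib; apply: eb; lia].
apply: ESeq.
  apply: ha => [i||i ib].
  - by rewrite upd_other ?rsb' ?ers.
  - by rewrite upd_other ?eb //; lia.
  by rewrite upd_other ?eb //; lia.
apply: (@ESeq _ _ _ _ _ _ (S 0)).
  have -> : upd (upd st b (unary (n e))) b.+2 (unary (a e)) = S (n e).
    rewrite /S subnn; congr upd; apply/funext => i; rewrite /upd.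
    by upd_cases; apply: eb; lia.
  apply: exec_count => [j _|j jn].
    by rewrite /S /upd; upd_cases.
  have nj : (n e - j) = (n e - j.+1).+1 by lia.
  apply: ESeq.
    apply: (hh _ _ _ _ (scons (n e - j.+1) (scons (v (n e - j.+1)) e))).
    - case=> [|[|i]] /=.
      + by rewrite /S /upd; upd_cases.
      + by rewrite /S /upd; upd_cases.
      + by have ? := rsb i; rewrite /S /upd ers; upd_cases.
    - by rewrite /S /upd eb; try lia; upd_cases.
    - by move=> i ib; rewrite /S /upd eb; try lia; upd_cases.
  apply: ESeq; first exact: exec_clear.
  apply: ESeq.
    apply: exec_move; last by rewrite upd_same.
      lia.
    by rewrite /S /upd eb; try lia; upd_cases.
  set s1 := upd _ b.+2 _.
  suff -> : S j = upd s1 b.+1 (true :: s1 b.+1) by apply: EPush.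
  by rewrite /s1 /S nj; apply/funext => i; rewrite /upd; upd_cases; apply: eb; lia.
apply: ESeq; first exact: exec_clear.
have -> : upd st d (unary (v (n e))) =
   upd (upd (upd (S 0) b.+1 [::]) b.+2 [::]) d (unary (v (n e))).
  by congr upd; apply/funext => i; rewrite /S /upd; upd_cases; apply: eb; lia.
apply: exec_move; first lia.
  by rewrite /S subn0 /upd; upd_cases.
by rewrite /S /upd ed; upd_cases.
Qed.

Lemma implemented_mu p g : implemented p ->
  (forall e, p (scons (g e) e) = 0) ->
  (forall e i, i < g e -> p (scons i e) != 0) -> implemented g.
Proof.
move=> hp pz pn rs d b db rsb rsd.
have rsb' i j : b <= j -> rs i != j by move=> bj; have := rsb i; lia.
have [|[|i]|[|i]|cp ap {}hp] := hp (scons b rs) b.+1 b.+2.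
all: rewrite /= ?rsb' //; try lia.
  by have := rsb i; lia.
exists (Seq cp (Seq (While b.+1 Skip (Seq (clear b.+1) (Seq (Push b true) cp)))
                    (move_reg b d))); first by rewrite /= ap.
move=> B Q q st e ers ed eb.
pose s0 j := upd st b (unary j).
pose S j := upd (s0 j) b.+1 (unary (p (scons j e))).
have hp' j : exec B Q q cp (s0 j) (S j).
  apply: (hp _ _ _ _ (scons j e)) => [[|i]||i ib].
  - by rewrite /s0 /= upd_same.
  - by rewrite /s0 /= upd_other ?ers ?rsb'.
  - by rewrite /s0 upd_other ?eb //; lia.
  - by rewrite /s0 upd_other ?eb //; lia.
apply: (@ESeq _ _ _ _ _ _ (S 0)).
  have e0 : s0 0 = st by rewrite /s0 -[RHS](upd_id st b) eb.
  by have := hp' 0; rewrite e0.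
apply: (@ESeq _ _ _ _ _ _ (S (g e))).
  have loop j : j <= g e -> exec B Q q
      (While b.+1 Skip (Seq (clear b.+1) (Seq (Push b true) cp)))
      (S (g e - j)) (S (g e)).
    elim: j => [|j IH] jg.
      by rewrite subn0; apply: EWhileNil; rewrite /S upd_same pz.
    have := pn e (g e - j.+1) ltac:(lia); rewrite -lt0n => pp.
    apply: (EWhileCons (b := true)
      (s := unary (p (scons (g e - j.+1) e)).-1) (st1 := S (g e - j))).
    - by rewrite /S upd_same -[in LHS](prednK pp).
    - apply: ESeq; first exact: exec_clear.
      rewrite upd_upd /S upd_upd.
      apply: ESeq; first exact: EPush.
      set s1 := upd _ b _.
      suff -> : s1 = s0 (g e - j) by apply: hp'.
      have nj : (g e - j) = (g e - j.+1).+1 by lia.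
      rewrite /s1 /s0 nj; apply/funext => i; rewrite /upd.
      by upd_cases; rewrite eb.
    by apply: IH; lia.
  by have := loop (g e) (leqnn _); rewrite subnn.
have -> : upd st d (unary (g e)) = upd (upd (S (g e)) b [::]) d (unary (g e)).
  congr upd; apply/funext => i; rewrite /S /s0 /upd pz.
  by case: (i =P b) => [->|_]; [|case: eqP => [->|//]]; rewrite eb.
apply: exec_move; first lia.
  by rewrite /S /s0 /upd; upd_cases.
by rewrite /S /s0 /upd; upd_cases.
Qed.

Lemma comp_implemented f : computable f -> implemented f.
Proof.
elim=> {f}.
- exact: implemented_var.
- exact: implemented_zero.
- by move=> f _; apply: implemented_succ.
- by move=> g f _ hg _; apply: implemented_let.
- by move=> r f _; apply: implemented_ren.
- by move=> n a h _ hn _ ha _; apply: implemented_iteri.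
- by move=> p g _; apply: implemented_mu.
Qed.

(** * A stock of computable functions *)

Definition comp1 (f : nat -> nat) : Prop := computable (fun e => f (e 0)).
Definition comp2 (f : nat -> nat -> nat) : Prop := computable (fun e => f (e 0) (e 1)).
Definition comp3 (f : nat -> nat -> nat -> nat) : Prop :=
  computable (fun e => f (e 0) (e 1) (e 2)).

Lemma comp_ext f g : f =1 g -> computable f -> computable g.
Proof. by move=> /funext->. Qed.

Lemma comp_app1 F a : comp1 F -> computable a -> computable (fun e => F (a e)).
Proof. by move=> hF ha; apply: (comp_let ha hF). Qed.

Lemma comp_app2 F a b : comp2 F -> computable a -> computable b -> computable (fun e => F (a e) (b e)).
Proof.
move=> hF ha hb.
have h1 := comp_let (comp_ren S hb) (comp_ren (fun i => nth 0 [:: 1; 0] i) hF).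
exact: (comp_let ha h1).
Qed.

Lemma comp_app3 F a b c : comp3 F -> computable a -> computable b -> computable c ->
  computable (fun e => F (a e) (b e) (c e)).
Proof.
move=> hF ha hb hc.
have h0 : comp2 (fun x y => F x y 0).
  have h1 := comp_let comp_zero (comp_ren (fun i => nth 0 [:: 1; 2; 0] i) hF).
  exact: h1.
have h1 := comp_let (comp_ren (fun i => i.+2) hc)
  (comp_ren (fun i => nth 0 [:: 2; 1; 0] i) hF).
have h2 := comp_let (comp_ren S hb) h1.
exact: (comp_let ha h2).
Qed.

Lemma comp_iter n a (h : nat -> nat -> env -> nat) : computable n -> computable a ->
  computable (fun e => h (e 0) (e 1) (fun i => e i.+2)) ->
  computable (fun e => iteri (n e) (fun i acc => h i acc e) (a e)).
Proof. by move=> hn ha hh; apply: (comp_iteri hn ha hh). Qed.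

Lemma comp_const n : computable (fun=> n).
Proof. by elim: n => [|n IH]; [apply: comp_zero|apply: comp_succ IH]. Qed.

Create HintDb computable.

(** The tactic decomposes a function along its head symbol, looking for the computability
    of the symbol among the hints and the hypotheses. *)
Ltac comp_basic := cbv beta; match goal with
  | |- computable (fun e => e _) => apply: comp_var
  | |- computable (fun=> ?c) => apply: comp_const
  | |- computable (fun e => S _) => apply: comp_succ
  | |- computable (fun e => ?F (@?a e) (@?b e) (@?c e)) =>
      apply: (@comp_app3 F a b c); first solve [auto with computable nocore]
  | |- computable (fun e => ?F (@?a e) (@?b e)) =>
      apply: (@comp_app2 F a b); first solve [auto with computable nocore]
  | |- computable (fun e => ?F (@?a e)) =>
      apply: (@comp_app1 F a); first solve [auto with computable nocore]
  end.

Lemma comp2_addn : comp2 addn.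
Proof.
apply: (@comp_ext (fun e => iteri (e 1) (fun _ acc => acc.+1) (e 0))).
  by move=> e; elim: (e 1) => [|n /= ->]; rewrite ?addn0 ?addnS.
by apply: comp_iter; do !comp_basic.
Qed.
Hint Resolve comp2_addn : computable.

Lemma comp2_muln : comp2 muln.
Proof.
apply: (@comp_ext (fun e => iteri (e 1) (fun _ acc => acc + e 0) 0)).
  by move=> e; elim: (e 1) => [|n /= ->]; rewrite ?muln0 ?mulnSr.
by apply: comp_iter; do !comp_basic.
Qed.
Hint Resolve comp2_muln : computable.

Lemma comp2_expn : comp2 expn.
Proof.
apply: (@comp_ext (fun e => iteri (e 1) (fun _ acc => acc * e 0) 1)).
  by move=> e; elim: (e 1) => [|n /= ->]; rewrite ?expn0 ?expnSr.
by apply: comp_iter; do !comp_basic.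
Qed.
Hint Resolve comp2_expn : computable.

Lemma comp1_predn : comp1 predn.
Proof.
apply: (@comp_ext (fun e => iteri (e 0) (fun i _ => i) 0)).
  by move=> e; case: (e 0).
by apply: comp_iter; do !comp_basic.
Qed.
Hint Resolve comp1_predn : computable.

Lemma comp2_subn : comp2 subn.
Proof.
apply: (@comp_ext (fun e => iteri (e 1) (fun _ acc => acc.-1) (e 0))).
  by move=> e; elim: (e 1) => [|n /= ->]; rewrite ?subn0 ?subnS.
by apply: comp_iter; do !comp_basic.
Qed.
Hint Resolve comp2_subn : computable.

Lemma comp_negb (b : env -> bool) : computable (fun e => b e : nat) ->
  computable (fun e => ~~ b e : nat).
Proof.
move=> hb; apply: (@comp_ext (fun e => 1 - b e)); first by move=> e; case: (b e).
by do !comp_basic.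
Qed.

Lemma comp_andb (a b : env -> bool) : computable (fun e => a e : nat) ->
  computable (fun e => b e : nat) -> computable (fun e => a e && b e : nat).
Proof.
move=> ha hb; apply: (@comp_ext (fun e => a e * b e)).
  by move=> e; case: (a e); case: (b e).
by do !comp_basic.
Qed.

Lemma comp_orb (a b : env -> bool) : computable (fun e => a e : nat) ->
  computable (fun e => b e : nat) -> computable (fun e => a e || b e : nat).
Proof.
move=> ha hb; apply: (@comp_ext (fun e => ~~ (~~ a e && ~~ b e) : nat)).
  by move=> e; case: (a e); case: (b e).
by apply: comp_negb; apply: comp_andb; apply: comp_negb.
Qed.

Lemma comp_if (b : env -> bool) x y : computable (fun e => b e : nat) ->
  computable x -> computable y -> computable (fun e => if b e then x e else y e).
Proof.
move=> hb hx hy; apply: (@comp_ext (fun e => b e * x e + (1 - b e) * y e)).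
  by move=> e; case: (b e); rewrite ?mul1n ?addn0 ?mul0n.
by do !comp_basic.
Qed.

Lemma comp2_leq : comp2 (fun m n => (m <= n : nat)).
Proof.
apply: (@comp_ext (fun e => 1 - (e 0 - e 1))); last by do !comp_basic.
by move=> e; rewrite /leq; case: (e 0 - e 1).
Qed.

Lemma comp_leq a b : computable a -> computable b -> computable (fun e => (a e <= b e) : nat).
Proof. exact: comp_app2 comp2_leq. Qed.

Lemma comp_eqn a b : computable a -> computable b -> computable (fun e => (a e == b e) : nat).
Proof.
move=> ha hb; apply: (@comp_ext (fun e => (a e <= b e) && (b e <= a e) : nat)).
  by move=> e; rewrite -eqn_leq.
by apply: comp_andb; apply: comp_leq.
Qed.

Lemma comp_sum n (F : nat -> env -> nat) : computable n ->
  computable (fun e => F (e 0) (fun i => e i.+1)) ->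
  computable (fun e => \sum_(0 <= i < n e) F i e).
Proof.
move=> hn hF; apply: (@comp_ext (fun e => iteri (n e) (fun i acc => F i e + acc) 0)).
  move=> e; elim: (n e) => [|k IH]; first by rewrite big_geq.
  by rewrite big_nat_recr //= IH addnC.
apply: comp_iter => //; first exact: comp_zero.
apply: (comp_app2 comp2_addn); last exact: comp_var.
exact: (comp_ren (fun i => if i is j.+1 then j.+2 else 0) hF).
Qed.

Lemma comp_max n (F : nat -> env -> nat) : computable n ->
  computable (fun e => F (e 0) (fun i => e i.+1)) ->
  computable (fun e => \max_(0 <= i < n e) F i e).
Proof.
move=> hn hF; apply: (@comp_ext (fun e => iteri (n e)
    (fun i acc => acc + (F i e - acc)) 0)).
  move=> e; elim: (n e) => [|k IH]; first by rewrite big_geq.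
  by rewrite big_nat_recr //= IH maxnE.
apply: comp_iter => //; first exact: comp_zero.
apply: (comp_app2 comp2_addn); first exact: comp_var.
apply: (comp_app2 comp2_subn); last exact: comp_var.
exact: (comp_ren (fun i => if i is j.+1 then j.+2 else 0) hF).
Qed.

Ltac comp_tac := repeat (cbv beta; match goal with
  | |- computable (fun e => nat_of_bool (~~ _)) => apply: comp_negb
  | |- computable (fun e => nat_of_bool (_ && _)) => apply: comp_andb
  | |- computable (fun e => nat_of_bool (_ || _)) => apply: comp_orb
  | |- computable (fun e => nat_of_bool (_ <= _)) => apply: comp_leq
  | |- computable (fun e => nat_of_bool (_ == _)) => apply: comp_eqn
  | |- computable (fun e => if _ then _ else _) => apply: comp_if
  | |- computable (fun e => bigop _ _ _) => first [apply: comp_sum | apply: comp_max]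
  | |- computable (fun e => nat_of_bool (?F (@?a e) (@?b e) (@?c e))) =>
      apply: (@comp_app3 (fun x y z => nat_of_bool (F x y z)) a b c);
      first solve [auto with computable nocore]
  | |- computable (fun e => nat_of_bool (?F (@?a e) (@?b e))) =>
      apply: (@comp_app2 (fun x y => nat_of_bool (F x y)) a b);
      first solve [auto with computable nocore]
  | |- computable (fun e => nat_of_bool (?F (@?a e))) =>
      apply: (@comp_app1 (fun x => nat_of_bool (F x)) a);
      first solve [auto with computable nocore]
  | |- comp2 _ => unfold comp2
  | |- comp1 _ => unfold comp1
  | |- comp3 _ => unfold comp3
  | |- _ => comp_basic
  end).

Lemma sum_ltn n m : m <= n -> \sum_(0 <= i < n) (i < m) = m.
Proof.
move=> mn; rewrite (@big_cat_nat _ _ _ m) //= big_nat_cond.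
rewrite (eq_bigr (fun=> 1)) => [|i /andP[/andP[_ ->]] //].
rewrite -big_nat_cond sum_nat_const_nat subn0 muln1 big_nat_cond big1 ?addn0 //.
by move=> i /andP[/andP[mi _] _]; rewrite ltnNge mi.
Qed.

Lemma comp2_divn : comp2 divn.
Proof.
apply: (@comp_ext (fun e => \sum_(0 <= i < e 0) ((0 < e 1) && (i.+1 * e 1 <= e 0)))).
  move=> e; case: (posnP (e 1)) => [->|d0].
    by rewrite divn0 big1.
  rewrite (eq_bigr (fun i => (i < e 0 %/ e 1) : nat)); last first.
    by move=> i _; rewrite leq_divRL.
  by rewrite sum_ltn // leq_div.
by comp_tac.
Qed.
Hint Resolve comp2_divn : computable.

Lemma comp2_modn : comp2 modn.
Proof.
apply: (@comp_ext (fun e => e 0 - e 0 %/ e 1 * e 1)); last by comp_tac.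
by move=> e; rewrite {1}(divn_eq (e 0) (e 1)) addKn.
Qed.
Hint Resolve comp2_modn : computable.

Lemma comp1_odd : comp1 (fun n => odd n : nat).
Proof.
by apply: (@comp_ext (fun e => e 0 %% 2)); [move=> e; rewrite modn2|comp_tac].
Qed.
Hint Resolve comp1_odd : computable.

(** Every function of finite support is a finite sum of constants times tests; the
    transition tables of machines are of this form. *)
Lemma comp1_finite_support N F : (forall n, N <= n -> F n = 0) -> comp1 F.
Proof.
move=> F0; apply: (@comp_ext (fun e => \sum_(j < N) ((e 0 == j) * F j))).
  move=> e; case: (ltnP (e 0) N) => eN.
    rewrite (bigD1 (Ordinal eN)) //= eqxx mul1n big1 ?addn0 // => j.
    by rewrite -val_eqE /=; case: (e 0 =P j :> nat) => // ->; rewrite eqxx.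
  rewrite (F0 _ eN) big1 // => j _; have := ltn_ord j.
  by case: eqP => //= <-; rewrite ltnNge eN.
elim: N {F0} => [|N IH].
  by apply: (comp_ext _ comp_zero) => e; rewrite big_ord0.
apply: (@comp_ext (fun e => \sum_(j < N) ((e 0 == j) * F j) + (e 0 == N) * F N)).
  by move=> e; rewrite big_ord_recr.
by apply: (comp_app2 comp2_addn) => //; comp_tac.
Qed.

(** ** Pairs *)

Definition pairn (x y : nat) : nat := 2 ^ x * (y.*2.+1).

Lemma pairn_inj x y x' y' : pairn x y = pairn x' y' -> (x = x') * (y = y').
Proof.
have odd_part u v : logn 2 (pairn u v) = u.
  by rewrite /pairn mulnC logn_Gauss ?pfactorK // coprime2n /= odd_double.
move=> e; have ex : x = x' by rewrite -[x](odd_part x y) e odd_part.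
move: e; rewrite ex /pairn => /eqP; rewrite eqn_pmul2l ?expn_gt0 // => /eqP.
by move=> e; split=> //; apply: double_inj; case: e.
Qed.

Lemma pairn_gt1 x y : x < pairn x y.
Proof. by rewrite /pairn (leq_trans (ltn_expl x (ltnSn 1))) // leq_pmulr. Qed.

Lemma pairn_gt2 x y : y < pairn x y.
Proof.
rewrite /pairn (@leq_trans y.*2.+1) ?leq_pmull ?expn_gt0 //.
by rewrite ltnS -addnn leq_addr.
Qed.

Lemma comp2_pairn : comp2 pairn.
Proof.
apply: (@comp_ext (fun e => 2 ^ e 0 * (e 1 + e 1).+1)); last by comp_tac.
by move=> e; rewrite addnn.
Qed.
Hint Resolve comp2_pairn : computable.

(** The projections are found by exhaustive search, which may stop at [z] because both
    components of a pair are smaller than its code. *)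
Definition fstn (z : nat) : nat :=
  \sum_(0 <= x < z) \sum_(0 <= y < z) (pairn x y == z) * x.
Definition sndn (z : nat) : nat :=
  \sum_(0 <= x < z) \sum_(0 <= y < z) (pairn x y == z) * y.

Lemma sum_delta n j (F : nat -> nat) : j < n ->
  (forall i, i != j -> F i = 0) -> \sum_(0 <= i < n) F i = F j.
Proof.
move=> jn F0; rewrite (bigD1_seq j) ?mem_index_iota ?iota_uniq //=.
by rewrite big1 ?addn0.
Qed.

Lemma sum_pairn x y (F : nat -> nat -> nat) :
  let z := pairn x y in
  \sum_(0 <= x < z) \sum_(0 <= y < z) (pairn x y == z) * F x y = F x y.
Proof.
move=> z; rewrite {}/z (@sum_delta _ x) ?pairn_gt1 // => [|i ne].
  rewrite (@sum_delta _ y) ?pairn_gt2 ?eqxx ?mul1n // => j ne.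
  by case: eqP => // /pairn_inj[] _ e; rewrite e eqxx in ne.
by rewrite big1 // => j _; case: eqP => // /pairn_inj[] e; rewrite e eqxx in ne.
Qed.

Lemma pairnK1 x y : fstn (pairn x y) = x.
Proof. exact: (sum_pairn x y (fun x _ => x)). Qed.

Lemma pairnK2 x y : sndn (pairn x y) = y.
Proof. exact: (sum_pairn x y (fun _ y => y)). Qed.

Lemma comp1_fstn : comp1 fstn. Proof. by rewrite /fstn; comp_tac. Qed.
Lemma comp1_sndn : comp1 sndn. Proof. by rewrite /sndn; comp_tac. Qed.
Hint Resolve comp1_fstn comp1_sndn : computable.

(** ** Strings as numbers *)

(** Bijective base two, the first bit of the string being the least significant digit. *)
Fixpoint strcode (s : bstr) : nat := if s is b :: s' then (strcode s').*2 + b.+1 else 0.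

Definition popn (n : nat) : nat := n.-1 %/ 2.
Definition bitn (n i : nat) : bool := odd (iter i popn n).-1.
Definition slen (n : nat) : nat := \sum_(0 <= i < n) (0 < iter i popn n).
Definition str (n : nat) : bstr := mkseq (bitn n) (slen n).

Lemma popn_strcode s : popn (strcode s) = strcode (behead s).
Proof.
case: s => //= b s; rewrite /popn addnS /= divn2.
by case: b; rewrite ?addn0 ?addn1 /= ?uphalf_double ?doubleK.
Qed.

Lemma iter_popn_strcode i s : iter i popn (strcode s) = strcode (drop i s).
Proof.
elim: i => [|i IH]; first by rewrite drop0.
by rewrite iterS IH popn_strcode -drop1 drop_drop.
Qed.

Lemma code_gt0 s : (0 < strcode s) = (0 < size s).
Proof. by case: s => //= b s; rewrite addnS. Qed.

Lemma size_strcode s : 2 ^ size s <= (strcode s).+1 < 2 ^ (size s).+1.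
Proof.
elim: s => //= b s /andP[h1 h2]; rewrite !expnS in h1 h2 *.
by case: b => /=; lia.
Qed.

Lemma slen_strcode s : slen (strcode s) = size s.
Proof.
rewrite /slen (eq_bigr (fun i => (i < size s) : nat)) => [|i _].
  rewrite sum_ltn //; have /andP[h _] := size_strcode s.
  by rewrite -ltnS (leq_trans _ h) // ltn_expl.
by rewrite iter_popn_strcode code_gt0 size_drop subn_gt0.
Qed.

Lemma strcodeK : cancel strcode str.
Proof.
move=> s; apply: (@eq_from_nth _ false); rewrite size_mkseq slen_strcode // => i il.
rewrite nth_mkseq ?slen_strcode // /bitn iter_popn_strcode (drop_nth false il) /=.
by rewrite addnS /= oddD odd_double; case: nth.
Qed.

Lemma strK : cancel str strcode.
Proof.
move=> n; suff [s <-] : exists s, strcode s = n by rewrite strcodeK.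
elim/ltn_ind: n => -[|n] IH; first by exists [::].
have [|s e] := IH (n./2); first by rewrite ltnS -divn2 leq_div.
exists (odd n :: s); rewrite /= e addnS.
by congr S; rewrite -[RHS](odd_double_half n) addnC.
Qed.

Lemma str_inj : injective str. Proof. exact: can_inj strK. Qed.
Lemma strcode_inj : injective strcode. Proof. exact: can_inj strcodeK. Qed.

Lemma size_str n : size (str n) = slen n.
Proof. by rewrite size_mkseq. Qed.

Lemma slen_leq n m : (slen n <= m) = (n < 2 ^ m.+1 - 1).
Proof.
have /andP[h1 h2] := size_strcode (str n); rewrite strK size_str in h1 h2.
apply/idP/idP => h.
  by have : 2 ^ (slen n).+1 <= 2 ^ m.+1 by [rewrite leq_exp2l]; lia.
have : 2 ^ slen n < 2 ^ m.+1 by have := expn_gt0 2 m.+1; lia.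
by rewrite ltn_exp2l.
Qed.

Lemma comp2_iter_popn : comp2 (fun i n => iter i popn n).
Proof.
apply: (@comp_ext (fun e => iteri (e 0) (fun _ acc => acc.-1 %/ 2) (e 1))).
  by move=> e; elim: (e 0) => //= n ->.
by apply: comp_iter; comp_tac.
Qed.
Hint Resolve comp2_iter_popn : computable.

Lemma comp2_bitn : comp2 (fun n i => bitn n i : nat).
Proof.
rewrite /bitn; apply: (@comp_app1 (fun n => odd n : nat)); first by auto with computable.
by apply: (@comp_app1 predn); [auto with computable|apply: (comp_app2 comp2_iter_popn); comp_tac].
Qed.
Hint Resolve comp2_bitn : computable.

Lemma comp1_slen : comp1 slen.
Proof.
rewrite /slen; apply: comp_sum; first by comp_tac.
by apply: comp_leq; [comp_tac|apply: (comp_app2 comp2_iter_popn); comp_tac].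
Qed.
Hint Resolve comp1_slen : computable.

(** * Search programs *)

Section Programs.
Variables (B : set bstr) (Q : bstr -> Prop) (q : nat).
Notation exec := (exec B Q q).

Definition pour (r d : nat) : cmd := While r (Push d false) (Push d true).

Lemma exec_pour st r d s : r != d -> st r = s ->
  exec (pour r d) st (upd (upd st r [::]) d (catrev s (st d))).
Proof.
move=> ne; elim: s st => [|b s IH] st e.
  rewrite /= -[in X in upd X](e) upd_id upd_id; exact: EWhileNil.
pose st1 := upd (upd st r s) d (b :: st d).
apply: (EWhileCons e (st1 := st1)).
  have -> : st1 = upd (upd st r s) d (b :: upd st r s d).
    by rewrite /st1 upd_other // eq_sym.
  by case: b {e st1}; apply: EPush.
suff -> : upd (upd st r [::]) d (catrev (b :: s) (st d)) =
   upd (upd st1 r [::]) d (catrev s (st1 d)).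
  by apply: IH; rewrite /st1 /upd; upd_cases.
by apply/funext => i; rewrite /st1 /upd; upd_cases.
Qed.

Definition double_succ : cmd :=
  Seq (move_reg 1 3)
    (Seq (While 3 Skip (Seq (Push 1 true) (Push 1 true))) (Push 1 true)).

(** The string is read backwards, from stack 2, because its last bit is the most
    significant digit of its code. *)
Definition read_code : cmd :=
  Seq (pour 0 2) (While 2 double_succ (Seq double_succ (Push 1 true))).

Lemma exec_double_succ st n : st 1 = unary n -> st 3 = [::] ->
  exec double_succ st (upd st 1 (unary n.*2.+1)).
Proof.
move=> e1 e3; apply: ESeq; first exact: exec_move e1 e3.
pose S j := upd (upd st 3 (unary j)) 1 (unary (n - j).*2).
have -> : upd (upd st 1 [::]) 3 (unary n) = S n.
  by rewrite /S subnn; apply/funext => i; rewrite /upd; upd_cases.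
apply: (@ESeq _ _ _ _ _ _ (S 0)).
  apply: exec_count => [j _|j jn]; first by rewrite /S /upd.
  have nj : (n - j) = (n - j.+1).+1 by lia.
  apply: ESeq; first exact: EPush.
  set s1 := upd _ 1 _.
  suff -> : S j = upd s1 1 (true :: s1 1) by apply: EPush.
  by rewrite /s1 /S nj; apply/funext => i; rewrite /upd; upd_cases.
suff -> : upd st 1 (unary n.*2.+1) = upd (S 0) 1 (true :: S 0 1) by apply: EPush.
by rewrite /S subn0; apply/funext => i; rewrite /upd; upd_cases.
Qed.

Lemma exec_read_code s : exec read_code
  (upd (fun=> [::]) 0 s) (upd (fun=> [::]) 1 (unary (strcode s))).
Proof.
apply: ESeq; first exact: (@exec_pour _ 0 2 s).
have -> : upd (upd (upd (fun=> [::]) 0 s) 0 [::]) 2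
    (catrev s (upd (fun=> [::]) 0 s 2)) = upd (upd (fun=> [::]) 1 (unary (strcode [::]))) 2 (rev s).
  by apply/funext => i; rewrite /upd; upd_cases.
suff gen t u : exec (While 2 double_succ (Seq double_succ (Push 1 true)))
   (upd (upd (fun=> [::]) 1 (unary (strcode u))) 2 t)
   (upd (fun=> [::]) 1 (unary (strcode (catrev t u)))).
  by have := gen (rev s) [::]; rewrite -/(rev (rev s)) revK.
elim: t u => [|b t IH] u.
  rewrite (_ : upd _ 2 _ = upd (fun=> [::]) 1 (unary (strcode u))); last first.
    by apply/funext => i; rewrite /upd; upd_cases.
  exact: EWhileNil.
apply: (EWhileCons (b := b) (s := t)
  (st1 := upd (upd (fun=> [::]) 1 (unary (strcode (b :: u)))) 2 t)) => //.
have d0 := @exec_double_succ (upd (upd (fun=> [::]) 1 (unary (strcode u))) 2 t) (strcode u) erefl erefl.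
rewrite upd_upd; case: b; last first.
  rewrite [X in exec _ _ X](_ : _ = upd (upd (upd (fun=> [::]) 1 (unary (strcode u))) 2 t) 1
    (unary (strcode u).*2.+1)) //.
  by apply/funext => i; rewrite /upd /= addn1; upd_cases.
apply: ESeq; first exact: d0.
set s1 := upd _ 1 _.
suff -> : upd (upd (fun=> [::]) 1 (unary (strcode (true :: u)))) 2 t = upd s1 1 (true :: s1 1).
  exact: EPush.
by apply/funext => i; rewrite /s1 /upd /= addn2; upd_cases.
Qed.

End Programs.

(** The bits are pushed from the last to the first, so that the counter of the loop, which
    runs down to zero, is the index of the current bit. *)
Lemma emit_program r b : r < b -> 0 < r ->
  exists2 c, ask_free c & forall B Q q st n, st r = unary n -> st 0 = [::] ->
    (forall i, b <= i -> st i = [::]) -> exec B Q q c st (upd st 0 (str n)).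
Proof.
move=> rb r0.
have [||i|cl al hl] := comp_implemented comp1_slen (rs := fun=> r) (d := b) (b := b.+1).
all: try lia.
have [|[|i]|[|i]|ct at_ ht] := comp_implemented comp2_bitn
   (rs := fun i => if i is 1 then b else r) (d := b.+1) (b := b.+3).
all: try (rewrite /=; case: i => [|i]); try lia.
have hnb : comp2 (fun n i => ~~ bitn n i : nat) by comp_tac.
have [|[|i]|[|i]|cf af hf] := comp_implemented hnb
   (rs := fun i => if i is 1 then b else r) (d := b.+2) (b := b.+3).
all: try (rewrite /=; case: i => [|i]); try lia.
exists (Seq cl (While b Skip (Seq ct (Seq cf
  (Seq (While b.+1 Skip (Push 0 true)) (While b.+2 Skip (Push 0 false))))))).
  by rewrite /= al at_ af.
move=> B Q q st n er e0 eb.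
pose S j := upd (upd st b (unary j)) 0 (drop j (str n)).
apply: (@ESeq _ _ _ _ _ _ (S (slen n))).
  have -> : S (slen n) = upd st b (unary (slen n)).
    rewrite /S drop_oversize ?size_str //.
    by apply/funext => i; rewrite /upd; upd_cases.
  apply: (hl _ _ _ _ (fun=> n)) => [i||i ib]; rewrite ?er ?eb //; lia.
have -> : upd st 0 (str n) = S 0.
  rewrite /S drop0; apply/funext => i; rewrite /upd; upd_cases.
  by rewrite eb.
apply: exec_count => [j _|j jn]; first by rewrite /S /upd; upd_cases.
set s0 := upd _ b _.
have s0b i : b < i -> s0 i = [::].
  by move=> bi; rewrite /s0 /S /upd; upd_cases; apply: eb; lia.
pose e (i : nat) := if i is 1 then j else n.
have s0e i : s0 (if i is 1 then b else r) = unary (e i).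
  by case: i => [|[|i]]; rewrite /s0 /S /upd /=; upd_cases.
apply: (@ESeq _ _ _ _ _ _ (upd s0 b.+1 (unary (bitn n j)))).
  by apply: (ht _ _ _ _ e) => // [|i ib]; rewrite s0b //; lia.
apply: (@ESeq _ _ _ _ _ _ (upd (upd s0 b.+1 (unary (bitn n j))) b.+2 (unary (~~ bitn n j)))).
  apply: (hf _ _ _ _ e) => // [i||i ib].
  - rewrite upd_other //; case: i => [|[|i]]; lia.
  - by rewrite upd_other ?s0b //; lia.
  - by rewrite upd_other ?s0b //; lia.
have dr : drop j (str n) = bitn n j :: drop j.+1 (str n).
  by rewrite (drop_nth false) ?size_str // nth_mkseq.
have hs0 : S j = upd s0 0 (bitn n j :: s0 0).
  rewrite /s0 /S dr; apply/funext => i; rewrite /upd; upd_cases.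
case: (bitn n j) hs0 => /= ->.
  apply: (@ESeq _ _ _ _ _ _ (upd s0 0 (true :: s0 0))).
    apply: (EWhileCons (b := true) (s := [::]) (st1 := upd s0 0 (true :: s0 0))).
    - by rewrite /upd; upd_cases.
    - set s1 := upd _ b.+1 [::].
      suff -> : upd s0 0 (true :: s0 0) = upd s1 0 (true :: s1 0) by apply: EPush.
      by rewrite /s1; apply/funext => i; rewrite /upd; upd_cases; rewrite s0b.
    - by apply: EWhileNil; rewrite /upd; upd_cases; rewrite s0b.
  by apply: EWhileNil; rewrite /upd; upd_cases; rewrite s0b.
set s2 := upd _ b.+2 _.
apply: (@ESeq _ _ _ _ _ _ s2); first by apply: EWhileNil; rewrite /s2 /upd; upd_cases.
apply: (EWhileCons (b := true) (s := [::]) (st1 := upd s0 0 (false :: s0 0))).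
- by rewrite /s2 /upd; upd_cases.
- set s1 := upd s2 b.+2 [::].
  suff -> : upd s0 0 (false :: s0 0) = upd s1 0 (false :: s1 0) by apply: EPush.
  by rewrite /s1 /s2; apply/funext => i; rewrite /upd; upd_cases; rewrite s0b.
- by apply: EWhileNil; rewrite /upd; upd_cases; rewrite s0b.
Qed.

Definition input_store (x K : nat) : store :=
  upd (upd (fun=> [::]) 1 (unary x)) 3 (unary K).

Definition search_store (P : nat -> nat -> nat -> nat) (x K s : nat) : store :=
  upd (upd (input_store x K) 4 (unary s)) 5 (unary (P x K s == 0)).

(** The search is delivered in three parts around its loop, because divergence has to be
    argued on the loop itself.  Stacks 1, 3, 4 hold [x], [K], [s], and stack 5 holds a bit
    as long as the search goes on. *)
Lemma search_program P U : comp3 P -> comp3 U ->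
  exists pre body post, [/\ ask_free pre, ask_free body & ask_free post] /\
  forall B Q q x K, let st := search_store P x K in
  [/\ exec B Q q pre (input_store x K) (st 0),
      forall s, exec B Q q body (upd (st s) 5 [::]) (st s.+1) &
      forall s, P x K s != 0 -> exists2 st', exec B Q q post (st s) st' &
        st' 0 = str (U x K s)].
Proof.
move=> hP hU; pose rs := nth 1 [:: 1; 3; 4].
have hP' : comp3 (fun x K s => P x K s == 0 : nat).
  by apply: comp_eqn => //; apply: comp_const.
have rs5 i : rs i < 5 by case: i => [|[|[|i]]] //; rewrite /rs /= nth_nil.
have rs_lt i : rs i < 7 by have := rs5 i; lia.
have [//|//|i|cp ap hp] := comp_implemented hP' (rs := rs) (d := 5) (b := 7).
  by have := rs5 i; lia.
have [//|//|i|cu au hu] := comp_implemented hU (rs := rs) (d := 6) (b := 7).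
  by have := rs5 i; lia.
have [//|//|ce ae he] := @emit_program 6 7.
exists cp, (Seq (Push 4 true) cp), (Seq cu ce); split; first by rewrite /= au.
move=> B Q q x K; rewrite /search_store; set st0 := input_store x K.
pose st s := upd (upd st0 4 (unary s)) 5 (unary (P x K s == 0)).
pose e s := nth x [:: x; K; s].
have e_rs s i : upd st0 4 (unary s) (rs i) = unary (e s i).
  by case: i => [|[|[|i]]] //; rewrite /rs /e /= !nth_nil.
have hp' s : exec B Q q cp (upd st0 4 (unary s)) (st s).
  apply: (hp _ _ _ _ (e s)) => // i i7.
  by rewrite /st0 /input_store /upd; upd_cases.
split.
- have E0 : upd st0 4 (unary 0) = st0.
    by apply/funext => i; rewrite /st0 /input_store /upd; upd_cases.
  by have := hp' 0; rewrite {1}E0.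
- move=> s; apply: ESeq; first exact: EPush.
  set s1 := upd _ 4 _.
  suff -> : s1 = upd st0 4 (unary s.+1) by apply: hp'.
  by apply/funext => i; rewrite /s1 /st /st0 /input_store /upd; upd_cases.
move=> s Ps; rewrite (negbTE Ps).
have -> : upd (upd st0 4 (unary s)) 5 (unary false) = upd st0 4 (unary s).
  by apply/funext => i; rewrite /st0 /input_store /upd; upd_cases.
have hu' : exec B Q q cu (upd st0 4 (unary s)) (upd (upd st0 4 (unary s)) 6 (unary (U x K s))).
  apply: (hu _ _ _ _ (e s)) => // i i7.
  by rewrite /st0 /input_store /upd; upd_cases.
eexists; first apply: ESeq hu' _.
  by apply: he => // i i7; rewrite /st0 /input_store /upd; upd_cases.
by [].
Qed.

Section Search.
Variables (P : nat -> nat -> nat -> nat) (x K : nat).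

Lemma search_exec B Q q pre body post st0 (st : nat -> store) y s :
  exec B Q q pre st0 (st 0) ->
  (forall j, exec B Q q body (upd (st j) 5 [::]) (st j.+1)) ->
  (forall j, st j 5 = unary (P x K j == 0)) ->
  P x K s != 0 -> (forall j, j < s -> P x K j = 0) ->
  (exists2 st', exec B Q q post (st s) st' & st' 0 = y) ->
  exists2 st', exec B Q q (Seq pre (Seq (While 5 Skip body) post)) st0 st' & st' 0 = y.
Proof.
move=> hpre hbody st5 Ps Pj [st' hpost e]; exists st' => //.
apply: ESeq; first exact: hpre.
apply: ESeq hpost.
suff loop j : j <= s -> exec B Q q (While 5 Skip body) (st (s - j)) (st s).
  by have := loop s (leqnn s); rewrite subnn.
elim: j => [|j IH] js.
  by rewrite subn0; apply: EWhileNil; rewrite st5 (negbTE Ps).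
apply: (EWhileCons (b := true) (s := [::]) (st1 := st (s - j))).
- by rewrite st5 Pj //; lia.
- by rewrite (_ : s - j = (s - j.+1).+1) //; lia.
- by apply: IH; lia.
Qed.

End Search.

Lemma iter_halted (M : otm) B (c : config M) n : halted c -> iter n (step B) c = c.
Proof. by move=> h; elim: n => //= n ->; rewrite /step h. Qed.

Lemma halted_run (M : otm) B x m n : m <= n -> halted (run M B x m) ->
  run M B x n = run M B x m.
Proof. by move=> mn h; rewrite /run -(subnK mn) iterD iter_halted. Qed.

Lemma outputs_inj (M : otm) B x y y' : outputs M B x y -> outputs M B x y' -> y = y'.
Proof.
move=> [t [ht <-]] [t' [ht' <-]].
by case: (leqP t t') => [|/ltnW] le; rewrite (halted_run le).
Qed.

(** Whether a search succeeds is decided classically, which turns it into a function with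
    values in an option type. *)
Definition search_fun (P U : nat -> nat -> nat) (x : bstr) : option bstr :=
  if pselect (exists s, P (strcode x) s != 0) is left ex
  then Some (str (U (strcode x) (ex_minn ex))) else None.

Lemma code_at_seq prog p c1 c2 : code_at prog p (assemble (Seq c1 c2) p) ->
  code_at prog p (assemble c1 p) /\
  code_at prog (p + clen c1) (assemble c2 (p + clen c1)).
Proof. by move=> /code_at_cat; rewrite size_assemble. Qed.

(** The machine halts exactly when the search succeeds: otherwise its loop is entered more
    often than any given number of times. *)
Lemma partial_recursive_search P U : comp2 P -> comp2 U ->
  partial_recursive (search_fun P U).
Proof.
move=> hP hU.
pose P3 x (_ : nat) s := P x s; pose U3 x (_ : nat) s := U x s.
have hP3 : comp3 P3.
  exact: (comp_app2 hP (comp_var 0) (comp_var 2)).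
have hU3 : comp3 U3.
  exact: (comp_app2 hU (comp_var 0) (comp_var 2)).
have [pre [body [post [[a1 a2 a3] h]]]] := search_program hP3 hU3.
pose main := Seq read_code (Seq pre (Seq (While 5 Skip body) post)).
pose k := reg_bound main.
have rk : regs_below k.+2 main by apply: regs_below_bound; rewrite /k; lia.
exists (compile k main); split; first by apply: oracle_free_compile; rewrite /= a1 a2 a3.
move=> x y.
have [hpre hbody hpost] := h set0 (fun=> True) k.+1 (strcode x) 0.
set st := search_store P3 (strcode x) 0 in hpre hbody hpost *.
have st0E : input_store (strcode x) 0 = upd (fun=> [::]) 1 (unary (strcode x)).
  by apply/funext => i; rewrite /input_store /upd; upd_cases.
rewrite st0E in hpre.
have st5 j : st j 5 = unary (P3 (strcode x) 0 j == 0) by [].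
rewrite /search_fun; case: pselect => [ex|nex].
  case: ex_minnP => s Ps smin.
  have [|st' hst' e] := search_exec hpre hbody st5 Ps _ (hpost _ Ps).
    by move=> j js; apply/eqP; apply: contraTT js => /smin; rewrite -leqNgt.
  have [out _] := exec_run rk (ESeq (exec_read_code _ _ _ x) hst').
  rewrite e in out; split=> [[<-] //|out']; congr Some.
  exact: outputs_inj out out'.
have st1 j : st j 5 = [:: true].
  by rewrite st5; case: eqP => // /eqP Pj; case: nex; exists j.
split=> // -[t [ht _]]; exfalso.
have /and4P[rr rp rw _] : [&& regs_below k.+2 read_code, regs_below k.+2 pre,
  regs_below k.+2 (While 5 Skip body) & regs_below k.+2 post] := rk.
have /code_at_seq[k1 /code_at_seq[k2 /code_at_seq[k3 _]]] := code_at_self main.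
have [n1 [c1 [r1 h1]]] := exec_reach (exec_read_code set0 (fun=> True) k.+1 x) rr k1
  (represents_init _ _ x).
have [n2 [c2 [r2 h2]]] := exec_reach hpre rp k2 h1.
have [n3 [c3 [n3t r3 h3]]] := while_diverges rw st1 hbody k3 h2 t.+1.
have [_ /(_ t)] := reach_trans r1 (reach_trans r2 r3).
by move=> /(_ ltac:(lia)) [/negP nh _]; apply: nh.
Qed.

(** All questions are asked before the search, and they depend on the input only; this
    makes the query size a matter of the function [bnd]. *)
Lemma oracle_search_machine bnd P U (B : set bstr) :
  comp1 bnd -> comp3 P -> comp3 U ->
  let K x := \sum_(0 <= i < bnd x) (str i \in B) in
  (forall x, exists s, P x (K x) s != 0) ->
  exists M : otm,
    (forall x, exists s, P (strcode x) (K (strcode x)) s != 0 /\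
       outputs M B x (str (U (strcode x) (K (strcode x)) s))) /\
    (forall x w, queries M B x w -> strcode w < bnd (strcode x)).
Proof.
move=> hb hP hU K ex.
have [pre [body [post [_ h]]]] := search_program hP hU.
have [//|i|i|cb ab {}hb] := comp_implemented hb (rs := fun=> 1) (d := 4) (b := 5); rewrite //.
have [//|//|ce ae he] := @emit_program 4 5.
pose asks q := Seq cb (While 4 Skip
  (Seq ce (Seq (pour 0 2) (Seq (pour 2 q) (Seq (Ask 3) (clear q)))))).
pose main q := Seq read_code (Seq (asks q) (Seq pre (Seq (While 5 Skip body) post))).
pose k := \max_(b <- [:: 5; reg_bound cb; reg_bound ce; reg_bound pre;
  reg_bound body; reg_bound post]) b.
have lek b : b \in [:: 5; reg_bound cb; reg_bound ce; reg_bound pre;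
  reg_bound body; reg_bound post] -> b <= k.
  by move=> bin; apply: (leq_bigmax_seq b bin).
have k5 : 4 < k by apply: lek; rewrite inE.
have below c : reg_bound c \in [:: 5; reg_bound cb; reg_bound ce; reg_bound pre;
  reg_bound body; reg_bound post] -> regs_below k.+2 c.
  by move=> /lek ck; apply: regs_below_bound; rewrite ltnW // ltnW.
have rk : regs_below k.+2 (main k.+1).
  by rewrite /main /asks /= !below ?inE ?eqxx ?orbT //=; clearbody k; lia.
clearbody k; exists (compile k (main k.+1)).
have main_exec x : let n := strcode x in
  exists s st', [/\ P n (K n) s != 0,
    exec B (fun w => strcode w < bnd n) k.+1 (main k.+1) (upd (fun=> [::]) 0 x) st' &
    st' 0 = str (U n (K n) s)].
  move=> n; pose Q w := strcode w < bnd n.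
  have [hpre hbody hpost] := h B Q k.+1 n (K n).
  set st := search_store P n (K n) in hpre hbody hpost *.
  have st5 j : st j 5 = unary (P n (K n) j == 0) by [].
  case: (ex_minnP (ex n)) => s Ps smin.
  have [|st' hst' e] := search_exec hpre hbody st5 Ps _ (hpost _ Ps).
    by move=> j js; apply/eqP; apply: contraTT js => /smin; rewrite -leqNgt.
  exists s, st'; split=> //; apply: ESeq; first exact: exec_read_code.
  apply: ESeq hst'.
  set st1 := upd _ 1 _.
  apply: (@ESeq _ _ _ _ _ _ (upd st1 4 (unary (bnd n)))).
    by apply: (hb _ _ _ _ (fun=> n)) => // i i5; rewrite /st1 /upd; upd_cases.
  pose S j := upd (upd st1 4 (unary j)) 3 (unary (\sum_(j <= i < bnd n) (str i \in B))).
  have -> : upd st1 4 (unary (bnd n)) = S (bnd n).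
    rewrite /S big_geq //; apply/funext => i; rewrite /st1 /upd; upd_cases.
  have -> : input_store n (K n) = S 0.
    by apply/funext => i; rewrite /input_store /S /st1 /upd; upd_cases.
  apply: exec_count => [//|j jn].
  pose s0 := upd (S j.+1) 4 (unary j).
  have s0k : s0 k.+1 = [::] by rewrite /s0 /S /st1 /upd; upd_cases.
  apply: (@ESeq _ _ _ _ _ _ (upd s0 0 (str j))).
    by apply: he => // i i5; rewrite /S /st1 /upd; upd_cases.
  apply: (@ESeq _ _ _ _ _ _ (upd s0 2 (rev (str j)))).
    have := @exec_pour B Q k.+1 (upd s0 0 (str j)) 0 2 (str j) erefl erefl.
    congr exec; apply/funext => i; rewrite /s0 /S /st1 /upd; upd_cases.
  apply: (@ESeq _ _ _ _ _ _ (upd s0 k.+1 (str j))).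
    have := @exec_pour B Q k.+1 (upd s0 2 (rev (str j))) 2 k.+1 (rev (str j)) _ erefl.
    rewrite upd_other ?s0k; last lia.
    rewrite -/(rev (rev _)) revK => /(_ ltac:(lia)).
    congr exec; apply/funext => i; rewrite /s0 /S /st1 /upd; upd_cases.
  apply: ESeq; first by apply: EAsk; rewrite upd_same /Q strK.
  rewrite upd_same.
  suff -> : S j = upd (if str j \in B then
      upd (upd s0 k.+1 (str j)) 3 (true :: upd s0 k.+1 (str j) 3)
      else upd s0 k.+1 (str j)) k.+1 [::].
    exact: exec_clear.
  rewrite {1}/S big_ltn //; case: (str j \in B).
    by apply/funext => i; rewrite /s0 /S /st1 /upd; upd_cases.
  by apply/funext => i; rewrite /s0 /S /st1 /upd; upd_cases.
split=> x.
  have [s [st' [Ps e0 e1]]] := main_exec x.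
  by have [out _] := exec_run rk e0; exists s; split=> //; rewrite -e1.
have [s [st' [_ e0 _]]] := main_exec x.
by have [_] := exec_run rk e0.
Qed.

(** * Simulating Turing machines by computable functions *)

Definition digit (c : cell) : nat := if c is Some b then b.+1 else 0.

Lemma digit_inj : injective digit.
Proof. by move=> [[]|] [[]|]. Qed.

Lemma digit_lt c : digit c < 3. Proof. by case: c => [[]|]. Qed.

(** Half tapes are numbers in base three; a blank is the digit zero, so that blanks written
    at the far end of a tape leave its code unchanged. *)
Fixpoint tcode (s : seq cell) : nat := if s is c :: s' then digit c + 3 * tcode s' else 0.

Lemma tcode_head s : tcode s %% 3 = digit (head None s).
Proof.
by case: s => //= c s; rewrite addnC mulnC modnMDl modn_small // digit_lt.
Qed.

Lemma tcode_behead s : tcode s %/ 3 = tcode (behead s).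
Proof.
by case: s => //= c s; rewrite addnC mulnC divnMDl // divn_small ?addn0 ?digit_lt.
Qed.

Definition tdigit (r i : nat) : nat := (r %/ 3 ^ i) %% 3.

Lemma comp2_tdigit : comp2 tdigit. Proof. by rewrite /tdigit; comp_tac. Qed.
Hint Resolve comp2_tdigit : computable.

(** The string on a half tape consists of the digits before the first zero, and the digits
    one and two are those of the bijective base two of [strcode]. *)
Definition tstring (N r : nat) : nat :=
  \sum_(0 <= i < N)
    (\sum_(0 <= j < i.+1) (tdigit r j == 0) == 0) * tdigit r i * 2 ^ i.

Lemma comp2_tstring : comp2 tstring. Proof. by rewrite /tstring; comp_tac. Qed.
Hint Resolve comp2_tstring : computable.

Lemma tdigitS d t i : d < 3 -> tdigit (d + 3 * t) i.+1 = tdigit t i.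
Proof.
by move=> d3; rewrite /tdigit expnS divnMA addnC [3 * t]mulnC divnMDl // (divn_small d3) addn0.
Qed.

Lemma tdigit0 d t : d < 3 -> tdigit (d + 3 * t) 0 = d.
Proof. by move=> d3; rewrite /tdigit expn0 divn1 addnC mulnC modnMDl modn_small. Qed.

Lemma tstring_tcode N s : tcode s <= N -> tstring N (tcode s) = strcode (bits_until_blank s).
Proof.
elim: s N => [|c s IH] N; rewrite /tstring /=.
  by move=> _; rewrite big1 // => i _; rewrite /tdigit div0n mod0n muln0.
move=> le; case: N le => [|N] le.
  by rewrite big_geq //; case: c le => [b|//] /=.
rewrite big_nat_recl // big_nat1 tdigit0 ?digit_lt // expn0 muln1.
rewrite (eq_big_nat _ _ (F2 := fun i => (digit c != 0) * (2 *
   ((\sum_(0 <= j < i.+1) (tdigit (tcode s) j == 0) == 0) * tdigit (tcode s) i * 2 ^ i)))); last first.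
  move=> i _; rewrite big_nat_recl // tdigit0 ?digit_lt // tdigitS ?digit_lt //.
  rewrite (eq_bigr (fun j => (tdigit (tcode s) j == 0) : nat)); last first.
    by move=> j _; rewrite tdigitS ?digit_lt.
  rewrite addn_eq0 eqb0 expnS.
  by case: (digit c != 0); case: eqP; rewrite ?mul0n ?muln0 ?mul1n //= mulnCA.
rewrite -big_distrr /= -big_distrr /= -/(tstring N (tcode s)).
case: c le => [b|_] /=; last by rewrite !mul0n.
move=> le; rewrite IH; last by lia.
by rewrite !mul1n addnC mul2n.
Qed.

Lemma tcode_string s : tcode (map Some s) = \sum_(0 <= i < size s) (nth false s i).+1 * 3 ^ i.
Proof.
elim: s => [|b s IH] /=; first by rewrite big_geq.
rewrite big_nat_recl //= expn0 muln1 IH big_distrr /=; congr addn.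
by apply: eq_bigr => i _; rewrite expnS mulnCA.
Qed.

Lemma comp1_tcode_str : comp1 (fun n => tcode (map Some (str n))).
Proof.
apply: (@comp_ext (fun e => \sum_(0 <= i < slen (e 0)) (bitn (e 0) i).+1 * 3 ^ i)).
  move=> e; rewrite tcode_string size_str; apply: eq_big_nat => i /andP[_ il].
  by rewrite nth_mkseq.
by comp_tac.
Qed.
Hint Resolve comp1_tcode_str : computable.

(** ** Vectors and tables *)

Definition enc (s : seq nat) : nat := foldr pairn 0 s.
Definition getn (j z : nat) : nat := fstn (iter j sndn z).

Lemma getn_enc j s : j < size s -> getn j (enc s) = nth 0 s j.
Proof.
rewrite /getn; elim: s j => //= a s IH [|j] js; first exact: pairnK1.
by rewrite iterSr pairnK2 IH.
Qed.

Lemma enc_inj s1 s2 : size s1 = size s2 -> enc s1 = enc s2 -> s1 = s2.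
Proof.
by elim: s1 s2 => [|a s1 IH] [|b s2] //= [/IH{}IH] /pairn_inj[-> /IH->].
Qed.

Lemma comp2_getn : comp2 getn.
Proof.
apply: (comp_app1 comp1_fstn).
apply: (@comp_ext (fun e => iteri (e 0) (fun _ acc => sndn acc) (e 1))).
  by move=> e; elim: (e 0) => //= n ->.
by apply: comp_iter; comp_tac.
Qed.
Hint Resolve comp2_getn : computable.

Lemma comp_enc (I : Type) (s : seq I) (G : I -> env -> nat) :
  (forall i, computable (G i)) -> computable (fun e => enc [seq G i e | i <- s]).
Proof.
move=> hG; elim: s => [|i s IH] /=; first exact: comp_zero.
exact: (comp_app2 comp2_pairn).
Qed.

Definition table (T : finType) (key val : T -> nat) (n : nat) : nat :=
  if [pick t | key t == n] is Some t then val t else 0.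

Lemma tableE (T : finType) (key val : T -> nat) t :
  injective key -> table key val (key t) = val t.
Proof.
move=> ki; rewrite /table; case: pickP => [t' /eqP/ki -> //|/(_ t)].
by rewrite eqxx.
Qed.

Lemma comp1_table (T : finType) (key val : T -> nat) : comp1 (table key val).
Proof.
apply: (@comp1_finite_support (\max_(t : T) key t).+1) => n lt.
rewrite /table; case: pickP => // t /eqP e.
by move: lt; rewrite -e ltnNge leq_bigmax.
Qed.
Hint Resolve comp1_table : computable.

(** ** Configurations *)

(** Finite oracles are numbers, so that a guess about an oracle is a datum of a
    computation. *)
Definition maskset (D : nat) : set bstr := [set w | odd (D %/ 2 ^ strcode w)].

Definition tape_code (t : tape) : nat := pairn (tcode t.1) (tcode t.2).

Definition move_code (m : move) : nat :=
  match m with MoveLeft => 0 | Stay => 1 | MoveRight => 2 end.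

Definition tape_actn (w m z : nat) : nat :=
  let l := fstn z in
  let r := w + 3 * (sndn z %/ 3) in
  if m == 0 then pairn (l %/ 3) (l %% 3 + 3 * r) else
  if m == 1 then pairn l r else pairn (w + 3 * l) (sndn z %/ 3).

Lemma tape_actnE a t :
  tape_actn (digit a.1) (move_code a.2) (tape_code t) = tape_code (tape_act a t).
Proof.
case: a => c m; case: t => l r; rewrite /tape_actn /tape_code pairnK1 pairnK2 /=.
by rewrite !tcode_behead; case: m => //=; rewrite tcode_head.
Qed.

Lemma comp3_tape_actn : comp3 tape_actn.
Proof. by rewrite /tape_actn; comp_tac. Qed.
Hint Resolve comp3_tape_actn : computable.

Section Simulation.
Variable M : otm.
Notation m := (otm_work M).+2.

Definition qcode (q : otm_state M) : nat := enum_rank q.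

Lemma qcode_inj : injective qcode.
Proof. by move=> q q' /val_inj /enum_rank_inj. Qed.

Definition cfg_code (c : config M) : nat :=
  pairn (qcode c.1) (enc [seq tape_code (c.2 i) | i : 'I_m <- enum 'I_m]).

Definition key (qr : otm_state M * {ffun 'I_m -> cell}) : nat :=
  pairn (qcode qr.1) (enc [seq digit (qr.2 i) | i : 'I_m <- enum 'I_m]).

Lemma key_inj : injective key.
Proof.
move=> [q r] [q' r'] /pairn_inj[/qcode_inj /= ->] /enc_inj.
rewrite !size_map => /(_ erefl) /eq_in_map e; congr pair; apply/ffunP => i.
by apply: digit_inj; apply: e; rewrite mem_enum.
Qed.

Definition stepn (D z : nat) : nat :=
  let q := fstn z in
  let v := sndn z in
  if table qcode (fun q => otm_halt q : nat) q == 1 then z else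
  if table qcode (fun q => otm_query q != None : nat) q == 1 then
    let r := sndn (getn (otm_work M).+1 v) in
    pairn (if odd (D %/ 2 ^ tstring r r)
           then table qcode (fun q => if otm_query q is Some (y, _) then qcode y else 0) q
           else table qcode (fun q => if otm_query q is Some (_, n) then qcode n else 0) q) v
  else
    let k := pairn q (enc [seq sndn (getn i v) %% 3 | i : 'I_m <- enum 'I_m]) in
    pairn (table key (fun qr => qcode (otm_trans qr.1 qr.2).1) k)
      (enc [seq tape_actn (table key (fun qr => digit ((otm_trans qr.1 qr.2).2 i).1) k)
                          (table key (fun qr => move_code ((otm_trans qr.1 qr.2).2 i).2) k)
                          (getn i v) | i : 'I_m <- enum 'I_m]).

Lemma getn_cfg (c : config M) (i : 'I_m) :
  getn i (sndn (cfg_code c)) = tape_code (c.2 i).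
Proof.
rewrite /cfg_code pairnK2 getn_enc; last by rewrite size_map size_enum_ord.
by rewrite (nth_map i) ?size_enum_ord // nth_ord_enum.
Qed.

Lemma stepnE D c : stepn D (cfg_code c) = cfg_code (step (maskset D) c).
Proof.
have eq1 : fstn (cfg_code c) = qcode c.1 by rewrite pairnK1.
rewrite /stepn eq1 !(tableE _ _ qcode_inj) eqb1 /step /halted.
case: (otm_halt c.1) => //.
case eq : (otm_query c.1) => [[y n]|] /=.
  rewrite (getn_cfg c ord_max) /tape_code pairnK2 tstring_tcode //.
  rewrite -[RHS]/(pairn (qcode _) _) /cfg_code pairnK2; congr pairn.
  rewrite -/(string_of_tape _) -/(query_string c).
  have -> : (query_string c \in maskset D) = odd (D %/ 2 ^ strcode (query_string c)).
    by apply/idP/idP; rewrite inE.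
  by case: ifP.
set rd := [ffun i => tape_read (c.2 i)].
have -> : pairn (qcode c.1) (enc [seq sndn (getn i (sndn (cfg_code c))) %% 3 | i : 'I_m <- enum 'I_m])
    = key (c.1, rd).
  congr (pairn _ (enc _)); apply: eq_map => i.
  by rewrite getn_cfg pairnK2 tcode_head ffunE.
rewrite !(tableE _ _ key_inj) -[RHS]/(pairn (qcode _) _); congr (pairn _ (enc _)).
by apply: eq_map => i; rewrite !(tableE _ _ key_inj) getn_cfg tape_actnE ffunE.
Qed.

Lemma comp2_stepn : comp2 stepn.
Proof.
have hr : computable (fun e => enc [seq sndn (getn i (sndn (e 1))) %% 3 | i : 'I_m <- enum 'I_m]).
  by apply: comp_enc => i; comp_tac.
rewrite /stepn; comp_tac => //.
apply: comp_enc => i; comp_tac => //.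
Qed.

Definition initn (x : nat) : nat :=
  pairn (qcode (otm_start M))
    (enc [seq pairn 0 (if i == ord0 then tcode (map Some (str x)) else 0) | i : 'I_m <- enum 'I_m]).

Lemma initnE x : initn x = cfg_code (init M (str x)).
Proof.
congr (pairn _ (enc _)); apply: eq_map => i; rewrite /= ffunE /tape_code.
by case: eqP.
Qed.

Definition runn (x s D : nat) : nat := iter s (stepn D) (initn x).

Lemma runnE x s D : runn x s D = cfg_code (run M (maskset D) (str x) s).
Proof. by rewrite /runn /run initnE; elim: s => //= s ->; rewrite stepnE. Qed.

Lemma comp3_runn : comp3 runn.
Proof.
have hi : comp1 initn.
  rewrite /initn; comp_tac; apply: comp_enc => i.
  apply: (comp_app2 comp2_pairn); first exact: comp_zero.
  by case: (i == ord0); [apply: comp1_tcode_str|apply: comp_zero].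
apply: (@comp_ext (fun e => iteri (e 1) (fun _ acc => stepn (e 2) acc) (initn (e 0)))).
  by move=> e; rewrite /runn; elim: (e 1) => //= n ->.
have hs := comp2_stepn.
by apply: comp_iter; comp_tac.
Qed.

Definition simh (x s D : nat) : bool := halted (run M (maskset D) (str x) s).
Definition simo (x s D : nat) : nat := strcode (output (run M (maskset D) (str x) s)).

Lemma comp3_simh : comp3 (fun x s D => simh x s D : nat).
Proof.
apply: (@comp_ext (fun e => table qcode (fun q => otm_halt q : nat)
   (fstn (runn (e 0) (e 1) (e 2))))).
  by move=> e; rewrite runnE pairnK1 tableE //; apply: qcode_inj.
by have hr := comp3_runn; comp_tac.
Qed.

Lemma comp3_simo : comp3 simo.
Proof.
apply: (@comp_ext (fun e => let r := sndn (getn 0 (sndn (runn (e 0) (e 1) (e 2)))) in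
  tstring r r)).
  move=> e; cbv zeta; rewrite runnE (getn_cfg _ ord0) pairnK2 tstring_tcode //.
by have hr := comp3_runn; cbv zeta; comp_tac.
Qed.

End Simulation.
Hint Resolve comp3_simh comp3_simo : computable.

(** * Enumerations and prefix-free machines *)

(** All that is used about a machine computing [F]: [h p s] says that the computation on
    the string with code [p] has halted by stage [s], and then [o p s] codes its output. *)
Record enumerates (F : bstr -> option bstr) (h : nat -> nat -> bool) (o : nat -> nat -> nat) :
    Prop := Enumerates {
  enum_comph : comp2 (fun p s => h p s : nat);
  enum_compo : comp2 o;
  enum_mono : forall p s s', s <= s' -> h p s -> h p s';
  enum_dom : forall p, dom F (str p) <-> exists s, h p s;
  enum_val : forall p s, h p s -> F (str p) = Some (str (o p s)) }.

Lemma maskset0 : maskset 0 = set0.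
Proof. by apply/seteqP; split=> w //; rewrite /maskset /= div0n. Qed.

Lemma partial_recursive_enum F : partial_recursive F ->
  exists h o, enumerates F h o.
Proof.
move=> [M [_ hM]].
exists (fun p s => simh M p s 0), (fun p s => simo M p s 0); split.
- exact: (comp_app3 (comp3_simh M) (comp_var 0) (comp_var 1) comp_zero).
- exact: (comp_app3 (comp3_simo M) (comp_var 0) (comp_var 1) comp_zero).
- by move=> p s s' ss h; rewrite /simh (halted_run ss h).
- move=> p; rewrite /dom /simh maskset0; split.
    rewrite /=; case e : (F (str p)) => [y|//] _.
    by have [t [ht _]] := (hM _ _).1 e; exists t.
  move=> [s hs] /=; suff -> : F (str p) = Some (output (run M set0 (str p) s)) by [].
  by apply/hM; exists s.
- move=> p s; rewrite /simh /simo maskset0 strcodeK => hs.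
  by apply/hM; exists s.
Qed.

Lemma strcode_unary n : strcode (string_of_nat n) = 2 ^ n.+1 - 2.
Proof.
rewrite /string_of_nat; elim: n => //= n ->.
by have := expn_gt0 2 n; rewrite !expnS; lia.
Qed.

(** The halting time of a total computation is obtained by minimization; the unary input
    and output have to be translated, hence [strcode_unary] and the length [slen]. *)
Lemma total_recursive_comp g : total_recursive g -> comp1 g.
Proof.
move=> [F [/partial_recursive_enum[h [v [hh ho _ hd hv]]] hF]].
pose c n := 2 ^ n.+1 - 2.
have hc : comp1 c by rewrite /c; comp_tac.
have strc n : str (c n) = string_of_nat n by rewrite /c -strcode_unary strcodeK.
have ex n : exists s, h (c n) s by apply/hd; rewrite /dom /= strc hF.
pose t n := ex_minn (ex n).
have ht : comp1 t.
  apply: (@comp_mu (fun e => ~~ h (c (e 1)) (e 0) : nat)).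
  - have h1 : comp2 (fun p s => ~~ h p s : nat) by apply: comp_negb.
    by apply: (comp_app2 h1); [apply: (comp_app1 hc)|]; apply: comp_var.
  - by move=> e; rewrite /= /t; case: ex_minnP => s ->.
  - move=> e i; rewrite /= /t; case: ex_minnP => s _ smin lt.
    by rewrite eqb0 negbK; apply: contraL lt => /smin; rewrite -leqNgt.
apply: (@comp_ext (fun e => slen (v (c (e 0)) (t (e 0))))); last by comp_tac.
move=> e; have := hF (e 0); rewrite -strc (hv _ (t (e 0))).
  by move=> [/(congr1 size)]; rewrite size_str size_nseq.
by rewrite /t; case: ex_minnP.
Qed.

(** The value of a string as a binary numeral, its first bit being the most significant. *)
Fixpoint num (s : bstr) : nat := if s is b :: s' then b * 2 ^ size s' + num s' else 0.

Lemma num_lt s : num s < 2 ^ size s.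
Proof. by elim: s => //= b s IH; rewrite expnS; case: b; lia. Qed.

Lemma num_cat s t : num (s ++ t) = num s * 2 ^ size t + num t.
Proof.
by elim: s => //= b s ->; rewrite size_cat expnD mulnDl mulnA addnA.
Qed.

Lemma num_sum s : num s = \sum_(0 <= j < size s) nth false s j * 2 ^ (size s - j.+1).
Proof.
elim: s => [|b s IH] /=; first by rewrite big_geq.
by rewrite big_nat_recl //= subn1 IH.
Qed.

Lemma num_surj l k : k < 2 ^ l -> exists2 s, size s = l & num s = k.
Proof.
elim: l k => [|l IH] k; first by rewrite expn0 ltnS leqn0 => /eqP->; exists [::].
rewrite expnS => lt.
have [|s ss ns] := IH (k - (2 ^ l <= k) * 2 ^ l); first by case: leqP => ?; lia.
exists ((2 ^ l <= k) :: s) => /=; rewrite ss // ns.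
by case: leqP => ?; lia.
Qed.

Lemma num_inj s t : size s = size t -> num s = num t -> s = t.
Proof.
elim: s t => [|b s IH] [|c t] //= [st]; rewrite st => e.
have := num_lt s; have := num_lt t; rewrite st => lt ls.
have bc : b = c by move: e; case: (b); case: (c) => //; lia.
by rewrite bc; congr cons; apply: IH => //; move: e; rewrite bc; lia.
Qed.

Definition numn (n : nat) : nat := num (str n).

Lemma comp1_numn : comp1 numn.
Proof.
apply: (@comp_ext (fun e =>
  \sum_(0 <= j < slen (e 0)) bitn (e 0) j * 2 ^ (slen (e 0) - j.+1))); last by comp_tac.
move=> e; rewrite /numn num_sum size_str; apply: eq_big_nat => j /andP[_ jl].
by rewrite nth_mkseq.
Qed.
Hint Resolve comp1_numn : computable.

Lemma search_fun_some P U x y : search_fun P U x = Some y ->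
  exists2 s, P (strcode x) s != 0 & y = str (U (strcode x) s).
Proof.
rewrite /search_fun; case: pselect => // ex [<-].
by case: ex_minnP => s Ps _; exists s.
Qed.

Lemma search_fun_ex P U x s : P (strcode x) s != 0 -> search_fun P U x != None.
Proof. by move=> Ps; rewrite /search_fun; case: pselect => // -[]; exists s. Qed.

Import Order.TTheory GRing.Theory Num.Theory.
Import numFieldNormedType.Exports.

Section Kraft.
Variables (R : realFieldType) (ev : nat -> bool) (len : nat -> nat).

Let weight (i : nat) : R := ((ev i)%:R / 2%:R ^+ len i)%R.
Let S (i : nat) : R := (\sum_(0 <= j < i) weight j)%R.

(** The prefix sum of the weights, as a fraction with denominator [2 ^ scale i]. *)
Let scale (i : nat) : nat := \sum_(0 <= j < i) len j.
Let numer (i : nat) : nat := \sum_(0 <= j < i) ev j * 2 ^ (scale i - len j).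

(** The least multiple of [2 ^- (len i).+1] that is at least [S i]; since twice this unit
    fits in the weight of [i], it starts a dyadic interval inside [S i, S i.+1]. *)
Let start (i : nat) : nat :=
  (numer i * 2 ^ (len i).+1 + (2 ^ scale i).-1) %/ 2 ^ scale i.

Definition codeword (i x : nat) : bool :=
  [&& ev i, slen x == (len i).+1 & numn x == start i].

Lemma comp2_codeword : comp1 (fun i => ev i : nat) -> comp1 len ->
  comp2 (fun i x => codeword i x : nat).
Proof.
move=> he hl.
have hs : comp1 scale by rewrite /scale; comp_tac.
have hn : comp1 numer by rewrite /numer; comp_tac.
have ht : comp1 start by rewrite /start; comp_tac.
by rewrite /codeword; comp_tac.
Qed.

Local Open Scope ring_scope.

Lemma numerE i : S i * 2 ^+ scale i = (numer i)%:R.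
Proof.
rewrite /S /numer big_distrl natr_sum /=; apply: eq_big_nat => j /andP[_ ji].
rewrite /weight natrM natrX -mulrA; congr *%R.
have le : (len j <= scale i)%N by rewrite /scale (bigD1_seq j) ?mem_index_iota ?iota_uniq // leq_addr.
by rewrite -[in LHS](subnK le) exprD mulrC mulfK // expf_neq0 // pnatr_eq0.
Qed.

Lemma start_bounds i : S i * 2 ^+ (len i).+1 <= (start i)%:R < S i * 2 ^+ (len i).+1 + 1.
Proof.
have p0 : 0 < 2 ^+ scale i :> R by rewrite exprn_gt0.
rewrite -(ler_pM2r p0) -(ltr_pM2r p0) mulrDl mul1r mulrAC numerE.
rewrite -!natrX -!natrM -natrD ler_nat ltr_nat.
rewrite /start; set n := (numer i * _)%N; set d := (2 ^ scale i)%N.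
have d0 : (0 < d)%N by rewrite expn_gt0.
have := divn_eq (n + d.-1) d; have := ltn_pmod (n + d.-1) d0.
set a := (_ %/ d * d)%N; set b := (_ %% d)%N; lia.
Qed.

Lemma weight_unit i : ev i -> weight i * 2 ^+ (len i).+1 = 2.
Proof.
by move=> ei; rewrite /weight ei exprS mul1r mulrCA mulVf ?mulr1.
Qed.

Lemma codeword_interval i x : codeword i x ->
  S i <= (num (str x))%:R / 2 ^+ size (str x) /\
  (num (str x)).+1%:R / 2 ^+ size (str x) <= S i.+1.
Proof.
move=> /and3P[ei /eqP sx /eqP nx]; rewrite size_str sx -/(numn x) nx.
have /andP[h1 h2] := start_bounds i.
have p0 : 0 < 2 ^+ (len i).+1 :> R by rewrite exprn_gt0.
split; first by rewrite ler_pdivlMr.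
rewrite ler_pdivrMr // [S i.+1]/S big_nat_recr //= -/(S i) mulrDl -addn1 natrD.
rewrite weight_unit //; lra.
Qed.

Lemma S_mono i j : (i <= j)%N -> S i <= S j.
Proof.
move=> ij; rewrite /S (@big_cat_nat _ _ _ i 0%N j) //= lerDl sumr_ge0 // => k _.
by rewrite mulr_ge0 // invr_ge0 exprn_ge0.
Qed.

Lemma prefix_interval p q : prefix p q ->
  (num p)%:R / 2 ^+ size p <= (num q)%:R / 2 ^+ size q :> R /\
  (num q)%:R / 2 ^+ size q < (num p).+1%:R / 2 ^+ size p :> R.
Proof.
move=> /prefixP[r ->]; rewrite num_cat size_cat exprD.
have p0 n : 0 < 2 ^+ n :> R by rewrite exprn_gt0.
have e (n : nat) : n%:R / 2 ^+ size p =
    (n * 2 ^ size r)%:R / (2 ^+ size p * 2 ^+ size r) :> R.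
  by rewrite natrM natrX -mulf_div divff ?mulr1 // expf_neq0 // pnatr_eq0.
rewrite !e ler_pM2r ?ltr_pM2r ?invr_gt0 ?mulr_gt0 // ler_nat ltr_nat.
by rewrite leq_addr mulSn addnC ltn_add2r num_lt.
Qed.

(** Different requests own disjoint intervals, and the interval of a string contains those
    of its extensions. *)
Lemma codeword_inj i j x y : codeword i x -> codeword j y ->
  prefix (str x) (str y) -> i = j /\ x = y.
Proof.
move=> hi hj pxy; have [l1 u1] := codeword_interval hi.
have [l2 u2] := codeword_interval hj; have [p1 p2] := prefix_interval pxy.
have ij : i = j.
  have lt2 : (num (str y))%:R / 2 ^+ size (str y) <
      (num (str y)).+1%:R / 2 ^+ size (str y) :> R.
    by rewrite ltr_pM2r ?invr_gt0 ?exprn_gt0 // ltr_nat.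
  case: (ltngtP i j) => // /S_mono h.
    by have := le_lt_trans (le_trans u1 (le_trans h l2)) p2; rewrite ltxx.
  by have := le_lt_trans (le_trans u2 (le_trans h (le_trans l1 p1))) lt2; rewrite ltxx.
split=> //; move: hi hj; rewrite ij => /and3P[_ /eqP sx /eqP nx] /and3P[_ /eqP sy /eqP ny].
by apply: str_inj; apply: num_inj; rewrite ?size_str ?sx ?sy // [LHS]nx [RHS]ny.
Qed.

Hypothesis S_le1 : forall N, S N <= 1.

Lemma codeword_ex i : ev i -> exists x, codeword i x.
Proof.
move=> ei; have [|s ss ns] := @num_surj (len i).+1 (start i).
  have p0 : 0 < 2 ^+ (len i).+1 :> R by rewrite exprn_gt0.
  have /andP[_ h] := start_bounds i.
  have h1 := S_le1 i.+1; rewrite [S i.+1]/S big_nat_recr //= -/(S i) in h1.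
  rewrite -(ltr_nat R) natrX; move: h1; rewrite -(ler_pM2r p0) mulrDl mul1r.
  by rewrite weight_unit //; lra.
by exists (strcode s); rewrite /codeword ei -size_str /numn strcodeK ss ns !eqxx.
Qed.

(** The Kraft-Chaitin theorem: requests for codewords of lengths [len i] that satisfy the
    Kraft inequality are granted by a prefix-free machine, at the price of one more bit. *)
Lemma kraft_machine (G : nat -> nat -> nat) :
  comp1 (fun i => ev i : nat) -> comp1 len -> comp2 G ->
  exists2 F, prefix_free_machine F & forall i, ev i -> (exists s, G i s != 0%N) ->
    exists p s, [/\ size p = (len i).+1, G i s != 0%N & F p = Some (str (G i s).-1)].
Proof.
move=> he hl hG.
pose P x z := (codeword (fstn z) x && (G (fstn z) (sndn z) != 0%N) : nat).
pose U (x : nat) z := (G (fstn z) (sndn z)).-1.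
have hP : comp2 P.
  by have hc := comp2_codeword he hl; rewrite /P; comp_tac.
have hU : comp2 U by rewrite /U; comp_tac.
exists (search_fun P U).
  split; first exact: partial_recursive_search.
  move=> p q; rewrite /dom /=.
  case ep : (search_fun P U p) => [y|//] _; case eq : (search_fun P U q) => [y'|//] _ pq.
  have [s] := search_fun_some ep; rewrite eqb0 negbK => /andP[cs _] _.
  have [t] := search_fun_some eq; rewrite eqb0 negbK => /andP[ct _] _.
  have [|_ /strcode_inj //] := codeword_inj cs ct.
  by rewrite !strcodeK.
move=> i ei [s Gs]; have [x cx] := codeword_ex ei.
have Px : P (strcode (str x)) (pairn i s) != 0%N.
  by rewrite /P pairnK1 pairnK2 strK cx Gs.
have := search_fun_ex U Px; case e : (search_fun P U (str x)) => [y|//] _.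
have [z] := search_fun_some e; rewrite strK eqb0 negbK => /andP[cz Gz] ey.
have [|ei' _] := codeword_inj cz cx; first exact: prefix_refl.
exists (str x), (sndn z); rewrite -ei'; split=> //; last by rewrite e ey.
by have /and3P[_ /eqP sx _] := cz; rewrite size_str sx.
Qed.

End Kraft.

(** * Sums over prefix-free sets *)

Local Open Scope ring_scope.

Lemma str_double i (b : bool) : str (i.*2 + b.+1) = b :: str i.
Proof. by rewrite -[RHS]strcodeK /= strK. Qed.

Lemma sum_double (R : nmodType) (F : nat -> R) m :
  \sum_(0 <= i < m.*2.+1) F i =
  F 0%N + \sum_(0 <= i < m) (F (i.*2 + 1)%N + F (i.*2 + 2)%N).
Proof.
elim: m => [|m IH]; first by rewrite big_nat1 big_geq // addr0.
rewrite doubleS big_nat_recr //= big_nat_recr //= IH [in RHS]big_nat_recr //= !addrA.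
by rewrite addn1 addn2.
Qed.

(** By induction on the length, splitting the strings according to their first bit.  The
    codes make the splitting arithmetic: those of [false :: s] and [true :: s] are
    [2 i + 1] and [2 i + 2] when that of [s] is [i]. *)
Lemma kraft_inequality (R : realFieldType) (P : bstr -> bool) N :
  (forall p q, P p -> P q -> prefix p q -> p = q) ->
  \sum_(0 <= i < N) (P (str i))%:R / 2 ^+ slen i <= 1 :> R.
Proof.
have le_sum (M : nat) (Q : bstr -> bool) : (N <= M)%N ->
    \sum_(0 <= i < N) (Q (str i))%:R / 2 ^+ slen i <=
    \sum_(0 <= i < M) (Q (str i))%:R / 2 ^+ slen i :> R.
  by move=> NM; rewrite [leRHS](@big_cat_nat _ _ _ N) //= lerDl sumr_ge0.
move=> pf; apply: le_trans (le_sum (2 ^ N - 1)%N P _) _.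
  by rewrite leq_subRL ?expn_gt0 // add1n ltn_expl.
elim: N P pf {le_sum} => [|N IH] P pf; first by rewrite big_geq.
have -> : (2 ^ N.+1 - 1 = (2 ^ N - 1).*2.+1)%N.
  by rewrite expnS; have := expn_gt0 2 N; lia.
rewrite sum_double (eq_bigr (fun i => 2^-1 * ((P (false :: str i))%:R / 2 ^+ slen i)
    + 2^-1 * ((P (true :: str i))%:R / 2 ^+ slen i))); last first.
  move=> i _; rewrite -!size_str (str_double i false) (str_double i true) /= !exprS.
  by congr (_ + _); rewrite invfM mulrCA.
have s0 : slen 0%N = 0%N by rewrite /slen big_geq.
have e0 : str 0%N = [::] by rewrite /str s0.
rewrite e0 s0.
rewrite big_split /= -!big_distrr /= expr0 divr1.
case: (boolP (P [::])) => P0.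
  rewrite !big1 ?mulr0 ?addr0 // => i _; rewrite [P _](_ : _ = false) ?mul0r //.
    by apply/negP => /(pf _ _ P0) /(_ (prefix0s _)).
  by apply/negP => /(pf _ _ P0) /(_ (prefix0s _)).
have h b : \sum_(0 <= i < 2 ^ N - 1) (P (b :: str i))%:R / 2 ^+ slen i <= 1 :> R.
  apply: (IH (fun s => P (b :: s))) => p q hp hq pq.
  by have := pf _ _ hp hq; rewrite prefix_cons eqxx /= => /(_ pq) [].
have -> : false%:R = 0 :> R by [].
by have h0 := h false; have h1 := h true; lra.
Qed.

Lemma enum_below V h o n : enumerates V h o ->
  exists t, forall p, (p < n)%N -> str p \in dom V -> h p t.
Proof.
move=> hV; elim: n => [|n [t ht]]; first by exists 0%N.
case: (boolP (str n \in dom V)) => hn; last first.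
  exists t => p; rewrite ltnS leq_eqVlt => /orP[/eqP->|/ht//].
  by rewrite (negbTE hn).
have [s hs] : exists s, h n s by apply/(enum_dom hV); rewrite inE in hn.
exists (maxn t s) => p.
rewrite ltnS leq_eqVlt => /orP[/eqP-> _|/ht ht' /ht' hp].
  by apply: (enum_mono hV _ hs); rewrite ?leq_maxr.
by apply: (enum_mono hV _ hp); rewrite ?leq_maxl.
Qed.

(** * The partition function as a supremum *)

Section PartitionFunction.
Variables (R : realType) (T : R) (V : bstr -> option bstr).
Hypotheses (T0 : 0 < T) (T1 : T < 1) (pfV : prefix_free (dom V)).
Variables (h : nat -> nat -> bool) (o : nat -> nat -> nat).
Hypothesis (hV : enumerates V h o).

Definition bweight (k : nat) : R := 2 `^ (- (k%:R / T)).

Lemma bweight_ge0 k : 0 <= bweight k. Proof. exact: powR_ge0. Qed.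

Lemma bweight_le k : bweight k <= 2 ^- k.
Proof.
rewrite -powR_invn // ler_powR ?ler1n // lerN2 ler_pdivlMr //.
by rewrite ler_piMr ?ler0n // ltW.
Qed.

Definition Zpart (s : nat) : R := \sum_(0 <= p < s) (h p s)%:R * bweight (slen p).

Lemma Zpart_new s p t : (p < t)%N -> (s <= t)%N -> h p t -> ~~ ((p < s)%N && h p s) ->
  Zpart s + bweight (slen p) <= Zpart t.
Proof.
move=> pt st hpt nps; rewrite /Zpart [leRHS](bigD1_seq p) ?mem_index_iota ?iota_uniq //=.
rewrite hpt mul1r [leRHS]addrC lerD2r.
rewrite [leRHS]big_mkcond /= [leRHS](@big_cat_nat _ _ _ s) //=.
rewrite -[leLHS]addr0 lerD //; last first.
  by rewrite sumr_ge0 // => i _; case: ifP => // _; rewrite mulr_ge0 ?bweight_ge0.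
rewrite big_nat [leRHS]big_nat ler_sum // => i /andP[_ si].
case: eqP => [ip|_] /=.
  by move: nps; rewrite -ip si /= => /negbTE->; rewrite mul0r.
rewrite ler_wpM2r ?bweight_ge0 // ler_nat.
by case e : (h i s) => //; rewrite (enum_mono hV st e).
Qed.

Lemma Zpart_mono s t : (s <= t)%N -> Zpart s <= Zpart t.
Proof.
move=> st; rewrite /Zpart [leRHS](@big_cat_nat _ _ _ s) //=.
rewrite -[leLHS]addr0 lerD //; last first.
  by rewrite sumr_ge0 // => i _; rewrite mulr_ge0 ?bweight_ge0.
rewrite ler_sum // => i _; rewrite ler_wpM2r ?bweight_ge0 // ler_nat.
by case e : (h i s) => //; rewrite (enum_mono hV st e).
Qed.

Let d (n : nat) : R := \sum_(0 <= p < n) (str p \in dom V)%:R * bweight (slen p).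

Lemma domP p : (str p \in dom V) <-> exists s, h p s.
Proof. by rewrite inE; apply: (enum_dom hV). Qed.

Lemma d_le1 n : d n <= 1.
Proof.
apply: le_trans (_ : \sum_(0 <= p < n) (str p \in dom V)%:R / 2 ^+ slen p <= 1).
  by apply: ler_sum => i _; rewrite ler_wpM2l // bweight_le.
apply: (@kraft_inequality _ (fun p => p \in dom V)) => p q.
by rewrite !inE; apply: pfV.
Qed.

Lemma d_mono : {homo d : m n / (m <= n)%N >-> m <= n}.
Proof.
move=> m n mn; rewrite /d [leRHS](@big_cat_nat _ _ _ m) //= lerDl sumr_ge0 // => i _.
by rewrite mulr_ge0 ?bweight_ge0.
Qed.

Lemma Zpart_d s : Zpart s <= d s.
Proof.
apply: ler_sum => i _; rewrite ler_wpM2r ?bweight_ge0 // ler_nat.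
by case e : (h i s) => //; rewrite (_ : _ \in _) //; apply/domP; exists s.
Qed.

Lemma d_Zpart n : exists2 s, (n <= s)%N & d n <= Zpart s.
Proof.
have [t ht] := enum_below n hV.
exists (maxn n t); first exact: leq_maxl.
apply: le_trans (_ : \sum_(0 <= p < n) (h p (maxn n t))%:R * bweight (slen p) <= _).
  rewrite /d big_nat [leRHS]big_nat ler_sum // => i /andP[_ il].
  rewrite ler_wpM2r ?bweight_ge0 // ler_nat.
  case: (boolP (str i \in dom V)) => // hi.
  by rewrite (enum_mono hV _ (ht _ il hi)) // leq_maxr.
rewrite /Zpart [leRHS](@big_cat_nat _ _ _ n) //= ?leq_maxl // lerDl sumr_ge0 // => i _.
by rewrite mulr_ge0 ?bweight_ge0.
Qed.

(** The sum over strings is a series over their codes, whose partial sums are bounded by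
    the Kraft inequality because [T < 1]. *)
Lemma Z_sup : Z V T = sup (range d).
Proof.
rewrite /Z (@reindex_esum _ _ _ [set p | str p \in dom V] (dom V) str); last first.
  split=> [p|p q _ _ /str_inj //|x xV].
    by rewrite /= inE.
  by exists (strcode x); rewrite /= ?strcodeK // inE.
rewrite -(@nneseries_esum _ _ (fun p => str p \in dom V)); last first.
  by move=> p _; rewrite lee_fin powR_ge0.
have -> : (fun n => \sum_(0 <= i < n | str i \in dom V)
     (2 `^ (- ((size (str i))%:R / T)))%:E)%E = EFin \o d.
  apply/funext => n; rewrite /= /d -sumEFin big_mkcond /=; apply: eq_bigr => i _.
  by rewrite size_str; case: ifP; rewrite ?mul1r ?mul0r.
have ub : has_ubound (range d) by exists 1 => _ [n _ <-]; apply: d_le1.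
have cv := nondecreasing_cvgn d_mono ub.
rewrite EFin_lim; last by apply/cvg_ex; eexists; exact: cv.
by rewrite (cvg_lim _ cv).
Qed.

Lemma Zpart_le s : Zpart s <= Z V T.
Proof.
apply: le_trans (Zpart_d s) _; rewrite Z_sup; apply: ub_le_sup; last by exists s.
by exists 1 => _ [n _ <-]; apply: d_le1.
Qed.

Lemma Zpart_lt e : e < Z V T -> exists s, forall t, (s <= t)%N -> e < Zpart t.
Proof.
rewrite Z_sup => lt.
have [||_ [n _ <-]] := @sup_adherent R (range d) (sup (range d) - e).
- by rewrite subr_gt0.
- split; first by exists (d 0), 0%N.
  by exists 1 => _ [n _ <-]; apply: d_le1.
rewrite subKr => en; have [s ns ds] := d_Zpart n.
by exists s => t st; apply: lt_le_trans en (le_trans ds (Zpart_mono st)).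
Qed.

(** Why the first bits of [Z] bound halting times: once [Zpart s] is close to [Z], a
    program found later has a small weight, and is therefore long. *)
Lemma Zpart_missing s p : str p \in dom V -> ~~ ((p < s)%N && h p s) ->
  Zpart s + bweight (slen p) <= Z V T.
Proof.
move=> /domP[t ht] nps; apply: le_trans (Zpart_le (maxn (maxn s t) p.+1)).
apply: Zpart_new => //; first by rewrite leq_max leqnn orbT.
  by rewrite !leq_max leqnn.
by apply: (enum_mono hV _ ht); rewrite ?leq_max ?leqnn ?orbT //.
Qed.

Lemma kraft_found N s : \sum_(0 <= p < N) (h p s)%:R / 2 ^+ slen p <= 1 :> R.
Proof.
apply: le_trans (_ : \sum_(0 <= p < N) (str p \in dom V)%:R / 2 ^+ slen p <= 1).
  apply: ler_sum => i _; rewrite ler_wpM2r ?invr_ge0 ?exprn_ge0 // ler_nat.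
  by case e : (h i s) => //; rewrite (_ : _ \in _) //; apply/domP; exists s.
apply: (@kraft_inequality _ (fun p => p \in dom V)) => p q.
by rewrite !inE; apply: pfV.
Qed.

End PartitionFunction.

(** * Binary expansions *)

Lemma num_rcons s b : num (rcons s b) = ((num s).*2 + b)%N.
Proof. by rewrite -cats1 num_cat /= expn1 muln2 muln1 addn0. Qed.

Section BinaryExpansion.
Variable R : realType.

Lemma exp2_small (e : R) : 0 < e -> exists N, forall n, (N <= n)%N -> 2 ^- n < e.
Proof.
move=> e0; exists (Num.bound e^-1) => n Nn.
have p0 : 0 < 2 ^+ n :> R by rewrite exprn_gt0.
rewrite -[ltRHS]invrK ltf_pV2 ?posrE ?invr_gt0 //.
apply: lt_trans (archi_boundP _) _; first by rewrite invr_ge0 ltW.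
by rewrite -natrX ltr_nat (leq_ltn_trans Nn) // ltn_expl.
Qed.

Lemma dyadic_double (a m : nat) : a%:R / 2 ^+ m = a.*2%:R / 2 ^+ m.+1 :> R.
Proof.
by rewrite -muln2 natrM exprSr -mulf_div divff ?mulr1 // pnatr_eq0.
Qed.

Lemma num_mkseq_series (b : nat -> bool) n :
  (num (mkseq b n))%:R / 2 ^+ n = series (fun k => (b k)%:R / 2 ^+ k.+1 : R) n.
Proof.
elim: n => [|n IH]; first by rewrite /series /= big_geq // mul0r.
rewrite seriesSr -IH mkseqS num_rcons natrD -muln2 natrM exprS.
have p0 : 2 ^+ n != 0 :> R by rewrite expf_neq0 // pnatr_eq0.
by field.
Qed.

(** Infinitely many zeros make the upper bound strict. *)
Lemma base_two_expansion_num (alpha : R) (b : nat -> bool) n :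
  let beta := alpha - (Num.floor alpha)%:~R in base_two_expansion alpha b ->
  (num (mkseq b n))%:R / 2 ^+ n <= beta < (num (mkseq b n)).+1%:R / 2 ^+ n.
Proof.
move=> beta [zeros cv]; set u := series _ in cv.
have uE m : u m = (num (mkseq b m))%:R / 2 ^+ m by rewrite num_mkseq_series.
have p0 m : 0 < 2 ^+ m :> R by rewrite exprn_gt0.
have und : {homo u : i j / (i <= j)%N >-> i <= j}.
  by move=> i j ij; apply: nondecreasing_series.
have ule m : u m <= beta.
  have <- : limn u = beta by apply: cvg_lim.
  by apply: nondecreasing_cvgn_le => //; apply/cvg_ex; eexists; exact: cv.
have vni m : (num (mkseq b m.+1)).+1%:R / 2 ^+ m.+1 <= (num (mkseq b m)).+1%:R / 2 ^+ m :> R.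
  rewrite mkseqS num_rcons [leRHS]dyadic_double ler_pM2r ?invr_gt0 // ler_nat.
  by case: (b m); lia.
have vn i j : (i <= j)%N ->
    (num (mkseq b j)).+1%:R / 2 ^+ j <= (num (mkseq b i)).+1%:R / 2 ^+ i :> R.
  by elim: j => [|j IH]; rewrite leq_eqVlt ?ltnS => /orP[/eqP-> //|//] /IH; apply: le_trans.
rewrite -uE ule /=.
have [k nk bk] := zeros n; apply: lt_le_trans (vn _ _ nk).
apply: (@le_lt_trans _ _ ((num (mkseq b k.+1)).+1%:R / 2 ^+ k.+1)).
  apply: (cvgr_to_le cv); exists k.+1 => // j /= kj.
  by rewrite uE; apply: le_trans (vn _ _ kj); rewrite ler_pM2r ?invr_gt0 // ler_nat.
rewrite mkseqS num_rcons bk addn0 [ltRHS]dyadic_double.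
by rewrite ltr_pM2r ?invr_gt0 // ltr_nat; lia.
Qed.

(** The digits are read off the integer parts of [2 ^ k * beta]; if they were all one from
    some place on, [beta] would reach the next dyadic number. *)
Lemma base_two_expansion_ex (alpha : R) : exists b, base_two_expansion alpha b.
Proof.
set beta := alpha - (Num.floor alpha)%:~R.
have b0 : 0 <= beta by rewrite subr_ge0 floor_le.
have b1 : beta < 1 by rewrite ltrBlDr addrC; have := floorD1_gt alpha; rewrite intrD.
have p0 m : 0 < 2 ^+ m :> R by rewrite exprn_gt0.
pose F k := Num.truncn (2 ^+ k * beta).
have Fb k : (F k)%:R <= 2 ^+ k * beta < (F k).+1%:R.
  by apply: truncn_itv; rewrite mulr_ge0 // ltW.
pose b k := odd (F k.+1).
have F0 : F 0%N = 0%N.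
  have := Fb 0%N; rewrite expr0 mul1r => /andP[h _].
  by have := le_lt_trans h b1; rewrite -[X in _ < X]/(1%:R) ltr_nat; lia.
have FS k : F k.+1 = ((F k).*2 + b k)%N.
  have /andP[h1 h2] := Fb k; have /andP[h3 h4] := Fb k.+1.
  have e : 2 ^+ k.+1 * beta = 2 * (2 ^+ k * beta) by rewrite exprS mulrA.
  have l1 : (F k.+1 < (F k).+1.*2)%N.
    by rewrite -(ltr_nat R) -muln2 natrM; rewrite e in h3; lra.
  have l2 : ((F k).*2 < (F k.+1).+1)%N.
    by rewrite -(ltr_nat R) -muln2 natrM; rewrite e in h4; lra.
  by rewrite /b; have := odd_double_half (F k.+1); case: (odd _) => /=; lia.
have numF n : num (mkseq b n) = F n.
  by elim: n => [|n IH]; rewrite ?F0 // mkseqS num_rcons IH FS.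
have ser n : series (fun k => (b k)%:R / 2 ^+ k.+1 : R) n = (F n)%:R / 2 ^+ n.
  by rewrite -num_mkseq_series numF.
exists b; split; last first.
  rewrite -/beta; apply/cvgrPdist_lt => e e0.
  have [N hN] := exp2_small e0.
  exists N => // n /= Nn; rewrite ser.
  have /andP[h1 h2] := Fb n.
  apply: lt_trans (hN n Nn); rewrite -[(F n).+1%:R]natr1 in h2.
  have -> : beta - (F n)%:R / 2 ^+ n = (2 ^+ n * beta - (F n)%:R) / 2 ^+ n.
    by rewrite mulrBl mulrAC divff ?mul1r // gt_eqF.
  rewrite normrM normfV [`|2 ^+ n|]ger0_norm ?ltW // ger0_norm; last by lra.
  by rewrite ltr_pdivrMr // mulVf ?gt_eqF //; lra.
move=> N; apply: contrapT => no.
have ones k : (N <= k)%N -> b k = true.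
  by move=> Nk; case e : (b k) => //; case: no; exists k.
have FN j : ((F (N + j)).+1 = (F N).+1 * 2 ^ j)%N.
  elim: j => [|j IH]; first by rewrite addn0 expn0 muln1.
  by rewrite addnS FS ones ?leq_addr // expnS; move: IH; lia.
have /andP[_ h2] := Fb N.
pose gap := (F N).+1%:R / 2 ^+ N - beta.
have g0 : 0 < gap by rewrite subr_gt0 ltr_pdivlMr // mulrC.
have [m hm] := exp2_small g0.
have := hm (N + m)%N (leq_addl _ _); apply/negP; rewrite -leNgt /gap.
have /andP[h3 _] := Fb (N + m)%N.
rewrite lerBlDr -lerBlDl.
have -> : (F N).+1%:R / 2 ^+ N = (F (N + m)).+1%:R / 2 ^+ (N + m) :> R.
  by rewrite FN natrM natrX exprD -mulf_div divff ?mulr1 // gt_eqF.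
rewrite -natr1 mulrDl mul1r addrK ler_pdivrMr // mulrC.
by move: h3; set y := 2 ^+ _ * _.
Qed.

(** Expansions with infinitely many zeros exist and are unique; this form of the fact
    speaks of one numeral only. *)
Lemma PfP (alpha : R) x :
  let beta := alpha - (Num.floor alpha)%:~R in
  Pf alpha x <-> (num x)%:R <= 2 ^+ size x * beta < (num x).+1%:R.
Proof.
move=> beta; have p0 m : 0 < 2 ^+ m :> R by rewrite exprn_gt0.
have tr n b : base_two_expansion alpha b ->
    (num (mkseq b n))%:R <= 2 ^+ n * beta < (num (mkseq b n)).+1%:R.
  move=> hb; have := base_two_expansion_num n hb.
  by rewrite -/beta ler_pdivrMr // ltr_pdivlMr // mulrC.
split=> [[b [n [hb ->]]]|/andP[h1 h2]]; first by rewrite size_mkseq; apply: tr.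
have [b hb] := base_two_expansion_ex alpha; exists b, (size x); split=> //.
apply: num_inj; first by rewrite size_mkseq.
have /andP[h3 h4] := tr (size x) b hb.
have := le_lt_trans h1 h4; have := le_lt_trans h3 h2; rewrite !ltr_nat; lia.
Qed.

End BinaryExpansion.

(** * Computing the weights *)

Lemma count_initial (P : pred nat) N : (forall a, P a.+1 -> P a) ->
  let m := (\sum_(0 <= a < N) P a)%N in
  [/\ (m <= N)%N, forall a, (a < m)%N -> P a & (m < N)%N -> ~~ P m].
Proof.
move=> hP; elim: N => [|N [le lo hi]]; first by rewrite big_geq.
have down b : P b -> forall a, (a <= b)%N -> P a.
  elim: b => [|b IH] Pb a; first by rewrite leqn0 => /eqP->.
  by rewrite leq_eqVlt => /orP[/eqP->//|]; apply: IH (hP _ Pb) a.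
rewrite big_nat_recr //=; set m := (\sum_(0 <= a < N) P a)%N in le lo hi *.
case: (boolP (P N)) => PN.
  have mN : m = N.
    by apply/eqP; rewrite eqn_leq le leqNgt; apply/negP => /hi /negP; apply; apply: down PN _ _.
  rewrite mN addn1 ltnn; split=> // a; rewrite ltnS; exact: down.
rewrite addn0 ltnS; split=> //; first exact: leqW.
rewrite leq_eqVlt => /orP[/eqP->//|]; exact: hi.
Qed.

Section Weights.
Variables (R : realType) (T : R).
Hypotheses (hT : computable_real T) (T0 : 0 < T) (T1 : T < 1).

(** Subtracting the error bound from an approximation of [T] gives a positive fraction
    below [T], from some precision on. *)
Lemma lower_approx : exists U W : nat -> nat, [/\ comp1 U, comp1 W &
  exists i0, forall i, (i0 <= i)%N -> [/\ (0 < U i)%N, (0 < W i)%N &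
    (U i)%:R / (W i)%:R < T < (U i)%:R / (W i)%:R + 2 * 2 ^- i]].
Proof.
have [a [[s [u [v [/total_recursive_comp hs /total_recursive_comp hu
  /total_recursive_comp hv av]]]] aT]] := hT.
exists (fun i => u i * 2 ^ i - v i)%N, (fun i => v i * 2 ^ i)%N; split; try by comp_tac.
have [|i0 hi0] := @exp2_small R (T / 2); first by rewrite divr_gt0.
exists i0 => i /hi0 hi; have [v0 ai] := av i.
have vp : (0 < v i)%N by rewrite lt0n; apply/eqP.
have vR : 0 < (v i)%:R :> R by rewrite ltr0n.
have p0 : 0 < 2 ^+ i :> R by rewrite exprn_gt0.
pose r : R := (u i)%:R / (v i)%:R.
have ar : ratr (a i) = (-1) ^+ s i * r.
  by rewrite ai !rmorphM /= fmorphV rmorphXn /= rmorphN1 !ratr_nat -mulrA.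
have := aT i; rewrite ar ltr_distl => /andP[l1 l2].
have r0 : 0 <= r by rewrite divr_ge0.
move: l1 l2; rewrite -signr_odd; case: (odd _); rewrite ?expr0 ?expr1 ?mul1r => l1 l2.
  by exfalso; lra.
have e : (u i * 2 ^ i)%:R / (v i * 2 ^ i)%:R = r :> R.
  by rewrite !natrM natrX -mulf_div divff ?mulr1 // gt_eqF.
have uv : (v i < u i * 2 ^ i)%N.
  have h : 2 ^- i < r by lra.
  by rewrite ltr_pdivlMr // mulrC ltr_pdivrMr // in h; rewrite -(ltr_nat R) natrM natrX.
have e2 : (u i * 2 ^ i - v i)%:R / (v i * 2 ^ i)%:R = r - 2 ^- i :> R.
  rewrite (natrB R (ltnW uv)) mulrBl e.
  by rewrite [X in r - _ / X]natrM natrX invfM mulrA divff ?mul1r // gt_eqF.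
rewrite e2 subn_gt0 muln_gt0 vp expn_gt0; split=> //.
by apply/andP; split; lra.
Qed.

Lemma one_sub_exp2 (y : R) : 0 <= y -> 1 - y <= 2 `^ (- y).
Proof.
move=> y0; have l2 : ln 2 <= 1 :> R by have := @le_ln1Dx R 1; rewrite -natr1; apply; lra.
have l0 : 0 <= ln 2 :> R by apply: ln_ge0; lra.
rewrite /powR ifF ?pnatr_eq0 //; apply: le_trans (expR_ge1Dx _).
by rewrite mulNr lerD2l lerN2 ler_piMr.
Qed.

(** Raising to the power [U] turns the comparison of a dyadic number with a real power of
    two into one of naturals. *)
Lemma dyadic_below_pow (U W k j a : nat) : (0 < U)%N ->
  (a ^ U * 2 ^ (k * W) <= 2 ^ (j * U))%N =
  (a%:R / 2 ^+ j <= 2 `^ (- (k%:R * W%:R / U%:R)) :> R).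
Proof.
move=> U0; have p0 m : 0 < 2 ^+ m :> R by rewrite exprn_gt0.
rewrite -(@ler_pXn2r _ U) ?nnegrE ?powR_ge0 ?divr_ge0 //.
rewrite -[X in _ <= X]powR_mulrn ?powR_ge0 // -powRrM mulNr divfK ?pnatr_eq0 ?gtn_eqF //.
rewrite -natrM powR_invn // expr_div_n ler_pdivrMr ?exprn_gt0 // mulrC ler_pdivlMr //.
by rewrite -exprM -!natrX -natrM ler_nat.
Qed.

(** Two errors of at most [2 ^ - j] each are made: one by rounding to a multiple of
    [2 ^ - j], the other by replacing [T] by a fraction [t] below it.  The derivative of
    the weight in [1 / T] is at most one in absolute value, and
    [1 / t - 1 / T <= (4 / T ^ 2) * 2 ^ - i] at precision [i], so that the precision
    [j + c] suffices for a constant [c]. *)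
Lemma weight_approx : exists2 q : nat -> nat -> nat, comp2 q &
  forall k j, (q k j)%:R <= 2 ^+ j * bweight T k <= (q k j)%:R + 2.
Proof.
have [U [W [hU hW [i0 hi0]]]] := lower_approx.
have [|c0 hc0] := @exp2_small R (T ^+ 2 / 4); first by rewrite divr_gt0 // exprn_gt0.
pose c := maxn c0 i0.
have hc : 2 ^- c < T ^+ 2 / 4 by apply: hc0; apply: leq_maxl.
pose q k j := (\sum_(0 <= a < 2 ^ j)
  (a.+1 ^ U (j + c) * 2 ^ (k * W (j + c)) <= 2 ^ (j * U (j + c))))%N.
exists q; first by rewrite /q; comp_tac.
move=> k j; have [|U0 W0 /andP[lT uT]] := hi0 (j + c)%N.
  by rewrite (leq_trans (leq_maxr c0 i0)) // leq_addl.
have p0 m : 0 < 2 ^+ m :> R by rewrite exprn_gt0.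
set u := U _ in U0 lT uT *; set w := W _ in W0 lT uT *.
set t := u%:R / w%:R in lT uT.
pose z : R := 2 `^ (- (k%:R * w%:R / u%:R)).
have t0 : 0 < t by rewrite divr_gt0 ?ltr0n.
have zE : z = 2 `^ (- (k%:R / t)) by rewrite /z /t invf_div mulrA.
have zx : z <= bweight T k.
  by rewrite zE ler_powR ?ler1n // lerN2 ler_wpM2l // lef_pV2 ?posrE // ltW.
have x1 : bweight T k <= 1.
  by apply: le_trans (bweight_le T0 T1 k) _; rewrite invf_le1 // exprn_ege1 // ler1n.
have xz : bweight T k - z <= 2 ^- j.
  have -> : z = bweight T k * 2 `^ (- (k%:R * (t^-1 - T^-1))).
    rewrite zE -powRD ?pnatr_eq0 ?implybT //; congr (_ `^ _); ring.
  have d0 : 0 <= t^-1 - T^-1 by rewrite subr_ge0 lef_pV2 ?posrE // ltW.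
  have dle : t^-1 - T^-1 <= 2 ^- j.
    have E0 : 0 < 2 ^- j :> R by rewrite invr_gt0.
    have E1 : 2 ^- j <= 1 :> R by rewrite invf_le1 // exprn_ege1 // ler1n.
    have C0 : 0 < 2 ^- c :> R by rewrite invr_gt0.
    have EC : 2 ^- (j + c) = 2 ^- j * 2 ^- c :> R by rewrite exprD invfM.
    move: uT hc E0 E1 C0; rewrite EC; set E := 2 ^- j; set C := 2 ^- c.
    move=> uT hc' E0 E1 C0; have EC1 : E * C <= C by rewrite ler_piMl // ltW.
    have TT : T ^+ 2 <= T by rewrite expr2 ler_piMl // ltW.
    have tT : T / 2 <= t by lra.
    have -> : t^-1 - T^-1 = (T - t) / (t * T) by field; rewrite !gt_eqF ?invr_gt0 ?ltr0n.
    rewrite ler_pdivrMr ?(mulr_gt0 t0 T0) //.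
    have h1 : E * C <= E * (T ^+ 2 / 4) by rewrite ler_wpM2l // ltW.
    have h2' : T ^+ 2 / 2 <= t * T by have := ler_wpM2r (ltW T0) tT; rewrite expr2; lra.
    have h2 : E * (T ^+ 2 / 2) <= E * (t * T) by apply: ler_wpM2l h2'; apply: ltW.
    by lra.
  have kx : k%:R * bweight T k <= 1.
    apply: le_trans (_ : k%:R * 2 ^- k <= 1); first by rewrite ler_wpM2l // bweight_le.
    by rewrite ler_pdivrMr // mul1r -natrX ler_nat ltnW // ltn_expl.
  have := @one_sub_exp2 (k%:R * (t^-1 - T^-1)) (mulr_ge0 (ler0n _ _) d0).
  set y := 2 `^ _ => hy.
  apply: le_trans (_ : (k%:R * bweight T k) * (t^-1 - T^-1) <= _).
    have b0 := bweight_ge0 T k.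
    have : bweight T k * (1 - y) <= bweight T k * (k%:R * (t^-1 - T^-1)).
      by rewrite ler_wpM2l //; lra.
    by lra.
  apply: le_trans (_ : 1 * (t^-1 - T^-1) <= _); last by rewrite mul1r.
  by rewrite ler_wpM2r.
have dec i : (i.+2 ^ u * 2 ^ (k * w) <= 2 ^ (j * u) ->
    i.+1 ^ u * 2 ^ (k * w) <= 2 ^ (j * u))%N.
  by apply: leq_trans; rewrite leq_mul2r leq_exp2r // leqnSn orbT.
have [le lo hi] := @count_initial
  (fun a => a.+1 ^ u * 2 ^ (k * w) <= 2 ^ (j * u))%N (2 ^ j) dec.
rewrite -/(q k j) in le lo hi.
have qz : (q k j)%:R <= 2 ^+ j * z.
  case eq : (q k j) => [|m]; first by rewrite mulr_ge0 ?powR_ge0 ?ltW.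
  have := lo m; rewrite eq ltnS leqnn => /(_ isT).
  by rewrite dyadic_below_pow // ler_pdivrMr // mulrC.
apply/andP; split; first by apply: le_trans qz _; rewrite ler_pM2l.
move: le; rewrite leq_eqVlt => /orP[/eqP e|lt].
  rewrite e natrX; have : 2 ^+ j * bweight T k <= 2 ^+ j * 1 by rewrite ler_pM2l.
  by rewrite mulr1; lra.
have := hi lt; rewrite dyadic_below_pow // -ltNge ltr_pdivlMr // mulrC -/z => h.
have : 2 ^+ j * (bweight T k - z) <= 1.
  by rewrite -ler_pdivlMl ?mulr1.
by rewrite mulrBr; rewrite -natr1 in h; lra.
Qed.

End Weights.

(** * Counting events *)

(** Codes of pairs are injective and exceed both components. *)
Lemma sum_pairs (R : numDomainType) (phi : nat -> nat -> R) N :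
  (forall n s, 0 <= phi n s) ->
  \sum_(0 <= i < N) (pairn (fstn i) (sndn i) == i)%:R * phi (fstn i) (sndn i) <=
  \sum_(0 <= n < N) \sum_(0 <= s < N) phi n s.
Proof.
move=> phi0.
apply: (@le_trans _ _ (\sum_(0 <= i < N) \sum_(0 <= n < N) \sum_(0 <= s < N)
    (pairn n s == i)%:R * phi n s)).
  rewrite big_nat [leRHS]big_nat ler_sum // => i /andP[_ iN].
  case: eqP => [e|_]; last first.
    by rewrite mul0r; do 2! apply: sumr_ge0 => ? _; rewrite mulr_ge0.
  have fN : (fstn i < N)%N by rewrite (leq_trans _ iN) // -[in ltnRHS]e ltnW // ltnS pairn_gt1.
  have sN : (sndn i < N)%N by rewrite (leq_trans _ iN) // -[in ltnRHS]e ltnW // ltnS pairn_gt2.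
  rewrite (bigD1_seq (fstn i)) ?mem_index_iota ?iota_uniq //=.
  rewrite (bigD1_seq (sndn i)) ?mem_index_iota ?iota_uniq //= e eqxx -addrA lerDl.
  rewrite addr_ge0 // ?sumr_ge0 // => j _; first by rewrite mulr_ge0.
  by rewrite sumr_ge0 // => k _; rewrite mulr_ge0.
rewrite exchange_big /= ler_sum // => n _; rewrite exchange_big /= ler_sum // => s _.
rewrite -big_distrl /= -[leRHS]mul1r ler_wpM2r //.
case: (ltnP (pairn n s) N) => h; last first.
  rewrite big_nat big1 // => i /andP[_ iN]; case: eqP => // e.
  by move: iN; rewrite -e ltnNge h.
rewrite (bigD1_seq (pairn n s)) ?mem_index_iota ?iota_uniq //= eqxx big1 ?addr0 // => i.
by rewrite eq_sym => /negbTE->.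
Qed.

Lemma changes_le (c : nat -> nat) N : {homo c : i j / (i <= j)%N} ->
  (\sum_(0 <= s < N) ((s == 0) || (c s != c s.-1)) <= 1 + c N)%N.
Proof.
move=> mono; case: N => [|N]; first by rewrite big_geq.
suff : (\sum_(0 <= s < N.+1) ((s == 0) || (c s != c s.-1)) <= 1 + c N)%N.
  by move=> h; apply: leq_trans h _; rewrite leq_add2l mono.
elim: N => [|N IH]; first by rewrite big_nat1.
rewrite big_nat_recr //=; have := mono N N.+1 (leqnSn _).
by case: eqP => /= [->|ne]; lia.
Qed.

(** The last event identifies the final state of a bounded enumeration; a machine that
    serves all events also serves this one, without being able to recognize it. *)
Lemma last_event (c : nat -> nat) n B : {homo c : i j / (i <= j)%N} -> (forall s, c s <= B)%N ->
  exists s, [/\ (n <= s)%N, (s == n) || (n < s)%N && (c s != c s.-1) &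
    forall t, (s <= t)%N -> c t = c s].
Proof.
move=> mono cB.
have [t tmax] : exists t, forall t', (c t' <= c t)%N.
  apply: contrapT => no.
  have up k : exists t, (k <= c t)%N.
    elim: k => [|k [t kt]]; first by exists 0%N.
    apply: contrapT => no'; apply: no; exists t => t'.
    by rewrite leqNgt; apply/negP => lt; apply: no'; exists t'; apply: leq_ltn_trans kt lt.
  by have [t] := up B.+1; rewrite ltnNge cB.
have ex : exists s, (n <= s)%N && (c s == c t).
  exists (maxn n t); rewrite leq_maxl eqn_leq tmax mono //.
  exact: leq_maxr.
case: (ex_minnP ex) => s /andP[ns /eqP cs] smin; exists s; split=> //.
  case: eqP => //= /eqP ne; have nlt : (n < s)%N by rewrite ltn_neqAle eq_sym ne.
  rewrite nlt /=; apply/negP => /eqP e.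
  have := smin s.-1; rewrite -e cs eqxx andbT -ltnS prednK; last by apply: leq_ltn_trans nlt.
  by move=> /(_ nlt); case: (s) nlt => // s'; rewrite ltnn.
move=> t' st; apply/eqP; rewrite eqn_leq cs tmax -cs; exact: mono.
Qed.

Lemma leq_sum_eq (a b : nat -> nat) N : (forall i, b i <= a i)%N ->
  (\sum_(0 <= i < N) a i <= \sum_(0 <= i < N) b i)%N ->
  forall i, (i < N)%N -> a i = b i.
Proof.
move=> ba; elim: N => [|N IH] //; rewrite !big_nat_recr //= => le i.
have le' : (\sum_(0 <= i < N) b i <= \sum_(0 <= i < N) a i)%N by apply: leq_sum.
have bN := ba N; rewrite ltnS leq_eqVlt => /orP[/eqP->|]; first by lia.
by apply: IH; lia.
Qed.

Lemma odd_mask (b : nat -> bool) B w :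
  odd ((\sum_(0 <= i < B) b i * 2 ^ i) %/ 2 ^ w) = (w < B)%N && b w.
Proof.
elim: w B b => [|w IH] B b.
  rewrite expn0 divn1; case: B => [|B]; first by rewrite big_geq.
  rewrite big_nat_recl // expn0 muln1 oddD.
  rewrite (eq_bigr (fun i => 2 * (b i.+1 * 2 ^ i))%N) => [|i _]; last by rewrite expnS mulnCA.
  by rewrite -big_distrr /= oddM /= addbF; case: (b 0%N).
case: B => [|B]; first by rewrite big_geq // div0n.
rewrite big_nat_recl // expn0 muln1.
rewrite (eq_bigr (fun i => (b i.+1 * 2 ^ i) * 2)%N) => [|i _]; last by rewrite expnSr mulnA.
have b2 : (b 0%N %/ 2 = 0)%N by case: (b 0%N).
rewrite -big_distrl /= expnS divnMA addnC divnMDl // b2 addn0.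
by rewrite (IH B (fun i => b i.+1)) ltnS.
Qed.

(** * Rational approximations from below *)

Section Approximation.
Variables (R : realType) (T : R) (V : bstr -> option bstr).
Hypotheses (T0 : 0 < T) (T1 : T < 1) (pfV : prefix_free (dom V)).
Variables (h : nat -> nat -> bool) (o : nat -> nat -> nat) (q : nat -> nat -> nat).
Hypotheses (hV : enumerates V h o) (hq : comp2 q).
Hypothesis qT : forall k j, (q k j)%:R <= 2 ^+ j * bweight T k <= (q k j)%:R + 2.

Definition znum (s : nat) : nat := \sum_(0 <= p < s) h p s * q (slen p) s.*2.

Definition zapprox (s : nat) : R := (znum s)%:R / 2 ^+ s.*2.

Lemma comp1_znum : comp1 znum.
Proof.
have hh := enum_comph hV; rewrite /znum.
apply: (@comp_ext (fun e => \sum_(0 <= p < e 0) h p (e 0) * q (slen p) (e 0 + e 0)))%N.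
  by move=> e; rewrite -addnn.
by comp_tac.
Qed.

(** Each of the at most [s] programs found by stage [s] contributes an error of at most
    [2 / 4 ^ s]. *)
Lemma zapproxP s : Zpart T h s - 2 ^- s <= zapprox s <= Zpart T h s.
Proof.
have p0 m : 0 < 2 ^+ m :> R by rewrite exprn_gt0.
have zE : zapprox s = \sum_(0 <= p < s) (h p s)%:R * ((q (slen p) s.*2)%:R / 2 ^+ s.*2).
  rewrite /zapprox /znum natr_sum big_distrl /=; apply: eq_bigr => p _.
  by rewrite natrM mulrA.
have lo p : (q p s.*2)%:R / 2 ^+ s.*2 <= bweight T p.
  by have /andP[h1 _] := qT p s.*2; rewrite ler_pdivrMr // mulrC.
have hi p : bweight T p <= (q p s.*2)%:R / 2 ^+ s.*2 + 2 / 2 ^+ s.*2.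
  by have /andP[_ h2] := qT p s.*2; rewrite -mulrDl ler_pdivlMr // mulrC.
apply/andP; split; last by rewrite zE ler_sum // => p _; rewrite ler_wpM2l.
rewrite lerBlDr; apply: le_trans (_ : zapprox s + \sum_(0 <= p < s) 2 / 2 ^+ s.*2 <= _).
  rewrite zE -big_split /=; apply: ler_sum => p _.
  by case: (h p s); rewrite ?mul1r ?mul0r ?add0r //; apply: divr_ge0.
rewrite lerD2l sumr_const_nat subn0 -[_ *+ s]mulr_natr -addnn exprD invfM.
have le : (s.*2 <= 2 ^ s)%N.
  case: s {zE lo hi} => // s; rewrite -mul2n expnS leq_mul2l /=.
  by rewrite ltn_expl.
rewrite mulrA mulrAC -[leRHS]mul1r ler_wpM2r ?invr_ge0 ?(ltW (p0 s)) //.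
rewrite mulrAC -natrM mul2n ler_pdivrMr // mul1r -natrX ler_nat //.
Qed.

End Approximation.

(** * Counting the changes of the first bits *)

Lemma exp_powR (R : realType) (a : R) n : (2 `^ a) ^+ n = (2 ^+ n) `^ a.
Proof. by rewrite -powR_mulrn ?powR_ge0 // powRAC powR_mulrn. Qed.

Lemma exp2_gt1 (R : realType) (a : R) : 0 < a -> 1 < 2 `^ a.
Proof.
move=> a0; have := @gt0_ltr_powR R a a0 1 2.
by rewrite !nnegrE powR1 => /(_ ler01 (ler0n _ _)); apply; rewrite ltr1n.
Qed.

Lemma powR_inv (R : realType) (w a : R) : 0 < w -> (w^-1) `^ a = (w `^ a)^-1.
Proof. by move=> w0; rewrite -powR_inv1 ?ltW // -powRrM mulN1r powRN. Qed.

(** The sum is split at the least [n] with [1 <= 2 ^ n * w].  Below, its terms are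
    [w * (2 ^ (1 - T)) ^ n], from there on they are [(2 ^ - T) ^ n]; each part is bounded
    by a multiple of its term at the splitting point, where [2 ^ n] is about [w ^-1]. *)
Lemma geometric_min (R : realType) (T : R) : 0 < T -> T < 1 ->
  exists C : R, forall w N, 0 < w -> w <= 1 ->
    \sum_(0 <= n < N) (2 `^ (- T)) ^+ n * Num.min 1 (2 ^+ n * w) <= C * w `^ T.
Proof.
move=> T0 T1; pose rho : R := 2 `^ (- T); pose sigma : R := 2 `^ (1 - T).
have p0 m : 0 < 2 ^+ m :> R by rewrite exprn_gt0.
have lt12 : 1 < 2 :> R by rewrite ltr1n.
have rho0 : 0 < rho by rewrite powR_gt0.
have sigma0 : 0 < sigma by rewrite powR_gt0.
have rhoE : 2 * rho = sigma.
  by rewrite /sigma powRD ?pnatr_eq0 ?implybT // powRr1.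
have rho1 : rho < 1 by rewrite /rho powRN invf_lt1 ?powR_gt0 // exp2_gt1.
have sigma1 : 1 < sigma by rewrite exp2_gt1 // subr_gt0.
have wT0 (w : R) : 0 <= w `^ T by apply: powR_ge0.
exists (sigma / (sigma - 1) + 1 / (1 - rho)) => w N w0 w1.
have ex : exists n, 1 <= 2 ^+ n * w.
  have [n /(_ n (leqnn n)) h] := exp2_small w0; exists n.
  by rewrite mulrC -ler_pdivrMr // mul1r ltW.
case: (ex_minnP ex) => m hm mmin.
have term n : (2 `^ (- T)) ^+ n * Num.min 1 (2 ^+ n * w) <=
    (n < m)%:R * sigma ^+ n * w + (m <= n)%:R * rho ^+ n.
  case: (ltnP n m) => nm; rewrite ?mul1r ?mul0r ?addr0 ?add0r.
    rewrite -rhoE mulrC exprMn -mulrA mulrCA -/rho.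
    rewrite [leLHS]mulrC ler_wpM2l ?exprn_ge0 ?(ltW rho0) //.
    by rewrite ge_min lexx orbT.
  by rewrite ler_piMr ?ge_min ?lexx // exprn_ge0 // ltW.
apply: le_trans (ler_sum _ (fun n _ => term n)) _.
rewrite big_split /= mulrDl lerD //.
  rewrite -big_distrl /=.
  have A M : (\sum_(0 <= n < M) (n < m)%:R * sigma ^+ n) * (sigma - 1) <= sigma ^+ minn M m.
    elim: M => [|M IH]; first by rewrite big_geq // mul0r exprn_ge0 // ltW.
    rewrite big_nat_recr //= mulrDl; case: (ltnP M m) => Mm.
      rewrite (minn_idPl _) // mul1r exprS.
      by rewrite (minn_idPl (ltnW Mm)) in IH; lra.
    by rewrite !mul0r addr0 (minn_idPr (leqW Mm)) -[X in sigma ^+ X](minn_idPr Mm).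
  have s1 : 0 < sigma - 1 by rewrite subr_gt0.
  case: m {hm} mmin {term} A => [_ _|m mmin A].
    rewrite big1 ?mul0r; last by move=> i _; rewrite mul0r.
    by rewrite mulr_ge0 // divr_ge0 // ltW.
  have mw : 2 ^+ m * w < 1 by rewrite ltNge; apply/negP => /mmin; rewrite ltnn.
  have hs : sigma ^+ m * w <= w `^ T.
    have -> : w `^ T = w^-1 `^ (1 - T) * w.
      rewrite powR_inv // -powRN opprB -[X in _ * X](@powRr1 _ w) ?ltW //.
      by rewrite -powRD ?subrK // gt_eqF ?implybT.
    rewrite ler_wpM2r ?(ltW w0) // /sigma exp_powR ge0_ler_powR ?nnegrE ?invr_ge0 //.
    - by rewrite subr_ge0 ltW.
    - by rewrite ltW.
    - by rewrite -[leRHS]mul1r ler_pdivlMr // ltW.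
  have hA : \sum_(0 <= n < N) (n < m.+1)%:R * sigma ^+ n <= sigma * sigma ^+ m / (sigma - 1).
    rewrite ler_pdivlMr // -exprS; apply: le_trans (A N) _.
    by rewrite ler_weXn2l ?geq_minr // ltW.
  apply: le_trans (_ : sigma * sigma ^+ m / (sigma - 1) * w <= _).
    by rewrite ler_wpM2r // ltW.
  rewrite [leLHS](_ : _ = sigma / (sigma - 1) * (sigma ^+ m * w)); last by ring.
  by rewrite ler_wpM2l // divr_ge0 // ltW.
have B M : (\sum_(0 <= n < M) (m <= n)%:R * rho ^+ n) * (1 - rho) <= rho ^+ m - rho ^+ maxn M m.
  elim: M => [|M IH]; first by rewrite big_geq // mul0r max0n subrr.
  rewrite big_nat_recr //= mulrDl; case: (leqP m M) => Mm.
    rewrite (maxn_idPl (leqW Mm)) mul1r exprS.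
    by rewrite (maxn_idPl Mm) in IH; lra.
  by rewrite !mul0r addr0 (maxn_idPr Mm) -[X in _ - rho ^+ X](maxn_idPr (ltnW Mm)).
have r1 : 0 < 1 - rho by rewrite subr_gt0.
have hr : rho ^+ m <= w `^ T.
  rewrite /rho exp_powR powRN -[leRHS]invrK lef_pV2 ?posrE ?invr_gt0 ?powR_gt0 //.
  rewrite -powR_inv // ge0_ler_powR ?nnegrE ?invr_ge0 ?(ltW w0) ?(ltW T0) //.
  by rewrite -[leLHS]mul1r ler_pdivrMr.
apply: le_trans (_ : rho ^+ m / (1 - rho) <= _).
  rewrite ler_pdivlMr //; apply: le_trans (B N) _.
  by rewrite gerBl exprn_ge0 // ltW.
by rewrite mul1r mulrC ler_wpM2l // invr_ge0 ltW.
Qed.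

Section FirstBits.
Variables (R : realType) (T : R) (V : bstr -> option bstr).
Hypotheses (T0 : 0 < T) (T1 : T < 1) (pfV : prefix_free (dom V)).
Variables (h : nat -> nat -> bool) (o : nat -> nat -> nat) (q : nat -> nat -> nat).
Hypotheses (hV : enumerates V h o) (hq : comp2 q).
Hypothesis qT : forall k j, (q k j)%:R <= 2 ^+ j * bweight T k <= (q k j)%:R + 2.

Let p0 m : 0 < 2 ^+ m :> R. Proof. by rewrite exprn_gt0. Qed.
Let ZP := Zpart T h.

(** The integer part and the first [n] bits of the approximations; the maximum over the
    earlier stages makes them monotone. *)
Definition zbits (n s : nat) : nat :=
  \max_(0 <= t < s.+1) (2 ^ n * znum h q t) %/ 2 ^ t.*2.

Lemma comp2_zbits : comp2 zbits.
Proof.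
have hz := comp1_znum hV hq; rewrite /zbits.
apply: (@comp_ext (fun e => \max_(0 <= t < (e 1%N).+1)
   (2 ^ e 0%N * znum h q t) %/ 2 ^ (t + t)))%N.
  by move=> e; apply: eq_bigr => t _; rewrite addnn.
by comp_tac.
Qed.

Lemma zbits_ge_term n s t : (t <= s)%N -> ((2 ^ n * znum h q t) %/ 2 ^ t.*2 <= zbits n s)%N.
Proof.
move=> ts; rewrite /zbits (bigD1_seq t) ?mem_index_iota ?iota_uniq //=.
exact: leq_maxl.
Qed.

Lemma zbits_mono n : {homo zbits n : s t / (s <= t)%N}.
Proof.
move=> s t st; rewrite [leqRHS]/zbits (@big_cat_nat _ _ _ s.+1) //=.
exact: leq_maxl.
Qed.

Lemma floor_zapprox n t :
  ((2 ^ n * znum h q t) %/ 2 ^ t.*2)%:R <= 2 ^+ n * zapprox R h q t <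
  ((2 ^ n * znum h q t) %/ 2 ^ t.*2)%:R + 1.
Proof.
have e : 2 ^+ n * zapprox R h q t = (2 ^ n * znum h q t)%:R / 2 ^+ t.*2.
  by rewrite /zapprox natrM natrX mulrA.
rewrite e natr1 ler_pdivlMr // ltr_pdivrMr // -!natrX -!natrM ler_nat ltr_nat.
by rewrite leq_divM /= -ltn_divLR ?expn_gt0 // ltnSn.
Qed.

Lemma zbits_le n s : (zbits n s)%:R <= 2 ^+ n * ZP s.
Proof.
suff h1 t : (t <= s)%N -> ((2 ^ n * znum h q t) %/ 2 ^ t.*2)%:R <= 2 ^+ n * ZP s.
  rewrite /zbits big_nat; elim/big_ind: _ => [|a b ha hb|t /andP[_ ts]].
  - by rewrite mulr_ge0 ?(ltW (p0 n)) // sumr_ge0 // => i _; rewrite mulr_ge0 ?bweight_ge0.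
  - by rewrite /maxn; case: ifP.
  - exact: h1.
move=> ts; have /andP[h1 _] := floor_zapprox n t; apply: le_trans h1 _.
rewrite ler_pM2l //; have /andP[_ h2] := zapproxP h qT t.
exact: le_trans h2 (Zpart_mono T hV ts).
Qed.

(** One unit is lost by taking the integer part, and at most one by the error [2 ^ - s] of
    the approximation, which is small enough from stage [n] on. *)
Lemma zbits_gt n s : (n <= s)%N -> 2 ^+ n * ZP s < (zbits n s)%:R + 2.
Proof.
move=> ns; have /andP[_ h1] := floor_zapprox n s.
have /andP[h2 _] := zapproxP h qT s.
have : ((2 ^ n * znum h q s) %/ 2 ^ s.*2)%:R <= (zbits n s)%:R :> R.
  by rewrite ler_nat zbits_ge_term.
have : 2 ^+ n * 2 ^- s <= 1 :> R.
  by rewrite ler_pdivrMr // mul1r ler_eXn2l // ltr1n.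
have : 2 ^+ n * (ZP s - 2 ^- s) <= 2 ^+ n * zapprox R h q s by rewrite ler_pM2l.
by rewrite mulrBr; lra.
Qed.

(** The limit is reached unless it lies on the grid, where it is approached from below. *)
Lemma zbits_lim n : (forall m : nat, 2 ^+ n * Z V T != m%:R) ->
  exists s0, forall s, (s0 <= s)%N -> zbits n s = Num.truncn (2 ^+ n * Z V T).
Proof.
move=> nd; set M := Num.truncn _.
have Z0 : 0 <= Z V T.
  by apply: le_trans (Zpart_le T0 T1 pfV hV 0); rewrite /Zpart big_geq.
have /andP[ML MU] : M%:R <= 2 ^+ n * Z V T < M.+1%:R.
  by apply: truncn_itv; rewrite mulr_ge0 // ltW.
have lt : M%:R / 2 ^+ n < Z V T.
  by rewrite ltr_pdivrMr // mulrC lt_neqAle ML andbT eq_sym.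
pose gap := (Z V T - M%:R / 2 ^+ n) / 2.
have g0 : 0 < gap by rewrite divr_gt0 // subr_gt0.
have [|s1 hs1] := @Zpart_lt R T V T0 T1 pfV h o hV (Z V T - gap).
  by rewrite ltrBlDr ltrDl.
have [s2 hs2] := exp2_small g0.
exists (maxn s1 s2) => s; rewrite geq_max => /andP[s1s s2s]; apply/eqP; rewrite eqn_leq.
apply/andP; split.
  rewrite -ltnS -(ltr_nat R); apply: le_lt_trans (zbits_le n s) _.
  by apply: le_lt_trans _ MU; rewrite ler_pM2l // (Zpart_le T0 T1 pfV hV).
apply: leq_trans (zbits_ge_term n (leqnn s)).
rewrite -ltnS -(ltr_nat R) -natr1.
have /andP[_ h1] := floor_zapprox n s; rewrite natr1 in h1 *; apply: le_lt_trans h1.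
rewrite mulrC -ler_pdivrMr //.
have /andP[h2 _] := zapproxP h qT s; apply: le_trans h2.
have := hs1 s s1s; have := hs2 s s2s; rewrite /gap -/ZP => h3 h4; lra.
Qed.

(** The charge of the programs found by stage [s] for the changes at level [n]: a step of
    the enumeration that adds [x] to [2 ^ n * Z] changes the first bits at most once, and
    on average at most about [x] times. *)
Definition charge (n s : nat) : R :=
  \sum_(0 <= p < s) (h p s)%:R * Num.min 1 (2 ^+ n * bweight T (slen p)).

Let E s p := (p < s)%N && h p s.

Lemma sum_found (F : nat -> R) s M : (s <= M)%N ->
  \sum_(0 <= p < s) (h p s)%:R * F p = \sum_(0 <= p < M) (E s p)%:R * F p.
Proof.
move=> sM; rewrite [RHS](@big_cat_nat _ _ _ s) //=.
have -> : \sum_(s <= p < M) (E s p)%:R * F p = 0.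
  by rewrite big_nat big1 // => p /andP[sp _]; rewrite /E ltnNge sp mul0r.
by rewrite addr0; apply: eq_big_nat => p /andP[_ ps]; rewrite /E ps.
Qed.

Lemma min1_sum (F : nat -> R) M : (forall p, 0 <= F p) ->
  Num.min 1 (\sum_(0 <= p < M) F p) <= \sum_(0 <= p < M) Num.min 1 (F p).
Proof.
move=> F0; elim: M => [|M IH]; first by rewrite !big_geq // ge_min lexx orbT.
rewrite !big_nat_recr //=; set x := \sum_(_ <= _ < _) _ in IH *.
have x0 : 0 <= x by apply: sumr_ge0.
apply: le_trans (lerD IH (lexx _)); have y0 := F0 M.
by rewrite /Num.min; case: ltP => ?; case: ltP => ?; case: ltP => ?; lra.
Qed.

Lemma charge_step n s :
  Num.min 1 (2 ^+ n * ZP s.+1 - 2 ^+ n * ZP s) <= charge n s.+1 - charge n s.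
Proof.
have sub p : E s p -> E s.+1 p.
  by move=> /andP[ps hps]; rewrite /E ltnS (ltnW ps) (enum_mono hV _ hps).
rewrite -mulrBr /ZP /Zpart /charge !(sum_found _ (leqnSn s)) !(sum_found _ (leqnn s.+1)).
rewrite -!sumrB mulr_sumr.
apply: le_trans (min1_sum _ _) _ => [p|].
  rewrite -mulrBl !mulr_ge0 ?bweight_ge0 ?(ltW (p0 n)) // subr_ge0 ler_nat.
  by case e : (E s p) => //; rewrite sub.
apply: ler_sum => p _; rewrite -!mulrBl.
case e : (E s p); first by rewrite sub // subrr !mul0r mulr0 ge_min lexx orbT.
by case: (E s.+1 p); rewrite subr0 ?mul1r // !mul0r mulr0 ge_min lexx orbT.
Qed.

Definition zevent (n s : nat) : bool :=
  (s == n) || (n < s)%N && (zbits n s != zbits n s.-1).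

(** The potential [2 ^ n * ZP s - zbits n s] lies between zero and two.  A step that adds
    less than one unit has to spend potential on a change; a larger step can raise the
    potential by less than two and causes at most one change, so that three times its
    charge is enough. *)
Lemma change_le n s : (n <= s)%N ->
  (zbits n s.+1 != zbits n s)%:R <=
  3 * (charge n s.+1 - charge n s) + (2 ^+ n * ZP s - (zbits n s)%:R)
    - (2 ^+ n * ZP s.+1 - (zbits n s.+1)%:R).
Proof.
move=> ns; have step := charge_step n s.
have l1 := zbits_le n s; have l2 := zbits_le n s.+1.
have u1 := zbits_gt ns; have u2 := zbits_gt (leqW ns).
have m1 : 2 ^+ n * ZP s <= 2 ^+ n * ZP s.+1.
  by rewrite ler_pM2l // (Zpart_mono T hV).
have : (zbits n s != zbits n s.+1)%:R <= (zbits n s.+1)%:R - (zbits n s)%:R :> R.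
  have := zbits_mono n (leqnSn s); rewrite leq_eqVlt => /orP[/eqP->|lt].
    by rewrite eqxx subrr.
  by rewrite ltn_eqF //= lerBrDr -natrD ler_nat add1n.
rewrite eq_sym; set a := 2 ^+ n * ZP s.+1 in l2 u2 m1 step *.
set b := 2 ^+ n * ZP s in l1 u1 m1 step *.
have : (zbits n s.+1 != zbits n s)%:R <= 1 :> R by case: eqP.
move: step; rewrite [zbits n s.+1 == _]eq_sym /Num.min.
set d := (_ != _)%:R; by case: ltP => ? ? ? ?; lra.
Qed.

Lemma zevents_le n N : (\sum_(0 <= s < N) zevent n s)%:R <= 3 + 3 * charge n N.
Proof.
have c0 s : 0 <= charge n s.
  by apply: sumr_ge0 => p _; rewrite mulr_ge0 // le_min ler01 mulr_ge0 ?bweight_ge0.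
have early : (\sum_(0 <= s < n) zevent n s = 0)%N.
  rewrite big_nat big1 // => s /andP[_ sn].
  by rewrite /zevent ltn_eqF //= ltnNge (ltnW sn).
case: (leqP N n) => Nn.
  suff -> : (\sum_(0 <= s < N) zevent n s = 0)%N.
    by rewrite addr_ge0 // mulr_ge0.
  apply/eqP; rewrite -leqn0 -[leqRHS]early [leqRHS](@big_cat_nat _ _ _ N) //=.
  exact: leq_addr.
pose Phi s := 2 ^+ n * ZP s - (zbits n s)%:R.
have main k : (\sum_(0 <= s < (n + k).+1) zevent n s)%:R <=
    1 + 3 * charge n (n + k) + Phi n - Phi (n + k)%N.
  elim: k => [|k IH].
    rewrite addn0 big_nat_recr //= early add0n /zevent eqxx /= addrK.
    by rewrite lerDl mulr_ge0.
  rewrite addnS big_nat_recr //= natrD.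
  have -> : (zevent n (n + k).+1 = (zbits n (n + k).+1 != zbits n (n + k)%N) :> bool).
    by rewrite /zevent gtn_eqF ?ltnS ?leq_addr.
  have := change_le (leq_addr k n).
  move: IH; rewrite /Phi; set x := _%:R; set y := (_ != _)%:R; lra.
have := main (N - n.+1)%N; rewrite -addSn subnKC // => le.
apply: le_trans le _.
have g := zbits_gt (leqnn n); have g' := zbits_le n (n + (N - n.+1)).
have : charge n (n + (N - n.+1)) <= charge n N.
  rewrite /charge (sum_found _ (_ : n + (N - n.+1) <= N)%N); last by lia.
  rewrite [leRHS](sum_found _ (leqnn N)); apply: ler_sum => p _.
  rewrite ler_wpM2r ?le_min ?ler01 ?mulr_ge0 ?bweight_ge0 // ler_nat /E.
  case: (boolP (_ && _)) => // /andP[p1 p2].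
  by rewrite (_ : p < N)%N ?(enum_mono hV _ p2) //; lia.
by rewrite /Phi; lra.
Qed.

End FirstBits.

(** * From the halting problem to the partition function *)

(** With [alpha] in place of its fractional part, the integer part only shifts the
    numeral. *)
Lemma Pf_nat (R : realType) (alpha : R) x : 0 <= alpha ->
  Pf alpha x <->
  (num x + 2 ^ size x * Num.truncn alpha)%N = Num.truncn (2 ^+ size x * alpha).
Proof.
move=> a0; have p0 : 0 < 2 ^+ size x :> R by rewrite exprn_gt0.
have fl : Num.floor alpha = (Num.truncn alpha)%:Z by rewrite truncn_floor a0 gez0_abs // floor_ge0.
rewrite PfP fl mulrBr; set m := Num.truncn alpha.
have e : 2 ^+ size x * (m%:Z)%:~R = (2 ^ size x * m)%:R :> R by rewrite natrM natrX.
rewrite e; have b0 : 0 <= 2 ^+ size x * alpha by rewrite mulr_ge0 // ltW.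
have /andP[t1 t2] := truncn_itv b0; split=> [/andP[h1 h2]|h].
  have k1 : (num x + 2 ^ size x * m)%:R <= 2 ^+ size x * alpha by rewrite natrD; lra.
  have k2 : 2 ^+ size x * alpha < (num x + 2 ^ size x * m).+1%:R.
    by rewrite -addSn natrD; lra.
  have := le_lt_trans k1 t2; have := le_lt_trans t1 k2; rewrite !ltr_nat; clear; lia.
have E : (num x)%:R = (Num.truncn (2 ^+ size x * alpha))%:R - (2 ^ size x * m)%:R :> R.
  by rewrite -h natrD addrK.
rewrite -[(Num.truncn _).+1%:R]natr1 in t2.
by rewrite -[(num x).+1%:R]natr1 E; apply/andP; split; lra.
Qed.

Section Weights.
Variables (R : realType) (T : R) (V : bstr -> option bstr).
Hypotheses (T0 : 0 < T) (T1 : T < 1) (pfV : prefix_free (dom V)).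
Variables (h : nat -> nat -> bool) (o : nat -> nat -> nat) (q : nat -> nat -> nat).
Hypotheses (hV : enumerates V h o) (hq : comp2 q).
Hypothesis qT : forall k j, (q k j)%:R <= 2 ^+ j * bweight T k <= (q k j)%:R + 2.

Let p0 m : 0 < 2 ^+ m :> R. Proof. by rewrite exprn_gt0. Qed.

Lemma bweight_powT k : bweight T k `^ T = 2 ^- k.
Proof. by rewrite /bweight -powRrM mulNr divfK ?gt_eqF // powR_invn. Qed.

Lemma bweight_gt0 k : 0 < bweight T k. Proof. by rewrite powR_gt0. Qed.

Lemma bweight_le1 k : bweight T k <= 1.
Proof. by apply: le_trans (bweight_le T0 T1 k) _; rewrite invf_le1 // exprn_ege1 // ler1n. Qed.

(** Here [T < 1] enters: the charges of one program at all levels form two geometric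
    series, with sum proportional to the measure of the program. *)
Lemma zevent_weights (g : nat -> nat) : (forall n, T * n%:R <= (g n)%:R) ->
  exists c : nat, forall N,
    \sum_(0 <= n < N) \sum_(0 <= s < N) (zevent h q n s)%:R / 2 ^+ (g n + c) <= 1 :> R.
Proof.
move=> Tg; have [C hC] := geometric_min T0 T1.
have C0 : 0 <= C.
  by have := hC 1 0%N ltr01 (lexx _); rewrite big_geq // powR1 mulr1.
have [|c hc] := @exp2_small R (6 * C + 1)^-1.
  by rewrite invr_gt0; lra.
(* The sum of [rho ^ n] and the total charge are both at most [C]. *)
exists c => N; have {}hc := hc c (leqnn c).
set rho := 2 `^ (- T) in hC *.
have rho0 n : 0 <= rho ^+ n by rewrite exprn_ge0 // powR_ge0.
have grho n : 2 ^- g n <= rho ^+ n.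
  rewrite -powR_invn // -[leRHS]powR_mulrn ?powR_ge0 // -powRrM.
  by rewrite ler_powR ?ler1n // mulNr lerN2.
apply: (@le_trans _ _ (2 ^- c * \sum_(0 <= n < N) rho ^+ n * (3 + 3 * charge T h n N))).
  rewrite mulr_sumr; apply: ler_sum => n _.
  rewrite -mulr_suml -natr_sum exprD invfM mulrA mulrC ler_pM2l ?invr_gt0 //.
  rewrite mulrC; apply: le_trans (_ : rho ^+ n * (\sum_(0 <= s < N) zevent h q n s)%:R <= _).
    by rewrite ler_wpM2r.
  by rewrite ler_wpM2l //; apply: (zevents_le T0 T1 hV qT).
have s1 : \sum_(0 <= n < N) rho ^+ n <= C.
  have := hC 1 N ltr01 (lexx _); rewrite powR1 mulr1; apply: le_trans.
  apply: ler_sum => n _; rewrite mulr1 (min_idPl _) ?mulr1 //.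
  by rewrite exprn_ege1 // ler1n.
have s2 : \sum_(0 <= n < N) rho ^+ n * charge T h n N <= C.
  rewrite (eq_bigr (fun n => \sum_(0 <= p < N) (h p N)%:R *
      (rho ^+ n * Num.min 1 (2 ^+ n * bweight T (slen p))))); last first.
    by move=> n _; rewrite /charge mulr_sumr; apply: eq_bigr => p _; rewrite mulrCA.
  rewrite exchange_big /=.
  apply: (@le_trans _ _ (C * \sum_(0 <= p < N) (h p N)%:R / 2 ^+ slen p)).
    rewrite mulr_sumr; apply: ler_sum => p _; rewrite -mulr_sumr mulrCA ler_wpM2l //.
    by rewrite -bweight_powT; apply: hC; [apply: bweight_gt0|apply: bweight_le1].
  by rewrite -[leRHS]mulr1 ler_wpM2l // (kraft_found R pfV hV).
have -> : \sum_(0 <= n < N) rho ^+ n * (3 + 3 * charge T h n N) =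
    3 * \sum_(0 <= n < N) rho ^+ n + 3 * \sum_(0 <= n < N) rho ^+ n * charge T h n N.
  by rewrite !mulr_sumr -big_split /=; apply: eq_bigr => n _; ring.
rewrite mulrC; apply: le_trans (_ : (6 * C + 1) * 2 ^- c <= _).
  by rewrite ler_pM2r ?invr_gt0 //; lra.
by rewrite mulrC -ler_pdivlMr ?mul1r ?ltW //; lra.
Qed.

End Weights.

Lemma strcode_bit b : strcode [:: b] = b.+1. Proof. by case: b. Qed.

(** The Kraft-Chaitin theorem for events arranged in levels, where all events of a level
    ask for the same length. *)
Lemma event_machine (R : realType) (ev : nat -> nat -> bool) (len : nat -> nat)
    (G : nat -> nat -> nat) :
  comp2 (fun n s => ev n s : nat) -> comp1 len -> comp2 G ->
  (forall N, \sum_(0 <= n < N) \sum_(0 <= s < N) (ev n s)%:R / 2 ^+ len n <= 1 :> R) ->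
  exists2 F, prefix_free_machine F & forall n s, ev n s ->
    (exists z, G (pairn n s) z != 0%N) ->
    exists p z, [/\ size p = (len n).+1, G (pairn n s) z != 0%N &
      F p = Some (str (G (pairn n s) z).-1)].
Proof.
move=> he hl hG le1.
pose ev' i := (pairn (fstn i) (sndn i) == i) && ev (fstn i) (sndn i).
pose len' i := len (fstn i).
have he' : comp1 (fun i => ev' i : nat) by rewrite /ev'; comp_tac.
have hl' : comp1 len' by rewrite /len'; comp_tac.
have [|F pF hF] := @kraft_machine R ev' len' _ G he' hl' hG.
  move=> N; apply: le_trans (le1 N).
  apply: le_trans (sum_pairs N (_ : forall n s, 0 <= (ev n s)%:R / 2 ^+ len n :> R)) => [|n s].
    by apply: ler_sum => i _; rewrite /ev' -mulnb natrM mulrA.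
  by rewrite divr_ge0 // exprn_ge0.
exists F => // n s ens ex.
have [|p [z [sp Gz e]]] := hF (pairn n s) _ ex.
  by rewrite /ev' pairnK1 pairnK2 eqxx.
by exists p, z; rewrite sp /len' pairnK1.
Qed.

Section Reduction.
Variables (R : realType) (T : R) (V W : bstr -> option bstr) (f : nat -> nat).
Hypotheses (hT : computable_real T) (T0 : 0 < T) (T1 : T < 1).
Hypotheses (hV : optimal_machine V) (hW : optimal_machine W) (hf : comp1 f).

(** The first bits of a dyadic number are computable, so no question has to be asked. *)
Lemma Pf_reducible_dyadic n0 m : 2 ^+ n0 * Z V T = m%:R ->
  reducible_in_query_size f (Pf (Z V T)) (dom W).
Proof.
move=> dy; have p0 k : 0 < 2 ^+ k :> R by rewrite exprn_gt0.
have ZE : Z V T = m%:R / 2 ^+ n0 by rewrite -dy mulrC mulKf // gt_eqF.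
have Z0 : 0 <= Z V T by rewrite ZE divr_ge0.
pose U x (K s : nat) := (numn x + 2 ^ slen x * Num.truncn (Z V T) ==
   (2 ^ slen x * m) %/ 2 ^ n0).+1%N.
have hU : comp3 U by rewrite /U; comp_tac.
have hP : comp3 (fun _ _ _ => 1%N) by apply: comp_const.
have hb : comp1 (fun=> 0%N) by apply: comp_const.
have [|M [out qs]] := @oracle_search_machine _ _ U (dom W) hb hP hU; first by exists 0%N.
exists M; split=> [x|x w /qs //].
have [s [_]] := out x; set b := (X in str X.+1); rewrite -strcode_bit strcodeK.
suff -> : (x \in Pf (Z V T)) = (numn (strcode x) + 2 ^ slen (strcode x) *
    Num.truncn (Z V T) == (2 ^ slen (strcode x) * m) %/ 2 ^ n0)%N :> bool by [].
rewrite slen_strcode /numn strcodeK.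
have -> : ((2 ^ size x * m) %/ 2 ^ n0)%N = Num.truncn (2 ^+ size x * Z V T).
  apply/esym/truncn_def; rewrite ZE mulrA -natrX -natrM -natrX.
  rewrite ler_pdivlMr ?ltr0n ?expn_gt0 // ltr_pdivrMr ?ltr0n ?expn_gt0 //.
  by rewrite -!natrM ler_nat ltr_nat leq_divM -ltn_divLR ?expn_gt0 //=.
by apply/idP/eqP; rewrite inE; move/(Pf_nat _ Z0).
Qed.

(** The machine counts the strings of [dom W] up to length [f n + c'], waits until as many
    have been found, and takes a stage beyond all their outputs; this is beyond the last
    event at level [n], because [W] describes the stage of that event.  For dyadic [Z] the
    approximations from below would never show the right bits. *)
Lemma Pf_reducible c : (forall n, T * n%:R <= (f n + c)%:R) ->
  exists c', reducible_in_query_size (fun n => (f n + c')%N) (Pf (Z V T)) (dom W).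
Proof.
move=> Tf; have [[pV pfV] _] := hV; have [[pW _] oW] := hW.
have [dy|nd] := pselect (exists n0 (m : nat), 2 ^+ n0 * Z V T = m%:R).
  have [n0 [m e]] := dy; exists 0%N.
  by under eq_fun do rewrite addn0; apply: Pf_reducible_dyadic e.
have {}nd n (m : nat) : 2 ^+ n * Z V T != m%:R.
  by apply/eqP => e; apply: nd; exists n, m.
have [h [v eV]] := partial_recursive_enum pV.
have [hw [vw eW]] := partial_recursive_enum pW.
have [q hq qT] := weight_approx hT T0 T1.
have Z0 : 0 <= Z V T.
  by apply: le_trans (Zpart_le T0 T1 pfV eV 0); rewrite /Zpart big_geq.
have [c0 hc0] := zevent_weights T0 T1 pfV eV qT Tf.
have hz := comp2_zbits eV hq.
have hev : comp2 (fun n s => zevent h q n s : nat).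
  by rewrite /zevent; comp_tac.
have hl : comp1 (fun n => f n + c + c0)%N by comp_tac.
have hG : comp2 (fun i (_ : nat) => (sndn i).+1) by comp_tac.
have [F pF hF] := event_machine hev hl hG hc0.
have [d hd] := oW F pF.
(* One bit is lost by the codewords, and [d] by the passage from [F] to [W]. *)
pose c' := (c + c0 + 1 + d)%N; exists c'.
pose bnd x := (2 ^ (f (slen x) + c').+1 - 1)%N.
pose found x s := (\sum_(0 <= i < bnd x) hw i s)%N.
pose stage x s := (slen x + \sum_(0 <= i < bnd x) hw i s * vw i s)%N.
pose P x K s := (K <= found x s : nat)%N.
pose U x (K : nat) s := (numn x + 2 ^ slen x * Num.truncn (Z V T) ==
   zbits h q (slen x) (stage x s)).+1%N.
have hhw := enum_comph eW; have hvw := enum_compo eW.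
have hb : comp1 bnd by rewrite /bnd; comp_tac.
have hfound : comp2 found by rewrite /found; comp_tac.
have hstage : comp2 stage by rewrite /stage; comp_tac.
have hP : comp3 P by rewrite /P; comp_tac.
have hU : comp3 U by rewrite /U; comp_tac.
have foundE x s : (forall i, (i < bnd x)%N -> (str i \in dom W) = hw i s) <->
    (\sum_(0 <= i < bnd x) (str i \in dom W) <= found x s)%N.
  have le i : (hw i s <= (str i \in dom W))%N.
    case e : (hw i s) => //; rewrite (_ : str i \in dom W) //.
    by rewrite inE; apply/(enum_dom eW); exists s.
  split=> [e|/(leq_sum_eq le) e i /e].
    by rewrite /found big_nat [leqRHS]big_nat leq_sum // => i /andP[_ /e->].
  by case: (str i \in dom W); case: (hw i s).
have [x|M [out qs]] := @oracle_search_machine bnd P U (dom W) hb hP hU.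
  have [s hs] := enum_below (bnd x) eW; exists s; rewrite /P eqb0 negbK.
  apply/foundE => i ib; apply/idP/idP => [|hi]; first exact: hs.
  by rewrite inE; apply/(enum_dom eW); exists s.
exists M; split=> x; last first.
  move=> w /qs; rewrite /bnd -slen_leq !slen_strcode.
  by [].
have [s [Ps]] := out x; rewrite /U -strcode_bit strcodeK.
rewrite eqb0 negbK in Ps; have {}Ps := (foundE _ _).2 Ps.
set n := slen (strcode x) in Ps *.
have nx : n = size x by rewrite /n slen_strcode.
suff -> : zbits h q n (stage (strcode x) s) = Num.truncn (2 ^+ n * Z V T).
  suff -> : (x \in Pf (Z V T)) = (numn (strcode x) + 2 ^ n *
    Num.truncn (Z V T) == Num.truncn (2 ^+ n * Z V T))%N :> bool by [].
  by rewrite /numn strcodeK nx; apply/idP/eqP; rewrite inE; move/(Pf_nat _ Z0).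
have [s1 hs1] := zbits_lim T0 T1 pfV eV qT (nd n).
have zb t : (zbits h q n t <= Num.truncn (2 ^+ n * Z V T))%N.
  have Zn0 : 0 <= 2 ^+ n * Z V T by rewrite mulr_ge0.
  have /andP[_ t2] := truncn_itv Zn0.
  rewrite -ltnS -(ltr_nat R); apply: le_lt_trans (zbits_le eV qT n t) _.
  apply: le_lt_trans t2; by rewrite ler_wpM2l // (Zpart_le T0 T1 pfV eV).
have [s0 [ns0 es0 last]] := last_event n (@zbits_mono h q n) zb.
have z0 : zbits h q n s0 = Num.truncn (2 ^+ n * Z V T).
  by rewrite -(last (maxn s0 s1)) ?leq_maxl // hs1 // leq_maxr.
have [|p [z [sp _ Fp]]] := hF n s0 es0; first by exists 0%N.
rewrite pairnK2 in Fp.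
have [|r [Wr er sr]] := hd p; first by rewrite /dom /= Fp.
have rb : (strcode r < bnd (strcode x))%N.
  by rewrite /bnd -slen_leq -/n slen_strcode (leq_trans sr) // sp /c'; lia.
have hr : hw (strcode r) s by rewrite -Ps // inE strcodeK.
have vr : vw (strcode r) s = s0.
  by have := enum_val eW hr; rewrite strcodeK er Fp => -[/str_inj].
rewrite last ?z0 // /stage (bigD1_seq (strcode r)) ?mem_index_iota ?iota_uniq //=.
by rewrite hr vr mul1n addnCA leq_addr.
Qed.

End Reduction.

(** * From the partition function to the halting problem *)

Lemma run_agree (M : otm) (B B' : set bstr) x t :
  (forall w, queries M B x w -> (w \in B) = (w \in B')) -> run M B x t = run M B' x t.
Proof.
move=> agree; elim: t => [//|t IH]; rewrite /run !iterS -/(run M B x t) -/(run M B' x t) -IH.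
rewrite /step; case: ifP => // nh.
case e : (otm_query (run M B x t).1) => [[y n]|//].
by rewrite agree //; exists t; rewrite nh e.
Qed.

(** The values of [f] at its jumps are distinct, so the sum is at most that of a full
    geometric series starting at [2 ^ - a]. *)
Lemma jump_sum (R : realFieldType) (f : nat -> nat) c a N : {homo f : m n / (m <= n)%N} ->
  \sum_(0 <= n < N) ((f n < f n.+1)%N && (a <= f n + c)%N)%:R / 2 ^+ (f n + c) <=
  2 / 2 ^+ a :> R.
Proof.
move=> mono; have i0 k : 0 < (2 ^+ k)^-1 :> R by rewrite invr_gt0 exprn_gt0.
have le2 k l : (k <= l)%N -> (2 ^+ l)^-1 <= (2 ^+ k)^-1 :> R.
  by move=> kl; rewrite lef_pV2 ?posrE ?exprn_gt0 // ler_weXn2l // ler1n.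
suff : \sum_(0 <= n < N) ((f n < f n.+1)%N && (a <= f n + c)%N)%:R / 2 ^+ (f n + c) <=
    2 / 2 ^+ a - 2 / 2 ^+ maxn a (f N + c) :> R.
  by move=> h; apply: le_trans h _; rewrite gerBl ltW // mulr_gt0.
elim: N => [|N IH].
  by rewrite big_geq // subr_ge0 ler_pM2l // le2 // leq_maxl.
rewrite big_nat_recr //=.
case: (boolP ((f N < f N.+1)%N && (a <= f N + c)%N)) => [/andP[lt aN]|_].
  rewrite (maxn_idPr aN) in IH; have aN' : (a <= f N.+1 + c)%N by lia.
  have l1 : ((f N + c).+1 <= f N.+1 + c)%N by lia.
  by have := le2 _ _ l1; rewrite mul1r (maxn_idPr aN') exprS invfM; lra.
have l1 : (maxn a (f N + c) <= maxn a (f N.+1 + c))%N.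
  by have := mono N N.+1 (leqnSn N); lia.
by have := le2 _ _ l1; rewrite mul0r; lra.
Qed.

Section Converse.
Variables (R : realType) (T : R) (V W : bstr -> option bstr) (f : nat -> nat) (c : nat).
Hypotheses (hT : computable_real T) (T0 : 0 < T) (T1 : T < 1).
Hypotheses (hV : optimal_machine V) (hW : optimal_machine W) (hf : comp1 f).
Hypotheses (fmono : {homo f : m n / (m <= n)%N}).
Variables (M : otm).
Hypothesis MPf : turing_reducible_via M (Pf (Z V T)) (dom W).
Hypothesis Mf : forall x w, queries M (dom W) x w -> (size w <= f (size x) + c)%N.
Variables (h hw : nat -> nat -> bool) (v vw : nat -> nat -> nat) (q : nat -> nat -> nat).
Hypotheses (eV : enumerates V h v) (eW : enumerates W hw vw) (hq : comp2 q).
Hypothesis qT : forall k j, (q k j)%:R <= 2 ^+ j * bweight T k <= (q k j)%:R + 2.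

Let p0 m : 0 < 2 ^+ m :> R. Proof. by rewrite exprn_gt0. Qed.
Let pfV : prefix_free (dom V) := hV.1.2.
Let pfW : prefix_free (dom W) := hW.1.2.

Let bnd n := (2 ^ (f n + c).+1 - 1)%N.
Let cnt n s := (\sum_(0 <= i < bnd n) hw i s)%N.
Let mask n s := (\sum_(0 <= i < bnd n) hw i s * 2 ^ i)%N.
Let event n s := (f n < f n.+1)%N && ((s == 0%N) || (cnt n s != cnt n s.-1)).

Lemma cnt_mono n : {homo cnt n : s t / (s <= t)%N}.
Proof.
move=> s t st; apply: leq_sum => i _.
by case e : (hw i s) => //; rewrite (enum_mono eW st e).
Qed.

(** A string found in [dom W] makes one event at each level whose bound is at least its
    length; by [jump_sum] these weigh at most twice the measure of the string, and the
    additional events at stage 0 weigh at most two. *)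
Lemma event_weights N : \sum_(0 <= n < N) \sum_(0 <= s < N)
  (event n s)%:R / 2 ^+ (f n + c + 2) <= 1 :> R.
Proof.
pose B := (\sum_(0 <= n < N) bnd n)%N.
pose jump n := (f n < f n.+1)%N.
have cntE n : (n < N)%N ->
    cnt n N = (\sum_(0 <= i < B) (slen i <= f n + c) * hw i N)%N.
  move=> nN; have le : (bnd n <= B)%N.
    by rewrite /B (bigD1_seq n) ?mem_index_iota ?iota_uniq //= leq_addr.
  rewrite (@big_cat_nat _ _ _ (bnd n)) //= [X in (_ + X)%N]big_nat [X in (_ + X)%N]big1.
    rewrite addn0 /cnt; apply: eq_big_nat => i /andP[_ ib].
    by rewrite slen_leq ib mul1n.
  by move=> i /andP[bi _]; rewrite slen_leq ltnNge bi.
apply: (@le_trans _ _ (4^-1 * \sum_(0 <= n < N) ((jump n)%:R / 2 ^+ (f n + c) +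
   \sum_(0 <= i < B) (hw i N)%:R * ((jump n && (slen i <= f n + c)%N)%:R / 2 ^+ (f n + c))))).
  rewrite mulr_sumr big_nat [leRHS]big_nat; apply: ler_sum => n /andP[_ nN].
  rewrite -mulr_suml -natr_sum exprD invfM mulrA mulrC.
  have -> : 2 ^+ 2 = 4 :> R by rewrite -natrX.
  rewrite ler_pM2l ?invr_gt0 //.
  apply: (@le_trans _ _ ((jump n)%:R * (1 + cnt n N)%:R / 2 ^+ (f n + c))).
    rewrite ler_pM2r ?invr_gt0 // -natrM ler_nat /event -/(jump n).
    case: (jump n); last by rewrite big1.
    rewrite mul1n; apply: changes_le; exact: cnt_mono.
  rewrite natrD mulrDr mulrDl mulr1 lerD2l cntE // natr_sum mulr_sumr mulr_suml.
  apply: ler_sum => i _; rewrite natrM -mulnb natrM le_eqVlt; apply/orP; left.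
  by apply/eqP; ring.
rewrite big_split /= mulrDr.
have s1 : \sum_(0 <= n < N) (jump n)%:R / 2 ^+ (f n + c) <= 2 :> R.
  have := @jump_sum R f c 0 N fmono; rewrite expr0 divr1; apply: le_trans.
  by apply: ler_sum => n _; rewrite leq0n andbT.
have s2 : \sum_(0 <= n < N) \sum_(0 <= i < B) (hw i N)%:R *
    ((jump n && (slen i <= f n + c)%N)%:R / 2 ^+ (f n + c)) <= 2 :> R.
  rewrite exchange_big /=.
  apply: (@le_trans _ _ (2 * \sum_(0 <= i < B) (hw i N)%:R / 2 ^+ slen i)).
    rewrite mulr_sumr; apply: ler_sum => i _; rewrite -mulr_sumr mulrCA ler_wpM2l //.
    exact: jump_sum.
  by rewrite -[leRHS]mulr1 ler_pM2l // (kraft_found R pfW eW).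
lra.
Qed.

(** The reduction is run with the oracle known at the event.  When this is the true one,
    [x] is the string of the first [n] bits of [Z], and the last condition says that the
    approximation at stage [t] misses [Z] by less than [2 / 2 ^ n].  The number two is the
    code of the answer yes, the string with the single bit 1. *)
Let good n s x t r :=
  [&& slen x == n, simh M x r (mask n s), simo M x r (mask n s) == 2 &
      (2 ^ n * Num.truncn (Z V T) + numn x) * 2 ^ (t + t) <=
        2 ^ n * znum h q t + 2 ^ (t + t)]%N.

(** The code of a string that is no output found by stage [t]. *)
Let fresh t := (\sum_(0 <= p < t) h p t * v p t).+1%N.

Let answer i z :=
  let x := fstn z in let t := fstn (sndn z) in let r := sndn (sndn z) in
  if good (fstn i) (sndn i) x t r then (fresh t).+1 else 0%N.

Lemma comp2_event : comp2 (fun n s => event n s : nat).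
Proof.
have hhw := enum_comph eW; have hb : comp1 bnd by rewrite /bnd; comp_tac.
have hc : comp2 cnt by rewrite /cnt; comp_tac.
by rewrite /event; comp_tac.
Qed.

Lemma comp2_answer : comp2 answer.
Proof.
have hhw := enum_comph eW; have hb : comp1 bnd by rewrite /bnd; comp_tac.
have hm : comp2 mask by rewrite /mask; comp_tac.
have hh := enum_comph eV; have hv := enum_compo eV.
have hz := comp1_znum eV hq.
have hfr : comp1 fresh by rewrite /fresh; comp_tac.
have h1 := comp3_simh M; have h2 := comp3_simo M.
by rewrite /answer /good; cbv zeta; comp_tac.
Qed.

(** At the last event of level [n] the answer is a string that [V] has not put out by a
    stage [t] at which its partial sum is within [2 / 2 ^ n] of [Z].  A program of [V] for
    it has weight less than [2 / 2 ^ n], so its length exceeds [T * (n - 1)], while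
    optimality makes it at most [f n + O(1)]. *)
Lemma jump_bound : exists d : nat, forall n, (f n < f n.+1)%N -> T * n%:R <= (f n + d)%:R.
Proof.
have hl : comp1 (fun n => f n + c + 2)%N by comp_tac.
have [F pF hF] := event_machine comp2_event hl comp2_answer event_weights.
have [d hd] := hV.2 F pF.
(* Two bits for the Kraft inequality, one for the codewords, and one for [T <= 1]. *)
exists (c + 3 + d + 1)%N => n jump.
have cntB s : (cnt n s <= bnd n)%N.
  apply: leq_trans (_ : \sum_(0 <= i < bnd n) 1 <= _)%N.
    by apply: leq_sum => i _; apply: leq_b1.
  by rewrite sum_nat_const_nat subn0 muln1.
have [s [_ es last]] := last_event 0 (@cnt_mono n) cntB.
have {}es : event n s.
  by rewrite /event jump; case/orP: es => [->|/andP[_ ->]]; rewrite ?orbT.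
have found i : (i < bnd n)%N -> (str i \in dom W) = hw i s.
  move=> ib; apply/idP/idP => [iW|hi]; last by rewrite inE; apply/(enum_dom eW); exists s.
  have [t ht] := enum_below (bnd n) eW.
  have le j : (hw j s <= hw j (maxn s t))%N.
    by case e : (hw j s) => //; rewrite (enum_mono eW _ e) // leq_maxl.
  have := leq_sum_eq le _ ib; rewrite -/(cnt n s) -/(cnt n (maxn s t)) last ?leq_maxl //.
  move=> /(_ (leqnn _)); rewrite (enum_mono eW _ (ht _ ib iW)) ?leq_maxr //.
  by case: (hw i s).
have maskE w : (size w <= f n + c)%N -> (w \in dom W) = (w \in maskset (mask n s)).
  move=> sw; have wb : (strcode w < bnd n)%N by rewrite /bnd -slen_leq slen_strcode.
  rewrite -[w in LHS]strcodeK found //.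
  by apply/idP/idP; rewrite inE /maskset /= odd_mask wb.
have runE x r : slen x = n ->
    run M (maskset (mask n s)) (str x) r = run M (dom W) (str x) r.
  move=> sx; apply/esym/run_agree => w /Mf; rewrite size_str sx; exact: maskE.
have Z0 : 0 <= Z V T.
  by apply: le_trans (Zpart_le T0 T1 pfV eV 0); rewrite /Zpart big_geq.
have tE t : (2 ^ n * znum h q t)%:R / 2 ^+ (t + t) = 2 ^+ n * zapprox R h q t.
  by rewrite /zapprox natrM natrX -addnn mulrA.
have Pf_bounds x : slen x = n -> Pf (Z V T) (str x) ->
    (2 ^ n * Num.truncn (Z V T) + numn x)%:R <= 2 ^+ n * Z V T <
    (2 ^ n * Num.truncn (Z V T) + numn x)%:R + 1.
  move=> sx /(Pf_nat _ Z0); rewrite size_str sx -/(numn x) addnC => ->.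
  by rewrite natr1; apply: truncn_itv; rewrite mulr_ge0.
have goodE x t r : slen x = n -> good n s x t r =
  [&& halted (run M (dom W) (str x) r),
    output (run M (dom W) (str x) r) == [:: true] &
    (2 ^ n * Num.truncn (Z V T) + numn x)%:R <= 2 ^+ n * zapprox R h q t + 1].
  move=> sx; rewrite /good sx eqxx /simh /simo runE //=; congr [&& _, _ & _].
    by rewrite -[X in _ == X]/(strcode [:: true]) (inj_eq strcode_inj).
  rewrite -tE; set a := (_ + numn x)%N; set b := (2 ^ n * znum h q t)%N.
  rewrite -(@ler_nat R) [(a * _)%:R]natrM [(b + _)%:R]natrD natrX -ler_pdivlMr //.
  by rewrite mulrDl divff // gt_eqF.
have [z gz] : exists z, answer (pairn n s) z != 0%N.
  have [b hb] := base_two_expansion_ex (Z V T).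
  pose x := strcode (mkseq b n).
  have sx : slen x = n by rewrite slen_strcode size_mkseq.
  have xP : Pf (Z V T) (str x) by rewrite strcodeK; exists b, n.
  have [r [hr er]] := MPf (str x).
  have [|t1 ht1] := @Zpart_lt R T V T0 T1 pfV h v eV (Z V T - 2 ^- n / 2).
    by rewrite ltrBlDr ltrDl divr_gt0 // invr_gt0.
  have [|t2 ht2] := @exp2_small R (2 ^- n / 2); first by rewrite divr_gt0 // invr_gt0.
  pose t := maxn t1 t2.
  exists (pairn x (pairn t r)); rewrite /answer !pairnK1 !pairnK2 !pairnK1 goodE //.
  rewrite hr er (_ : _ \in _) ?inE // eqxx /=.
  suff -> : (2 ^ n * Num.truncn (Z V T) + numn x)%:R <= 2 ^+ n * zapprox R h q t + 1 by [].
  have /andP[l1 _] := Pf_bounds x sx xP; apply: le_trans l1 _.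
  have l2 := ht1 t (leq_maxl _ _); have l3 := ht2 t (leq_maxr _ _).
  have /andP[l4 _] := zapproxP h qT t.
  have : 2 ^+ n * (Z V T - 2 ^- n) <= 2 ^+ n * zapprox R h q t.
    by rewrite ler_pM2l //; lra.
  by rewrite mulrBr divff ?gt_eqF //; lra.
have [|p [z' [sp Gz Fp]]] := hF n s es; first by exists z.
have [|r [Vr er sr]] := hd p; first by rewrite /dom /= Fp.
move: Gz Fp; rewrite /answer pairnK1 pairnK2.
set x := fstn z'; set t := fstn _; set r' := sndn _.
case: (boolP (good n s x t r')) => // gd _ /= Fp.
have sx : slen x = n by move: gd => /and4P[/eqP].
have := gd; rewrite goodE // => /and3P[g1 /eqP g2 g3].
have xP : Pf (Z V T) (str x).
  have [t' [ht' et']] := MPf (str x).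
  have : output (run M (dom W) (str x) r') = [:: str x \in Pf (Z V T)].
    by apply: (@outputs_inj M (dom W) (str x)); [exists r'|exists t'].
  by rewrite g2 => -[e]; apply: set_mem; rewrite -e.
have /andP[_ b2] := Pf_bounds x sx xP.
have /andP[_ z2] := zapproxP h qT t.
have miss : ~~ ((strcode r < t)%N && h (strcode r) t).
  apply/negP => /andP[rt hr].
  have := enum_val eV hr; rewrite strcodeK er Fp => -[/str_inj e].
  suff : (v (strcode r) t < fresh t)%N by rewrite -e ltnn.
  rewrite /fresh ltnS (bigD1_seq (strcode r)) ?mem_index_iota ?iota_uniq //=.
  by rewrite hr mul1n leq_addr.
have rV : str (strcode r) \in dom V by rewrite strcodeK; apply: mem_set.
have le := Zpart_missing T0 T1 pfV eV rV miss; rewrite slen_strcode in le.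
have small : 2 ^+ n * bweight T (size r) < 2.
  have : 2 ^+ n * bweight T (size r) <= 2 ^+ n * (Z V T - Zpart T h t).
    by rewrite ler_pM2l //; lra.
  have : 2 ^+ n * zapprox R h q t <= 2 ^+ n * Zpart T h t by rewrite ler_pM2l.
  by rewrite mulrBr; lra.
have expo : n%:R - (size r)%:R / T < 1.
  rewrite ltNge; apply/negP => ge1; move: small; apply/negP; rewrite -leNgt.
  rewrite -[2 ^+ n]powR_mulrn // /bweight -powRD ?pnatr_eq0 ?implybT //.
  by rewrite -[leLHS]powRr1 // ler_powR ?ler1n.
have Tn : T * n%:R <= (size r)%:R + 1.
  move: expo; rewrite ltrBlDr -(ltr_pM2l T0) mulrDr mulr1 mulrCA divff ?gt_eqF // mulr1.
  by move=> lt; apply: le_trans (ltW lt) _; rewrite addrC lerD2l ltW.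
apply: le_trans Tn _; rewrite natr1 ler_nat; move: sr; rewrite sp; clear; lia.
Qed.

End Converse.

(** Replace [n] by the last argument with the same value of [f], which is a jump. *)
Lemma bound_of_jumps (R : realFieldType) (T : R) (f : nat -> nat) d :
  0 < T -> {homo f : m n / (m <= n)%N} -> (forall A, exists n, (A < f n)%N) ->
  (forall n, (f n < f n.+1)%N -> T * n%:R <= (f n + d)%:R) ->
  forall n, T * n%:R <= (f n + d)%:R.
Proof.
move=> T0 mono unb jump n; case: (ex_minnP (unb (f n))) => m fm mmin.
have nm : (n < m)%N by rewrite ltnNge; apply/negP => /mono; rewrite leqNgt fm.
case: m fm mmin nm => // m fm mmin nm.
have fE : f m = f n.
  have le : (f m <= f n)%N by rewrite leqNgt; apply/negP => /mmin; rewrite ltnn.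
  by apply/eqP; rewrite eqn_leq le; apply: mono.
apply: le_trans (_ : T * m%:R <= _); first by rewrite ler_pM2l // ler_nat.
by rewrite -fE jump // fE.
Qed.

Lemma order_function_unbounded f : order_function f -> forall A, exists n, (A < f n)%N.
Proof.
move=> [_ _ lim] A; have /= := lim (fun n => (A < n)%N : Prop).
case; first by exists A.+1.
by move=> N _ /(_ N (leqnn N)) /= h; exists N.
Qed.

Theorem theorem6p1 (R : realType) (T : R)
  (V W : seq bool -> option (seq bool)) (f : nat -> nat)
  (hT : computable_real T) (hT0 : 0 < T) (hT1 : T < 1)
  (hV : optimal_machine V) (hW : optimal_machine W)
  (hf : order_function f) :
  (exists c : nat,
     reducible_in_query_size (fun n => (f n + c)%N) (Pf (Z V T)) (dom W)) <->
  (exists c : nat, forall n : nat, T * n%:R <= (f n + c)%:R).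
Proof.
have unb := order_function_unbounded hf; have [/total_recursive_comp fc mono _] := hf.
split=> [[c [M [MPf Mf]]]|[c Tf]]; last exact: (Pf_reducible hT hT0 hT1 hV hW fc Tf).
have [h [v eV]] := partial_recursive_enum hV.1.1.
have [hw [vw eW]] := partial_recursive_enum hW.1.1.
have [q hq qT] := weight_approx hT hT0 hT1.
have [d hd] := jump_bound hT0 hT1 hV hW fc mono MPf Mf eV eW hq qT.
by exists d; apply: bound_of_jumps.
Qed.
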